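(* Let $\mathcal G\rightrightarrows M$ be a Lie groupoid and $\mathcal V\rightrightarrows E$ a regular VB-groupoid over $\mathcal G$ with core $C$ and core-anchor $\partial:C\to E$; let $\mathfrak k=\operatorname{Ker}\partial$ and $\mathfrak l=\operatorname{Coker}\partial$. Then there exists a map $K:H^{\bullet}(\mathcal G,\mathfrak l)\to H^{\bullet+2}(\mathcal G,\mathfrak k)$ such that the cohomology $H^*_{VB}(\mathcal G,\mathcal V)$ fits into a long exact sequence $$\cdots\to H^k(\mathcal G,\mathfrak k)\xrightarrow{\,r\,}H^k_{VB}(\mathcal G,\mathcal V)\xrightarrow{\,\pi\,}H^{k-1}(\mathcal G,\mathfrak l)\xrightarrow{\,K\,}H^{k+1}(\mathcal G,\mathfrak k)\to\cdots,$$ where $r$ and $\pi$ are the maps induced by right multiplication by zero elements of $\mathcal V$ and by the $\tilde s$-projection of elements of $\mathcal V$, respectively.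
   Context: A VB-groupoid $(\mathcal V,E,\mathcal G,M)$ consists of Lie groupoids $\mathcal V\rightrightarrows E$ (source $\tilde s$, target $\tilde t$, inversion $i_{\mathcal V}$) and $\mathcal G\rightrightarrows M$ (source $s$, target $t$) and vector bundles $\mathcal V\to\mathcal G$, $E\to M$ such that all structure maps of $\mathcal V$ are vector bundle morphisms over those of $\mathcal G$. The core $C\to M$ is the restriction to the units $M\subset\mathcal G$ of $\ker(\mathcal V\to s^*E)$, the map being induced by $\tilde s$; $\partial:C\to E$ is the restriction of $\tilde t$. $\mathcal V$ is regular if $\partial$ has constant rank; then $\mathfrak k,\mathfrak l$ are vector bundles over $M$ carrying representations of $\mathcal G$: $g\cdot c=0_g\cdot c\cdot0_g^{-1}$ on $\mathfrak k$ ($0_g$ the zero of $\mathcal V_g$), and $g\cdot[e]=[\tilde t(\gamma)]$ on $\mathfrak l$, for any $\gamma\in\mathcal V_g$ with $\tilde s(\gamma)=e$. $H^\bullet(\mathcal G,\mathfrak k)$ and $H^\bullet(\mathcal G,\mathfrak l)$ denote differentiable groupoid cohomology with values in these representations (zero in negative degrees). VB-complex: $C^0_{VB}(\mathcal G,\mathcal V)=\Gamma(C)$ with $(\delta\alpha)(g)=\alpha_{t(g)}\cdot0_g+0_g\cdot i_{\mathcal V}(\alpha_{s(g)})$. For $k\ge1$, $C^k_{VB}(\mathcal G,\mathcal V)$ is the space of smooth maps $c:\mathcal G^{(k)}\to\mathcal V$ on composable $k$-strings with $c(g_1,\dots,g_k)\in\mathcal V_{g_1}$ and $\tilde s(c(g_1,\dots,g_k))$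 independent of $g_1$, with $$(\delta c)(g_1,\dots,g_{k+1})=-c(g_1g_2,g_3,\dots)\cdot c(g_2,\dots,g_{k+1})^{-1}+\sum_{i=2}^k(-1)^ic(\dots,g_ig_{i+1},\dots)+(-1)^{k+1}c(g_1,\dots,g_k).$$ Its cohomology is $H^*_{VB}(\mathcal G,\mathcal V)$. The map $r$ is induced by $r(c)(g_1,\dots,g_k)=c(g_1,\dots,g_k)\cdot0_{g_1}$, and $\pi$ by sending $c$ to the class in $\mathfrak l$ of the $\tilde s$-projection $(g_2,\dots,g_k)\mapsto\tilde s(c(g_1,\dots,g_k))$. *)

(* Defs.v *)
From HB Require Import structures.
From mathcomp Require Import all_boot all_order all_algebra.
From mathcomp Require Import all_classical all_reals topology normedtype derive.

Set Implicit Arguments.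
Unset Strict Implicit.
Unset Printing Implicit Defensive.

Import Order.TTheory GRing.Theory Num.Theory.
Import numFieldNormedType.Exports.

Local Open Scope classical_set_scope.
Local Open Scope ring_scope.

(** * Smooth manifolds and smooth maps *)

Section Manifolds.
Context {R : realType}.

Fixpoint class_C (j : nat) {X Y : normedModType R} (W : set X) (f : X -> Y)
    : Prop :=
  (forall x, W x -> {for x, continuous f}) /\
  (if j is j'.+1 then
     forall v : X, (forall x, W x -> derivable f x v) /\ class_C j' W ('D_v f)
   else True).

Definition smooth_fun {X Y : normedModType R} (W : set X) (f : X -> Y) : Prop :=
  forall j, class_C j W f.

Record chart (T : topologicalType) (n : nat) := Chart {
  chart_dom : set T ;
  chart_map :> T -> 'rV[R]_n ;
  chart_inv : 'rV[R]_n -> T }.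

Definition is_chart (T : topologicalType) (n : nat) (phi : chart T n) : Prop :=
  [/\ open (chart_dom phi), open (phi @` chart_dom phi),
      {within chart_dom phi, continuous phi},
      {within phi @` chart_dom phi, continuous (chart_inv phi)} &
      forall x, chart_dom phi x -> chart_inv phi (phi x) = x].

(* The atlas need not be maximal. *)
Record manifold (n : nat) := Manifold {
  mtop :> topologicalType ;
  atlas : set (chart mtop n) ;
  manifold_hausdorff : hausdorff_space mtop ;
  manifold_second_countable : @second_countable mtop ;
  atlas_chart : forall phi, atlas phi -> is_chart phi ;
  atlas_cover : forall x, exists2 phi, atlas phi & chart_dom phi x ;
  atlas_compat : forall phi psi, atlas phi -> atlas psi ->
    smooth_fun (phi @` (chart_dom phi `&` chart_dom psi))
      (fun x => psi (chart_inv phi x)) }.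

(* A k-tuple of points of X, each read in its own chart: the product chart on
   X^k, with values in (R^n)^k seen as k x n matrices. *)
Definition coords (n k : nat) (X : manifold n) (phi : 'I_k -> chart X n)
    (q : 'I_k -> X) : 'M[R]_(k, n) :=
  \matrix_(i < k) phi i (q i).

(* Smoothness of a map defined on a subset S of the product manifold X^k, in
   the usual sense: near each point of S, the map is the restriction of a
   smooth map defined on an open subset of X^k.  When S is an embedded
   submanifold, such as the manifold of composable strings, this is smoothness
   for the submanifold structure. *)
Definition smooth_on (n m k : nat) (X : manifold n) (Y : manifold m)
    (S : set ('I_k -> X)) (f : ('I_k -> X) -> Y) : Prop :=
  forall (p : 'I_k -> X) (phi : 'I_k -> chart X n) (psi : chart Y m),
    S p -> (forall i, atlas (phi i) /\ chart_dom (phi i) (p i)) ->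
    atlas psi -> chart_dom psi (f p) ->
    exists (W : set 'M[R]_(k, n)) (F : 'M[R]_(k, n) -> 'rV[R]_m),
      [/\ open W, W (coords phi p), smooth_fun W F &
          forall q, S q -> (forall i, chart_dom (phi i) (q i)) ->
            W (coords phi q) ->
            chart_dom psi (f q) /\ psi (f q) = F (coords phi q)].

Definition smooth (n m : nat) (X : manifold n) (Y : manifold m) (f : X -> Y)
    : Prop :=
  smooth_on [set: 'I_1 -> X] (fun q => f (q ord0)).

Definition submersion (n m : nat) (X : manifold n) (Y : manifold m)
    (f : X -> Y) : Prop :=
  smooth f /\
  forall (x : X) (phi : chart X n) (psi : chart Y m),
    atlas phi -> chart_dom phi x -> atlas psi -> chart_dom psi (f x) ->
    forall w : 'rV[R]_m, exists v : 'rV[R]_n,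
      'D_v (fun y => psi (f (chart_inv phi y))) (phi x) = w.

(** * Vector bundles *)

(* [vadd e e'] is meaningful only when e and e' lie in the same fibre.  The
   manifold structure of the total space is given by an atlas of fibrewise
   linear charts p^-1(U) -> phi(U) x R^r, i.e. by local trivializations; in
   particular every fibre is isomorphic, with its operations, to R^r, which
   gives the vector space axioms, and the operations are smooth. *)
Record vbundle (n : nat) (B : manifold n) (r : nat) := VBundle {
  vtot :> manifold (n + r) ;
  vproj : vtot -> B ;
  vadd : vtot -> vtot -> vtot ;
  vscale : R -> vtot -> vtot ;
  vzero : B -> vtot ;
  vproj_add : forall e e', vproj e = vproj e' -> vproj (vadd e e') = vproj e ;
  vproj_scale : forall x e, vproj (vscale x e) = vproj e ;
  vproj_zero : forall b, vproj (vzero b) = b ;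
  vbundle_chart : forall Phi, atlas Phi ->
    exists (phi : chart B n) (U : set B) (a : vtot -> 'rV[R]_r),
      [/\ [/\ atlas phi, open U, U `<=` chart_dom phi &
              chart_dom Phi = vproj @^-1` U],
          (forall e, U (vproj e) -> Phi e = row_mx (phi (vproj e)) (a e)),
          Phi @` chart_dom Phi = [set x | (phi @` U) (lsubmx x)] &
          [/\ forall e e', U (vproj e) -> vproj e = vproj e' ->
                a (vadd e e') = a e + a e',
              forall x e, U (vproj e) -> a (vscale x e) = x *: a e &
              forall b, U b -> a (vzero b) = 0]] }.

Definition vbundle_morphism (n m r q : nat) (A : manifold n) (B : manifold m)
    (E : vbundle A r) (F : vbundle B q) (f0 : A -> B) (f : E -> F) : Prop :=
  [/\ forall e, vproj (f e) = f0 (vproj e),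
      forall e e', vproj e = vproj e' -> f (vadd e e') = vadd (f e) (f e') &
      forall x e, f (vscale x e) = vscale x (f e)].

(** * Lie groupoids and VB-groupoids *)

(* [gmul g h] is meaningful only when gsrc g = gtgt h. *)
Record lie_groupoid (n d : nat) (M : manifold n) (G : manifold d) :=
    LieGroupoid {
  gsrc : G -> M ;
  gtgt : G -> M ;
  gmul : G -> G -> G ;
  gone : M -> G ;
  ginv : G -> G ;
  gsrc_submersion : submersion gsrc ;
  gtgt_submersion : submersion gtgt ;
  gmul_smooth : smooth_on
    [set q : 'I_2 -> G | gsrc (q ord0) = gtgt (q ord_max)]
    (fun q => gmul (q ord0) (q ord_max)) ;
  gone_smooth : smooth gone ;
  ginv_smooth : smooth ginv ;
  gsrc_mul : forall g h, gsrc g = gtgt h -> gsrc (gmul g h) = gsrc h ;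
  gtgt_mul : forall g h, gsrc g = gtgt h -> gtgt (gmul g h) = gtgt g ;
  gmulA : forall g h l, gsrc g = gtgt h -> gsrc h = gtgt l ->
    gmul g (gmul h l) = gmul (gmul g h) l ;
  gsrc_one : forall x, gsrc (gone x) = x ;
  gtgt_one : forall x, gtgt (gone x) = x ;
  gmul1g : forall g, gmul (gone (gtgt g)) g = g ;
  gmulg1 : forall g, gmul g (gone (gsrc g)) = g ;
  gsrc_inv : forall g, gsrc (ginv g) = gtgt g ;
  gtgt_inv : forall g, gtgt (ginv g) = gsrc g ;
  gmulgV : forall g, gmul g (ginv g) = gone (gtgt g) ;
  gmulVg : forall g, gmul (ginv g) g = gone (gsrc g) }.

Record vb_groupoid (n d a b : nat) (M : manifold n) (G : manifold d)
    (GG : lie_groupoid M G) (E : vbundle M a) (V : vbundle G b) :=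
    VBGroupoid {
  vb_lie :> lie_groupoid E V ;
  vb_src : vbundle_morphism (gsrc GG) (gsrc vb_lie) ;
  vb_tgt : vbundle_morphism (gtgt GG) (gtgt vb_lie) ;
  vb_one : vbundle_morphism (gone GG) (gone vb_lie) ;
  vb_inv : vbundle_morphism (ginv GG) (ginv vb_lie) ;
  vb_mul_proj : forall v w, gsrc vb_lie v = gtgt vb_lie w ->
    vproj (gmul vb_lie v w) = gmul GG (vproj v) (vproj w) ;
  vb_mul_add : forall v v' w w', vproj v = vproj v' -> vproj w = vproj w' ->
    gsrc vb_lie v = gtgt vb_lie w -> gsrc vb_lie v' = gtgt vb_lie w' ->
    gmul vb_lie (vadd v v') (vadd w w') =
    vadd (gmul vb_lie v w) (gmul vb_lie v' w') ;
  vb_mul_scale : forall x v w, gsrc vb_lie v = gtgt vb_lie w ->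
    gmul vb_lie (vscale x v) (vscale x w) = vscale x (gmul vb_lie v w) }.

(** * The nerve *)

Section Nerve.
Context {n d : nat} {M : manifold n} {G : manifold d}.
Variable GG : lie_groupoid M G.

(* All strings of k arrows, composable or not; G^(k) is [composable]. *)
Definition nerve (k : nat) : topologicalType :=
  if k is k'.+1 then {ptws 'I_k'.+1 -> G} else M.

Definition composable (k : nat) : set (nerve k) :=
  match k with
  | 0 => setT
  | k'.+1 => [set p : 'I_k'.+1 -> G |
      forall i j : 'I_k'.+1, j = i.+1 :> nat -> gsrc GG (p i) = gtgt GG (p j)]
  end.

(* g_1; the unit at x if the string is the point x of G^(0) = M. *)
Definition first_arrow (k : nat) : nerve k -> G :=
  match k with
  | 0 => fun x => gone GG x
  | k'.+1 => fun p : 'I_k'.+1 -> G => p ord0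
  end.

Definition base (k : nat) (p : nerve k) : M := gtgt GG (first_arrow p).

(* face 0 deletes g_1, face i (0 < i < k+1) composes g_i and g_(i+1), and
   face (k+1) deletes g_(k+1); on a single arrow g, the faces are s(g), t(g). *)
Definition face (k i : nat) : nerve k.+1 -> nerve k :=
  match k with
  | 0 => fun p : 'I_1 -> G =>
      if i == 0 then gsrc GG (p ord0) else gtgt GG (p ord0)
  | k'.+1 => fun (p : 'I_k'.+2 -> G) (j : 'I_k'.+1) =>
      if (j.+1 < i)%N then p (lift ord_max j)
      else if j.+1 == i then gmul GG (p (lift ord_max j)) (p (lift ord0 j))
      else p (lift ord0 j)
  end.

Definition nerve_smooth (m k : nat) (Y : manifold m)
    : set (nerve k) -> (nerve k -> Y) -> Prop :=
  match k with
  | 0 => fun S f =>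
      smooth_on [set q : 'I_1 -> M | S (q ord0)] (fun q => f (q ord0))
  | k'.+1 => fun S f => @smooth_on d m k'.+1 G Y S f
  end.

(** * Cohomology of complexes of functions on the nerve *)

Record complex := Complex {
  cval : Type ;
  cadd : cval -> cval -> cval ;
  cscale : R -> cval -> cval ;
  czero : forall k, nerve k -> cval ;
  cochain : forall k, set (nerve k -> cval) ;
  cdiff : forall k, (nerve k -> cval) -> (nerve k.+1 -> cval) }.

Section Cohomology.
Variable C : complex.
Local Notation fn k := (nerve k -> cval C).

(* Cochains are functions on G^(k): values on other strings are irrelevant. *)
Definition agree (k : nat) (f g : fn k) : Prop :=
  forall p, composable p -> f p = g p.

Definition cocycle (k : nat) : set (fn k) :=
  [set c | cochain c /\ agree (cdiff c) (@czero C k.+1)].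

Definition coboundary (k : nat) : set (fn k) :=
  match k with
  | 0 => [set @czero C 0]
  | k'.+1 => [set cdiff c | c in @cochain C k']
  end.

Definition cohomologous (k : nat) (c c' : fn k) : Prop :=
  exists2 b, coboundary b & agree c' (fun p => cadd (c p) (b p)).

Definition cclass (k : nat) (c : fn k) : set (fn k) :=
  [set c' | cocycle c' /\ cohomologous c c'].

(* H^k, as a subset of the type of sets of functions. *)
Definition cohomology (k : nat) : set (set (fn k)) :=
  [set cclass c | c in @cocycle k].

Definition hzero (k : nat) : set (fn k) := cclass (@czero C k).

Definition hadd (k : nat) (A B : set (fn k)) : set (fn k) :=
  [set c | exists a b, [/\ A a, B b & cclass (fun p => cadd (a p) (b p)) c]].

Definition hscale (k : nat) (x : R) (A : set (fn k)) : set (fn k) :=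
  [set c | exists2 a, A a & cclass (fun p => cscale x (a p)) c].

End Cohomology.

(* The map in cohomology induced by a map of cochains.  It sends classes to
   classes exactly when the map of cochains preserves cocycles and the relation
   of being cohomologous. *)
Definition induced (C D : complex) (k l : nat)
    (f : (nerve k -> cval C) -> (nerve l -> cval D))
    (A : set (nerve k -> cval C)) : set (nerve l -> cval D) :=
  [set c | exists2 a, A a & cclass (f a) c].

Definition cohomology_linear (C D : complex) (k l : nat)
    (f : set (nerve k -> cval C) -> set (nerve l -> cval D)) : Prop :=
  [/\ set_fun (@cohomology C k) (@cohomology D l) f,
      forall A B, cohomology A -> cohomology B ->
        f (hadd A B) = hadd (f A) (f B) &
      forall x A, cohomology A -> f (hscale x A) = hscale x (f A)].

(* Maps in cohomology are functions on the ambient type of sets of functions, of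
   which only the values on [cohomology] matter. *)
Definition classes (C : complex) (k : nat) : Type := set (nerve k -> cval C).

(* Exactness of f : H^j(B) -> H^k(C), g : H^k(C) -> H^l(D) at H^k(C). *)
Definition exact_at (B C D : complex) (j k l : nat)
    (f : set (nerve j -> cval B) -> set (nerve k -> cval C))
    (g : set (nerve k -> cval C) -> set (nerve l -> cval D)) : Prop :=
  forall A, @cohomology C k A ->
    (g A = @hzero D l <-> exists2 A', @cohomology B j A' & f A' = A).

(** * Differentiable cohomology with values in a representation *)

(* The data of a vector bundle over M with an action of G, from which the complex
   is built: operations on the total space, fibres, action, and, through
   [rsmooth k S f], which functions on the set S of strings are smooth.  The
   operations are meaningful only within a fibre, and the action of g only on
   the fibre at the source of g. *)
Record representation := Representation {
  rval : Type ;
  radd : rval -> rval -> rval ;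
  rscale : R -> rval -> rval ;
  rzero : M -> rval ;
  rfibre : M -> set rval ;
  raction : G -> rval -> rval ;
  rsmooth : forall k, set (nerve k) -> (nerve k -> rval) -> Prop }.

Definition rep_diff (A : representation) (k : nat) (f : nerve k -> rval A)
    (p : nerve k.+1) : rval A :=
  radd (raction (first_arrow p) (f (face 0 p)))
    (\big[@radd A / rzero A (base p)]_(1 <= i < k.+2)
       rscale ((-1) ^+ i) (f (face i p))).

Definition rep_complex (A : representation) : complex := {|
  cval := rval A ;
  cadd := @radd A ;
  cscale := @rscale A ;
  czero := fun k p => rzero A (base p) ;
  cochain := fun k => [set f |
    (forall p, composable p -> rfibre (base p) (f p)) /\
    rsmooth (@composable k) f] ;
  cdiff := @rep_diff A |}.

(** * The core, the kernel and the cokernel of the core-anchor *)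

Section VBGroupoid.
Context {a b : nat} {E : vbundle M a} {V : vbundle G b}.
Variable VV : vb_groupoid GG E V.

Definition core (x : M) : set V :=
  [set v | vproj v = gone GG x /\ gsrc VV v = vzero E x].

Definition core_anchor (v : V) : E := gtgt VV v.

Definition image_anchor (x : M) : set E := core_anchor @` core x.

(* The image of the core-anchor at each point is linearly isomorphic to R^r,
   with r independent of the point. *)
Definition regular : Prop :=
  exists r : nat, forall x : M, exists f : 'rV[R]_r -> E,
    [/\ injective f, range f = image_anchor x,
        forall u w, f (u + w) = vadd (f u) (f w) &
        forall c u, f (c *: u) = vscale c (f u)].

Definition ker_rep : representation := {|
  rval := V ;
  radd := @vadd _ _ _ V ;
  rscale := @vscale _ _ _ V ;
  rzero := fun x => vzero V (gone GG x) ;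
  rfibre := fun x => [set v | core x v /\ core_anchor v = vzero E x] ;
  raction := fun g v =>
    gmul VV (gmul VV (vzero V g) v) (ginv VV (vzero V g)) ;
  rsmooth := fun k S f => nerve_smooth S f |}.

(* The class of e in the cokernel, as a coset of the image of the anchor. *)
Definition coker_class (e : E) : set E :=
  [set vadd e e' | e' in image_anchor (vproj e)].

(* Smooth functions with values in the quotient bundle are those that lift
   locally to smooth functions with values in E. *)
Definition coker_smooth (k : nat) (S : set (nerve k)) (f : nerve k -> set E)
    : Prop :=
  forall p, S p -> exists (O : set (nerve k)) (h : nerve k -> E),
    [/\ open O, O p, nerve_smooth (S `&` O) h &
        forall q, S q -> O q ->
          vproj (h q) = base q /\ f q = coker_class (h q)].

Definition coker_rep : representation := {|
  rval := set E ;
  radd := fun A B => [set e | exists x y, [/\ A x, B y & e = vadd x y]] ;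
  rscale := fun c A =>
    [set e | exists2 x, A x & coker_class (vscale c x) e] ;
  rzero := fun x => coker_class (vzero E x) ;
  rfibre := fun x => [set coker_class e | e in [set e | vproj e = x]] ;
  raction := fun g A => [set e | exists v,
    [/\ vproj v = g, A (gsrc VV v) & coker_class (gtgt VV v) e]] ;
  rsmooth := coker_smooth |}.

Definition ker_complex : complex := rep_complex ker_rep.
Definition coker_complex : complex := rep_complex coker_rep.

(** * The VB-complex *)

(* In positive degree, the condition on the source says that it is a function
   of the string with g_1 deleted; in degree 1, of the point s(g_1). *)
Definition vb_cochain (k : nat) : set (nerve k -> V) :=
  match k with
  | 0 => [set c : M -> V |
      (forall x : M, core x (c x)) /\ @nerve_smooth _ 0 V setT c]
  | k'.+1 => [set c |
      [/\ forall p, composable p -> vproj (c p) = first_arrow p,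
          forall p q, composable p -> composable q ->
            face 0 p = face 0 q -> gsrc VV (c p) = gsrc VV (c q) &
          nerve_smooth (@composable k'.+1) c]]
  end.

Definition vb_diff (k : nat) : (nerve k -> V) -> nerve k.+1 -> V :=
  match k with
  | 0 => fun (c : M -> V) p =>
      let g := first_arrow p in
      vadd (gmul VV (c (gtgt GG g)) (vzero V g))
           (gmul VV (vzero V g) (ginv VV (c (gsrc GG g))))
  | k'.+1 => fun c p =>
      vadd (vscale (-1) (gmul VV (c (face 1 p)) (ginv VV (c (face 0 p)))))
        (\big[@vadd _ _ _ V / vzero V (first_arrow p)]_(2 <= i < k'.+3)
           vscale ((-1) ^+ i) (c (face i p)))
  end.

Definition vb_complex : complex := {|
  cval := V ;
  cadd := @vadd _ _ _ V ;
  cscale := @vscale _ _ _ V ;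
  czero := fun k p => vzero V (first_arrow p) ;
  cochain := vb_cochain ;
  cdiff := vb_diff |}.

(* In degree 0 this is the identity, 0 being the unit of the zero of E. *)
Definition r_map (k : nat) (c : nerve k -> V) : nerve k -> V :=
  fun p => gmul VV (c p) (vzero V (first_arrow p)).

(* All the strings p with g_1 deleted equal to q give the same class. *)
Definition pi_map (k : nat) (c : nerve k.+1 -> V) : nerve k -> set E :=
  fun q => [set e | exists p,
    [/\ composable p, face 0 p = q & coker_class (gsrc VV (c p)) e]].

Definition Hr (k : nat) :=
  @induced ker_complex vb_complex k k (@r_map k).

Definition Hpi (k : nat) :=
  @induced vb_complex coker_complex k.+1 k (@pi_map k).

(* 0 -> H^0(k) -> H^0_VB -> 0 -> H^1(k) -> H^1_VB -> H^0(l) -> H^2(k) -> ...,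
   the cohomology of the cokernel being zero in degree -1. *)
Definition long_exact_sequence
    (K : forall k, classes coker_complex k -> classes ker_complex k.+2)
    : Prop :=
  [/\ [/\ forall k, cohomology_linear (@Hr k),
          forall k, cohomology_linear (@Hpi k) &
          forall k, cohomology_linear (K k)],
      set_bij (@cohomology ker_complex 0) (@cohomology vb_complex 0)
        (@Hr 0),
      set_inj (@cohomology ker_complex 1) (@Hr 1) &
      forall k, [/\ exact_at (@Hr k.+1) (@Hpi k),
                    exact_at (@Hpi k) (K k) &
                    exact_at (K k) (@Hr k.+2)]].

End VBGroupoid.
End Nerve.
End Manifolds.

Arguments manifold : clear implicits.
Arguments long_exact_sequence {R n d M G GG a b E V} VV K.

(* Main.v *)
Require Import Defs.
From HB Require Import structures.
From mathcomp Require Import all_boot all_order all_algebra.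
From mathcomp Require Import all_classical all_reals topology normedtype landau derive.
From mathcomp Require Import sequences realfun exp.
From mathcomp Require Import ring lra zify.

Set Implicit Arguments.
Unset Strict Implicit.
Unset Printing Implicit Defensive.

Import Order.TTheory GRing.Theory Num.Theory.
Import numFieldNormedType.Exports.

Local Open Scope classical_set_scope.
Local Open Scope ring_scope.

(** The maps [r] and [pi] behave like a short exact sequence of complexes, up to
    coboundaries, and the theorem is its long exact sequence; [K] is the
    connecting map of the snake lemma.

    Write S and T for the source and target maps of V.  The source of a
    VB-cochain c of degree k+1 is a section of E over the strings of k arrows,
    and [pi c] is its class modulo the image of the anchor.  The vector c(p) lies
    over g_1, so its target represents the action of g_1 on the class of its
    source; as the first term of delta c contributes -T(c) to S(delta c), the map
    [pi] anticommutes with the differentials ([src_vb_diff], [qdiff_pi]).  The map [r] commutes with them in positive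
    degree and anticommutes in degree 0 ([r_diff], [r_diff0]).  Exactness rests
    on three facts.
    - Every cochain of the cokernel is [pi c] for a VB-cochain c
      ([pi_preimage]).
    - A VB-cochain with zero source and zero target is [r z] for a cochain z of
      the kernel ([r_preimage]): divide by 0_(g_1) on the right.
    - If S(c) lies in the image of the anchor and S(delta c) = 0, then
      c = r z + delta h ([split_anchor]).  By regularity S(c) is the anchor of
      a smooth section of the core, and translating the opposite section by zeros
      gives a VB-cochain h with zero source such that delta h has the same source
      as c; for k = 0, the section of the core itself is taken as h.  Then w = c - delta h has zero source and S(delta w) = 0, which forces
      T(w) = 0.
    Given a cocycle f of the cokernel, choose c with [pi c] = f.  The source of
    delta c lies in the image of the anchor, so delta c = r u + delta h with h of
    zero source, and K sends the class of f to the class of u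
    ([lift_cocycle], [connecting_class]).  Exactness at the three places is then
    the usual chase, in which [split_cobound] replaces exactness of the
    sequence of cochains.

    The lifts have to be smooth.  All of them solve linear equations in the
    fibres of V whose rank does not depend on the string: one equation for the
    source, which is onto on fibres because it is a submersion
    ([submersion_fibre_onto]), or equations for the source and the target
    together, where the rank of the anchor enters.  Locally, Cramer's rule for a
    fixed minor gives a smooth solution; the solutions form affine subspaces of
    the fibres, so the local ones can be glued with bump functions
    ([glue_sections], [lift_pair]). *)

(** * Calculus of functions of class C^j *)

Section SmoothFunctions.
Context {R : realType}.
Implicit Types (X Y Z : normedModType R) (j : nat).

Lemma class_C_sub X Y j (W W' : set X) (f : X -> Y) :
  W' `<=` W -> class_C j W f -> class_C j W' f.
Proof.
elim: j f => [|j IH] f sW /= [cf]; first by split=> // x /sW /cf.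
move=> df; split=> [x /sW /cf //|v]; have [dv cv] := df v.
by split=> [x /sW /dv //|]; exact: IH.
Qed.

Lemma class_CW X Y j (W : set X) (f : X -> Y) : class_C j.+1 W f -> class_C j W f.
Proof.
elim: j f => [|j IH] f; first by case.
by case=> cf df; split=> // v; have [dv cv] := df v; split=> //; exact: IH.
Qed.

Lemma near_open_eq X (T : Type) (W : set X) (f g : X -> T) x :
  open W -> W x -> (forall y, W y -> f y = g y) -> \forall y \near x, f y = g y.
Proof.
move=> oW Wx fg; have nW : nbhs x W by apply: open_nbhs_nbhs; split.
by apply: filterS nW => y /fg.
Qed.

Lemma near_eq_continuous X Y (f g : X -> Y) x : (\forall y \near x, f y = g y) ->
  {for x, continuous f} -> {for x, continuous g}.
Proof.
move=> fg cf; have fgx := nbhs_singleton fg.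
rewrite /prop_for /continuous_at -fgx; apply: cvg_trans cf.
exact: near_eq_cvg.
Qed.

Lemma class_C_eq X Y j (W : set X) (f g : X -> Y) : open W ->
  (forall x, W x -> f x = g x) -> class_C j W f -> class_C j W g.
Proof.
move=> oW; elim: j f g => [|j IH] f g fg [cf df].
  split=> // x Wx.
  by apply: near_eq_continuous (cf x Wx); exact: near_open_eq fg.
split=> [x Wx|v].
  by apply: near_eq_continuous (cf x Wx); exact: near_open_eq fg.
have [dv cv] := df v; split=> [x Wx|].
  exact: (near_eq_derivable (near_open_eq oW Wx fg) (dv x Wx)).
apply: IH cv => x Wx; exact: (near_eq_derive v (near_open_eq oW Wx fg)).
Qed.

Lemma class_C_cst X Y j (W : set X) (a : Y) : class_C j W (fun=> a).
Proof.
elim: j a => [|j IH] a; first by split=> // x _; exact: cst_continuous.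
split=> [x _|v]; first exact: cst_continuous.
split=> [x _|]; first exact: derivable_cst.
rewrite (_ : 'D_v (fun=> a) = fun=> 0); first exact: IH.
by apply/funext => x; exact: derive_cst.
Qed.

Lemma class_C_add X Y j (W : set X) (f g : X -> Y) : open W ->
  class_C j W f -> class_C j W g -> class_C j W (f + g).
Proof.
move=> oW; elim: j f g => [|j IH] f g [cf df] [cg dg].
  by split=> // x Wx; apply: continuousD; [exact: cf|exact: cg].
split=> [x Wx|v]; first by apply: continuousD; [exact: cf|exact: cg].
have [dfv cfv] := df v; have [dgv cgv] := dg v.
split=> [x Wx|]; first by apply: derivableD; [exact: dfv|exact: dgv].
apply: class_C_eq (IH _ _ cfv cgv) => // x Wx.
by rewrite deriveD //; [exact: dfv|exact: dgv].
Qed.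

Lemma class_C_mul X j (W : set X) (f g : X -> R) : open W ->
  class_C j W f -> class_C j W g -> class_C j W (f * g).
Proof.
move=> oW; elim: j f g => [|j IH] f g Cf Cg.
  by split=> // x Wx; apply: continuousM; [exact: Cf.1|exact: Cg.1].
have [[cf df] [cg dg]] := (Cf, Cg).
split=> [x Wx|v]; first by apply: continuousM; [exact: cf|exact: cg].
have [dfv cfv] := df v; have [dgv cgv] := dg v.
split=> [x Wx|]; first by apply: derivableM; [exact: dfv|exact: dgv].
apply: (@class_C_eq _ _ _ _ (f * 'D_v g + g * 'D_v f)) => //.
  by move=> x Wx; rewrite deriveM //; [exact: dfv|exact: dgv].
by apply: class_C_add => //; apply: IH => //; exact: class_CW.
Qed.

Lemma class_CD X Y j (W : set X) (f g : X -> Y) : open W ->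
  class_C j W f -> class_C j W g -> class_C j W (fun x => f x + g x).
Proof. exact: class_C_add. Qed.

Lemma class_CM X j (W : set X) (f g : X -> R) : open W ->
  class_C j W f -> class_C j W g -> class_C j W (fun x => f x * g x).
Proof. exact: class_C_mul. Qed.

Lemma class_C_sum X Y (I : Type) (s : seq I) (P : pred I) j (W : set X)
    (f : I -> X -> Y) : open W ->
  (forall i, P i -> class_C j W (f i)) -> class_C j W (fun x => \sum_(i <- s | P i) f i x).
Proof.
move=> oW Cf; elim: s => [|i s IH].
  by apply: class_C_eq (class_C_cst j W 0) => // x _; rewrite big_nil.
case Pi : (P i).
  apply: class_C_eq (class_C_add oW (Cf i Pi) IH) => // x _.
  by rewrite big_cons Pi.
by apply: class_C_eq IH => // x _; rewrite big_cons Pi.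
Qed.

Lemma is_derive_coord (k n : nat) (i : 'I_k) (l : 'I_n) (x v : 'M[R]_(k, n)) :
  is_derive x v (fun A : 'M[R]_(k, n) => A i l) (v i l).
Proof.
apply: DeriveDef; first exact/diff_derivable/differentiable_coord.
apply/cvg_lim => //; apply: cvg_near_cst.
near=> h; rewrite /= !mxE addrK scalerA mulVf ?scale1r //.
by near: h; exact: nbhs_dnbhs_neq.
Unshelve. all: by end_near. Qed.

Lemma continuous_mxP (X : topologicalType) k n (F : X -> 'M[R]_(k, n)) x :
  (forall i l, {for x, continuous (fun y => F y i l : R)}) -> {for x, continuous F}.
Proof.
move=> cF; apply/cvgrPdist_le => e e0; near=> y.
rewrite /Num.Def.normr/= mx_normrE (bigmax_le _ (ltW e0))//= => i _.
rewrite !mxE/=; move: i; near: y; apply: filter_forall => /= i.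
exact: ((cvgrPdist_le _ _).1 (cF i.1 i.2) e e0).
Unshelve. all: by end_near. Qed.

Lemma class_C_mxP X j k n (W : set X) (F : X -> 'M[R]_(k, n)) : open W ->
  class_C j W F <-> forall i l, class_C j W (fun x => F x i l : R).
Proof.
move=> oW; elim: j F => [|j IH] F; split.
- move=> [cF _] i l; split=> // x Wx.
  exact: continuous_comp (cF x Wx) (@coord_continuous _ _ _ i l _).
- by move=> CF; split=> // x Wx; apply: continuous_mxP => i l; exact: (CF i l).1.
- move=> [cF dF] i l; split=> [x Wx|v].
    exact: continuous_comp (cF x Wx) (@coord_continuous _ _ _ i l _).
  have [dv cv] := dF v; split=> [x Wx|]; first by have /derivable_mxP := dv x Wx.
  apply: class_C_eq ((IH _).1 cv i l) => // x Wx.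
  by rewrite derive_mx ?mxE //; exact: dv.
- move=> CF; split=> [x Wx|v].
    by apply: continuous_mxP => i l; exact: (CF i l).1.
  have dv x : W x -> derivable F x v.
    by move=> Wx; apply/derivable_mxP => i l; apply: ((CF i l).2 v).1.
  split=> //; apply/IH => i l.
  apply: class_C_eq ((CF i l).2 v).2 => // x Wx.
  by rewrite derive_mx ?mxE //; exact: dv.
Qed.

Lemma class_C_coord j k n (W : set 'M[R]_(k, n)) (i : 'I_k) (l : 'I_n) :
  class_C j W (fun A : 'M[R]_(k, n) => A i l : R).
Proof.
case: j => [|j]; split=> //.
- by move=> x _; exact: coord_continuous.
- by move=> x _; exact: coord_continuous.
- move=> v; split=> [x _|]; first by have := is_derive_coord i l x v.
  rewrite (_ : 'D_v _ = fun=> v i l); first exact: class_C_cst.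
  by apply/funext => x; have [] := is_derive_coord i l x v.
Qed.

Lemma is_derive_line X Y (g : X -> Y) (y e : X) (t : R) :
  derivable g (y + t *: e) e ->
  is_derive t 1 (fun s : R => g (y + s *: e)) ('D_e g (y + t *: e)).
Proof.
move=> dg; have E (h : R) : g (y + (h *: (1 : R) + t) *: e) = g (h *: e + (y + t *: e)).
  by rewrite [h *: _]mulr1 scalerDl addrCA.
apply: DeriveDef; rewrite ?/derivable ?/derive;
  by under eq_fun => h do rewrite /= E.
Qed.

Lemma line_MVT X (g : X -> R) (y e : X) (c : R) :
  (forall t : R, `|t| <= `|c| -> derivable g (y + t *: e) e) ->
  exists2 t : R, `|t| <= `|c| & g (y + c *: e) - g y = c * 'D_e g (y + t *: e).
Proof.
move=> dg; pose phi (s : R) := g (y + s *: e).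
have phi0 : phi 0 = g y by rewrite /phi scale0r addr0.
have [c0|c0] := leP 0 c.
- have sub t : t \in `[0, c] -> `|t| <= `|c|.
    by rewrite in_itv /= => /andP[t0 tc]; rewrite !ger0_norm.
  have [t tc||t tc E] := @MVT_segment _ phi (fun t => 'D_e g (y + t *: e)) 0 c c0.
  + apply: is_derive_line; apply: dg; apply: sub.
    by move: tc; rewrite !in_itv /= => /andP[/ltW -> /ltW ->].
  + apply: derivable_within_continuous => t tc.
    by have [] := is_derive_line (dg t (sub t tc)).
  + by exists t; [exact: sub|rewrite -phi0 -[g _]/(phi c) E subr0 mulrC].
- have sub t : t \in `[c, 0] -> `|t| <= `|c|.
    by rewrite in_itv /= => /andP[t0 tc]; rewrite !ler0_norm ?lerN2 // ltW.
  have [t tc||t tc E] := @MVT_segment _ phi (fun t => 'D_e g (y + t *: e)) c 0 (ltW c0).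
  + apply: is_derive_line; apply: dg; apply: sub.
    by move: tc; rewrite !in_itv /= => /andP[/ltW -> /ltW ->].
  + apply: derivable_within_continuous => t tc.
    by have [] := is_derive_line (dg t (sub t tc)).
  + exists t; first exact: sub.
    by rewrite -phi0 -[g _]/(phi c) -opprB E sub0r mulrN opprK mulrC.
Qed.

Definition basis_mx k n (p : 'I_k * 'I_n) : 'M[R]_(k, n) := delta_mx p.1 p.2.

Lemma norm_basis_mx k n (p : 'I_k * 'I_n) : `|basis_mx p| <= 1.
Proof.
rewrite /Num.Def.normr/= mx_normrE (bigmax_le _ ler01)//= => i _.
by rewrite mxE; case: (_ && _); rewrite ?normr1 ?normr0.
Qed.

Lemma mx_sum_basis k n (A : 'M[R]_(k, n)) : A = \sum_p A p.1 p.2 *: basis_mx p.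
Proof.
rewrite {1}[A]matrix_sum_delta pair_bigA_idem /=; first by [].
by rewrite addr0.
Qed.

(** Moving from [x] one basis direction at a time and applying the mean value
    theorem to each step expresses the increment through partial derivatives at
    points near [x], which are within [e] of those at [x]. *)
Lemma C1_increment k n (W : set 'M[R]_(k, n)) (g : 'M[R]_(k, n) -> R) x (e : R) :
  open W -> W x -> class_C 1 W g -> 0 < e ->
  exists2 d : R, 0 < d & forall (s : seq ('I_k * 'I_n)) (c : 'I_k * 'I_n -> R),
    \sum_(p <- s) `|c p| < d ->
    `|g (x + \sum_(p <- s) c p *: basis_mx p) - g x
       - \sum_(p <- s) c p * 'D_(basis_mx p) g x| <= e * \sum_(p <- s) `|c p|.
Proof.
move=> oW Wx [cg dg] e0.
have : \forall y \near x, W y /\ forall p, `|'D_(basis_mx p) g x - 'D_(basis_mx p) g y| <= e.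
  apply: filterI; first by apply: open_nbhs_nbhs.
  near=> y; move=> p; move: p; near: y; apply: filter_forall => p.
  have [_ [/(_ x Wx) + _]] := dg (basis_mx p).
  by move=> /cvgrPdist_le /(_ e e0).
move=> /nbhs_normP [d /= d0 near_d]; exists d => // s c sd.
have {}near_d y : `|y| < d -> W (x + y) /\ forall p, `|'D_(basis_mx p) g x - 'D_(basis_mx p) g (x + y)| <= e.
  by move=> yd; apply: near_d; rewrite /= opprD addNKr normrN.
elim: s sd => [|p s IH]; first by rewrite !big_nil addr0 !subrr normr0 mulr0.
rewrite !big_cons; set S := \sum_(q <- s) `|c q|; set y := \sum_(q <- s) _ *: _ => sd.
have yS : `|y| <= S.
  apply: le_trans (ler_norm_sum _ _ _) _; apply: ler_sum => q _.
  by rewrite normrZ ler_piMr // norm_basis_mx.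
have tS (t : R) : `|t| <= `|c p| -> `|y + t *: basis_mx p| < d.
  move=> tc; apply: le_lt_trans (ler_normD _ _) _; apply: le_lt_trans sd.
  rewrite addrC lerD // normrZ (le_trans _ tc) // ler_piMr // norm_basis_mx //.
have [|t tc E] := @line_MVT _ g (x + y) (basis_mx p) (c p).
  move=> t /tS yd; have [Wy _] := near_d _ yd; rewrite -addrA.
  exact: (dg (basis_mx p)).1.
have [_ /(_ p)] := near_d _ (tS t tc); rewrite addrA -/(basis_mx p) => De.
have -> : x + (c p *: basis_mx p + y) = x + y + c p *: basis_mx p.
  by rewrite addrCA addrC.
rewrite -(subrK (g (x + y)) (g (_ + _ *: _))) E mulrDr.
set D := 'D_ _ g x in De *; set D' := 'D_ _ g _ in De *.
set U := \sum_(q <- s) c q * _.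
have -> : c p * D' + g (x + y) - g x - (c p * D + U) =
          c p * (D' - D) + (g (x + y) - g x - U).
  by move: (D) (D') (U) => u u' w; ring.
apply: le_trans (ler_normD _ _) _; apply: lerD.
  by rewrite normrM mulrC ler_wpM2r // distrC.
by apply: IH; apply: le_lt_trans sd; rewrite lerDr.
Unshelve. all: by end_near. Qed.

Lemma differentiable_estimate X Y (g : X -> Y) (L : {linear X -> Y}) x :
  continuous L ->
  (forall e : R, 0 < e -> exists2 d : R, 0 < d &
    forall h, `|h| < d -> `|g (x + h) - g x - L h| <= e * `|h|) ->
  differentiable g x /\ ('d g x : X -> Y) = L.
Proof.
move=> cL est; have dgL : g \o shift x = cst (g x) + L +o_ 0 id.
  apply/eqaddoP => e e0; have [d d0 estd] := est e e0.
  near=> h; rewrite /= !fctE /= opprD addrA [h + x]addrC; apply: estd.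
  by near: h; exact: nbhs0_lt.
have E := diff_unique cL dgL.
by split; [apply/diff_locallyP; rewrite E|].
Unshelve. all: by end_near. Qed.

(** [class_C] speaks of directional derivatives only, while the chain rule
    needs a differential; continuous partial derivatives provide it. *)
Lemma C1_differentiable k n (W : set 'M[R]_(k, n)) (g : 'M[R]_(k, n) -> R) x :
  open W -> W x -> class_C 1 W g ->
  differentiable g x /\
  forall v, 'd g x v = \sum_p v p.1 p.2 * 'D_(basis_mx p) g x.
Proof.
move=> oW Wx Cg.
pose L (v : 'M[R]_(k, n)) : R := \sum_p v p.1 p.2 * 'D_(basis_mx p) g x.
have lin_L : linear L.
  move=> a u v; rewrite /L scaler_sumr -big_split; apply: eq_bigr => p _ /=.
  by rewrite !mxE mulrDl scalerAl.
pose LM := GRing.isLinear.Build _ _ _ _ _ lin_L.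
pose LL : {linear 'M[R]_(k, n) -> R} := HB.pack L LM.
have cL : continuous LL.
  have : class_C 0 setT L.
    apply: class_C_sum => [|p _]; first exact: openT.
    apply: (@class_C_mul _ _ _ (fun v : 'M[R]_(k, n) => v p.1 p.2 : R) (fun=> 'D_(basis_mx p) g x)).
    - exact: openT.
    - exact: class_C_coord.
    - exact: class_C_cst.
  by move=> [cL _] y; exact: cL.
have [dg E] : differentiable g x /\ ('d g x : _ -> _) = LL.
  apply: differentiable_estimate => // e e0.
  (* The norm is the maximum of the entries; the successor keeps N positive when
     there are none. *)
  pose N : R := #|{: 'I_k * 'I_n}|.+1%:R.
  have N0 : 0 < N by rewrite ltr0n.
  have [d d0 inc] := @C1_increment _ _ W g x (e / N) oW Wx Cg (divr_gt0 e0 N0).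
  have sumN (h : 'M[R]_(k, n)) : \sum_p `|h p.1 p.2| <= N * `|h|.
    apply: (@le_trans _ _ (\sum_(p : 'I_k * 'I_n) `|h|)).
      apply: ler_sum => p _; rewrite {2}/Num.Def.normr/= mx_normrE.
      exact: (le_bigmax _ (fun p : 'I_k * 'I_n => `|h p.1 p.2|) p).
    rewrite sumr_const -mulr_natl ler_wpM2r // ler_nat //.
  exists (d / N) => [|h hdN]; first by rewrite divr_gt0.
  have hd : \sum_p `|h p.1 p.2| < d.
    apply: le_lt_trans (sumN h) _; rewrite mulrC -ltr_pdivlMr //.
  have := inc (index_enum _) (fun p => h p.1 p.2) hd.
  rewrite -mx_sum_basis => inc'.
  apply: le_trans inc' _; rewrite -mulrA ler_wpM2l ?(ltW e0) //.
  by rewrite mulrC ler_pdivrMr // mulrC.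
by split=> // v; rewrite E.
Qed.

(** On the line through [x] with direction [v], this is the chain rule for
    differentials. *)
Lemma is_derive_comp X Y Z (g : Y -> Z) (F : X -> Y) (x v : X) :
  differentiable g (F x) -> derivable F x v ->
  is_derive x v (g \o F) ('d g (F x) ('D_v F x)).
Proof.
move=> dg dF; pose psi (h : R) := F (h *: v + x).
have psi0 : psi 0 = F x by rewrite /psi scale0r add0r.
have dpsi : differentiable psi 0.
  by apply/derivable1_diffP; apply: (derivable1P F x v).1 dF.
rewrite -psi0 in dg *.
have dcomp : differentiable (g \o psi) 0 by exact: differentiable_comp.
have D1 (V : normedModType R) (H : X -> V) : 'D_v H x = 'D_1 (fun h : R => H (h *: v + x)) 0.
  rewrite /derive; set f1 := (fun h => h^-1 *: _); set f2 := (fun h => h^-1 *: _).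
  suff -> : f1 = f2 by [].
  by apply/funext => h; rewrite /f1 /f2 /= addr0 scale0r add0r [h *: 1]mulr1.
apply: DeriveDef.
  by apply: (derivable1P _ x v).2; apply: (derivable1_diffP _ _).2 dcomp.
rewrite (D1 _ F) D1 -[(fun h : R => (g \o F) _)]/(g \o psi) -[(fun h : R => F _)]/psi.
rewrite [LHS]deriveE //.
rewrite [X in _ = _ X]deriveE //.
by rewrite diff_comp.
Qed.

(** A directional derivative of [g \o F] is a sum of products of derivatives of
    [F] with functions [g' \o F], where [g'] is a partial derivative of [g], so
    induction on the order applies. *)
Lemma class_C_comp X j k n (W : set X) (W' : set 'M[R]_(k, n))
    (g : 'M[R]_(k, n) -> R) (F : X -> 'M[R]_(k, n)) :
  open W -> open W' -> (forall x, W x -> W' (F x)) ->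
  class_C j W' g -> class_C j W F -> class_C j W (g \o F).
Proof.
move=> oW oW'; elim: j g F => [|j IH] g F FW Cg CF.
  by split=> // x Wx; apply: continuous_comp; [exact: CF.1|exact: Cg.1 (FW _ Wx)].
have C1g : class_C 1 W' g.
  case: Cg => cg dg; split=> // v; have [dv] := dg v.
  by case: (j) => [|?] [cv _].
have [[cg dg] [cF dF]] := (Cg, CF).
split=> [x Wx|v].
  by apply: continuous_comp; [exact: cF|exact: cg (FW _ Wx)].
pose D y := \sum_p 'D_v (fun y => F y p.1 p.2) y * 'D_(basis_mx p) g (F y).
have dgF x : W x -> is_derive x v (g \o F) (D x).
  move=> Wx; have [dgx dgE] := C1_differentiable oW' (FW x Wx) C1g.
  have := is_derive_comp dgx ((dF v).1 x Wx); rewrite dgE derive_mx; last exact: (dF v).1.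
  by rewrite (eq_bigr _ (fun p _ => congr1 (fun r => r * _) (mxE _ _ _ _))).
split=> [x Wx|]; first by have [] := dgF x Wx.
apply: (@class_C_eq _ _ _ _ D) => //; first by move=> x Wx; have [_ ->] := dgF x Wx.
apply: class_C_sum => // p _.
apply: (@class_C_mul _ _ _ ('D_v (fun y => F y p.1 p.2 : R)) ('D_(basis_mx p) g \o F)) => //.
  by have [] := ((class_C_mxP j.+1 F oW).1 CF p.1 p.2).2 v.
by apply: IH => //; [exact: (dg _).2|exact: class_CW].
Qed.
End SmoothFunctions.

(** * Bump functions *)

Section Bump.
Context {R : realType}.
Implicit Types (X Y Z : normedModType R) (j : nat).

Lemma class_C_inv X j (W : set X) (f : X -> R) : open W ->
  (forall x, W x -> f x != 0) -> class_C j W f -> class_C j W (fun x => (f x)^-1).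
Proof.
move=> oW f0; elim: j => [|j IH] Cf.
  by split=> // x Wx; apply: continuousV; [exact: f0|exact: Cf.1].
have [cf df] := Cf.
have C := IH (class_CW Cf).
split=> [x Wx|v]; first by apply: continuousV; [exact: f0|exact: cf].
have [dv cv] := df v; split=> [x Wx|].
  by apply: derivableV; [exact: f0|exact: dv].
apply: (@class_C_eq _ _ _ _ _ (((fun x => (f x)^-1) * (fun x => (f x)^-1)) * ((fun=> -1) * 'D_v f))) => //.
  move=> x Wx; rewrite deriveV; [|exact: f0|exact: dv].
  rewrite -[LHS]/(((f x)^-1 * (f x)^-1) * (-1 * 'D_v f x)) mulN1r mulrN scaleNr; congr (- _).
  by rewrite expr2 invfM.
apply: class_C_mul => //; first exact: class_C_mul.
by apply: class_C_mul => //; exact: class_C_cst.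
Qed.

Lemma diff1_mul (g : R -> R) (t v : R) :
  differentiable g t -> 'd g t v = v * 'D_1 g t.
Proof. by move=> dg; rewrite diff1E // derive1E. Qed.

Lemma class_C_comp1 X j (W : set X) (W' : set R) (g : R -> R) (f : X -> R) :
  open W -> (forall x, W x -> W' (f x)) ->
  class_C j W' g -> class_C j W f -> class_C j W (g \o f).
Proof.
move=> oW; elim: j g f => [|j IH] g f fW Cg Cf.
  by split=> // x Wx; apply: continuous_comp; [exact: Cf.1|exact: Cg.1 (fW _ Wx)].
have [[cg dg] [cf df]] := (Cg, Cf).
split=> [x Wx|v].
  by apply: continuous_comp; [exact: cf|exact: cg (fW _ Wx)].
pose D x := 'D_v f x * 'D_1 g (f x).
have dgf x : W x -> is_derive x v (g \o f) (D x).
  move=> Wx; have dgx : differentiable g (f x).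
    by apply/derivable1_diffP; exact: (dg 1).1 (fW _ Wx).
  by have := is_derive_comp dgx ((df v).1 x Wx); rewrite diff1_mul.
split=> [x Wx|]; first by have [] := dgf x Wx.
apply: (@class_C_eq _ _ _ _ _ D) => //; first by move=> x Wx; have [_ ->] := dgf x Wx.
apply: (@class_C_mul _ _ _ _ ('D_v f) ('D_1 g \o f)) => //; first exact: (df v).2.
by apply: IH => //; [exact: (dg 1).2|exact: class_CW].
Qed.

Lemma expr_le_expR (i : nat) (y : R) : 0 <= y -> y ^+ i <= i`!%:R * expR y.
Proof.
move=> y0; case: i => [|i].
  by rewrite expr0 fact0 mul1r (le_trans _ (expR_ge1Dx y)) // lerDl.
rewrite mulrC -ler_pdivrMr ?ltr0n ?fact_gt0 //.
by apply: le_trans (expR_ge1Dxn i y0); rewrite lerDr.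
Qed.

Lemma poly_expR_bounded (q : {poly R}) :
  exists2 C : R, 0 <= C & forall y, 0 <= y -> `|q.[y] * expR (- y)| <= C.
Proof.
exists (\sum_(i < size q) `|q`_i| * i`!%:R).
  by apply: sumr_ge0 => i _; rewrite mulr_ge0 ?ler0n.
move=> y y0; rewrite normrM (ger0_norm (expR_ge0 _)) expRN ler_pdivrMr ?expR_gt0 //.
rewrite horner_coef mulr_suml; apply: le_trans (ler_norm_sum _ _ _) _.
apply: ler_sum => i _; rewrite normrM normrX (ger0_norm y0) -mulrA.
by rewrite ler_wpM2l //; exact: expr_le_expR.
Qed.

(** Products of a polynomial in 1/t with exp(-1/t), extended by 0.  The family is
    closed under differentiation, so that exp(-1/t) is smooth at 0 by a single
    induction over all polynomials. *)
Definition flat (p : {poly R}) (t : R) : R :=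
  if 0 < t then p.[t^-1] * expR (- t^-1) else 0.

(** The derivative of p(1/t) exp(-1/t) is q(1/t) exp(-1/t) for this q. *)
Definition flat_next (p : {poly R}) : {poly R} := 'X^2 * (p - p^`()).

Lemma flat0 (p : {poly R}) t : t <= 0 -> flat p t = 0.
Proof. by rewrite /flat ltNge => ->. Qed.

Lemma is_derive_quadratic (f : R -> R) (C : R) : 0 <= C ->
  (forall h, `|f h| <= C * h ^+ 2) -> is_derive (0 : R) 1 f 0.
Proof.
move=> C0 fC; have f0 : f 0 = 0.
  by apply/normr0_eq0/eqP; rewrite eq_le normr_ge0 (le_trans (fC 0)) ?expr0n ?mulr0.
have cv : h^-1 *: (f (h *: 1 + 0) - f 0) @[h --> 0^'] --> (0 : R).
  apply/cvgrPdist_le => e e0; near=> h.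
  rewrite sub0r normrN f0 subr0 addr0 [h *: 1]mulr1 normrM normfV.
  have hN0 : h != 0 by near: h; exact: nbhs_dnbhs_neq.
  rewrite ler_pdivrMl ?normr_gt0 //; apply: le_trans (fC h) _.
  rewrite -real_normK ?num_real // expr2 mulrCA ler_wpM2l //.
  have : `|h| <= e / (C + 1).
    by near: h; apply: dnbhs0_le; rewrite divr_gt0 // ltr_wpDl.
  rewrite ler_pdivlMr ?ltr_wpDl // mulrC; apply: le_trans.
  by rewrite ler_wpM2r // lerDl.
by apply: DeriveDef; [apply/cvg_ex; exists 0|apply/cvg_lim].
Unshelve. all: by end_near. Qed.

(** At 0 the function is O(t^2), because y^2 p(y) exp(-y) is bounded for
    y = 1/t. *)
Lemma is_derive_flat p (t : R) : is_derive t 1 (flat p) (flat (flat_next p) t).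
Proof.
have [t0|t0|t0] := ltgtP t 0.
- rewrite flat0 ?ltW //.
  apply: (near_eq_is_derive (f := cst 0)).
  by near=> s; rewrite flat0 //; apply/ltW; near: s; exact: lt_nbhsl.
- rewrite [X in is_derive _ _ _ X]/flat t0.
  pose G (y : R) := p.[y] * expR (- y).
  apply: (near_eq_is_derive (f := G \o (fun s => s^-1))).
    near=> s; rewrite /flat /= ifT //; near: s; exact: lt_nbhsr.
  have dG (y : R) : is_derive y 1 G ((p^`() - p).[y] * expR (- y)).
    have dE : is_derive y 1 (expR \o -%R) (expR (- y) * -1) by apply: is_derive1_comp.
    apply: (is_derive_eq (is_deriveM (is_derive_poly p y) dE)).
    rewrite hornerD hornerN /= -[X in X + _]/(p.[y] * (expR (- y) * -1)).
    by rewrite -[X in _ + X]/(expR (- y) * p^`().[y]); ring.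
  have tN0 : t != 0 by rewrite gt_eqF.
  have dV : is_derive t 1 (fun s : R => s^-1) (- t ^- 2 *: 1).
    exact: (@is_deriveV _ id).
  apply: (is_derive_eq (is_derive1_comp (dG t^-1) dV)).
  rewrite -[(- t ^- 2)%:A]/(- t ^- 2 * 1) mulr1 /flat_next !hornerE exprVn; ring.
- rewrite t0 flat0 //.
  have [C C0 bC] := poly_expR_bounded ('X^2 * p).
  apply: (is_derive_quadratic C0) => h; rewrite /flat; case: ifP => h0; last first.
    by rewrite normr0 mulr_ge0 // sqr_ge0.
  have : h^-1 ^+ 2 * `|p.[h^-1] * expR (- h^-1)| <= C.
    have := bC h^-1; rewrite invr_ge0 (ltW h0) => /(_ isT).
    by rewrite !hornerE -mulrA normrM normrX (ger0_norm (ltW _)) ?invr_gt0.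
  by rewrite exprVn ler_pdivrMl ?exprn_gt0 // [_ * C]mulrC.
Unshelve. all: by end_near. Qed.

Lemma class_C_flat j (p : {poly R}) : class_C j setT (flat p).
Proof.
elim: j p => [|j IH] p.
  split=> // t _; apply/differentiable_continuous/derivable1_diffP.
  by have [] := is_derive_flat p t.
split=> [t _|v].
  apply/differentiable_continuous/derivable1_diffP.
  by have [] := is_derive_flat p t.
have dv t : differentiable (flat p) t.
  by apply/derivable1_diffP; have [] := is_derive_flat p t.
split=> [t _|]; first exact: diff_derivable.
apply: (@class_C_eq _ _ _ _ _ ((fun=> v) * flat (flat_next p))).
- exact: openT.
- move=> t _; have [_ D1] := is_derive_flat p t.
  by rewrite (deriveE v (dv t)) diff1_mul // D1.
- by apply: class_C_mul; [exact: openT|exact: class_C_cst|exact: IH].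
Qed.

(** A smooth step from 1 on t <= 1 to 0 on t >= 2.  The denominator is positive
    because one of 2 - t and t - 1 is. *)
Definition step (t : R) : R := flat 1 (2 - t) / (flat 1 (2 - t) + flat 1 (t - 1)).

Lemma flat1_gt0 t : 0 < t -> 0 < flat 1 t.
Proof. by move=> t0; rewrite /flat t0 hornerC mul1r expR_gt0. Qed.

Lemma flat1_ge0 t : 0 <= flat 1 t.
Proof. by have [/flat0->//|/flat1_gt0/ltW] := leP t 0. Qed.

Lemma step1 t : t <= 1 -> step t = 1.
Proof.
move=> t1; rewrite /step (@flat0 _ (t - 1)) ?subr_le0 // addr0 divff // gt_eqF //.
by apply: flat1_gt0; lra.
Qed.

Lemma step0 t : 2 <= t -> step t = 0.
Proof. by move=> t2; rewrite /step flat0 ?mul0r // subr_le0. Qed.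

Lemma class_C_step j : class_C j setT step.
Proof.
have oT : open [set: R] by exact: openT.
have C1 (f : R -> R) : class_C j setT f -> class_C j setT (flat 1 \o f).
  by move=> Cf; apply: class_C_comp1 (class_C_flat j 1) Cf.
have Cid : class_C j [set: R] (fun t : R => t).
  case: j {C1} => [|j]; split=> //; [by move=> t _; exact: cvg_id|by move=> t _; exact: cvg_id|].
  move=> v; split=> [t _|]; first exact: derivable_id.
  rewrite (_ : 'D_v _ = fun=> v); first exact: class_C_cst.
  by apply/funext => t; exact: derive_id.
have A : class_C j setT (fun t : R => flat 1 (2 - t)).
  apply: (C1 (fun t => 2 - t)); apply: (@class_C_eq _ _ _ _ _ ((fun=> 2) + (fun=> -1) * (fun t : R => t))) => //.
    by move=> t _; rewrite !fctE /= mulN1r.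
  by apply: class_C_add => //; [|apply: class_C_mul => //]; exact: class_C_cst.
have B : class_C j setT (fun t : R => flat 1 (t - 1)).
  apply: (C1 (fun t => t - 1)); apply: (@class_C_eq _ _ _ _ _ ((fun t : R => t) + (fun=> -1))) => //.
  by apply: class_C_add => //; exact: class_C_cst.
apply: (@class_CM _ _ _ _ (fun t : R => flat 1 (2 - t)) (fun t => (flat 1 (2 - t) + flat 1 (t - 1))^-1)) => //.
apply: class_C_inv => //; last exact: (class_C_add oT A B).
move=> t _; rewrite gt_eqF //.
have [t2|t2] := ltP t 2.
  by rewrite ltr_pwDl ?flat1_ge0 // flat1_gt0 // subr_gt0.
by rewrite ltr_wpDl ?flat1_ge0 // flat1_gt0 //; lra.
Qed.

(** The sum of the squares of the entries replaces the norm, which is not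
    smooth; it dominates the square of the norm. *)
Lemma bump_exists k n (x0 : 'M[R]_(k, n)) (r : R) : 0 < r ->
  exists beta : 'M[R]_(k, n) -> R,
    [/\ smooth_fun setT beta, \forall x \near x0, beta x = 1 &
        forall x, r < `|x0 - x| -> beta x = 0].
Proof.
move=> r0; have oT : open [set: 'M[R]_(k, n)] by exact: openT.
pose c := 2 / r ^+ 2; have c0 : 0 < c by rewrite divr_gt0 // exprn_gt0.
pose N (x : 'M[R]_(k, n)) := c * \sum_p (x p.1 p.2 - x0 p.1 p.2) ^+ 2.
have CN j : class_C j setT N.
  apply: (@class_CM _ _ _ _ (fun=> c) (fun x : 'M[R]_(k, n) => \sum_p (x p.1 p.2 - x0 p.1 p.2) ^+ 2)) => //.
    exact: class_C_cst.
  apply: class_C_sum => // p _.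
  have Cp : class_C j setT (fun x : 'M[R]_(k, n) => x p.1 p.2 - x0 p.1 p.2).
    apply: (@class_CD _ _ _ _ _ (fun x : 'M[R]_(k, n) => x p.1 p.2 : R) (fun=> - x0 p.1 p.2)) => //.
      exact: class_C_coord.
    exact: class_C_cst.
  by apply: class_C_eq (class_C_mul oT Cp Cp).
have N0 : N x0 = 0.
  by rewrite /N big1 ?mulr0 // => p _; rewrite subrr expr0n.
exists (step \o N); split.
- by move=> j; apply: class_C_comp1 (class_C_step j) (CN j).
- have : N x @[x --> x0] --> N x0 by exact: (CN 0%N).1.
  move=> /cvgrPdist_lt /(_ 1 ltr01); rewrite N0 => N1.
  apply: filterS N1 => x; rewrite sub0r normrN => N1 /=.
  by rewrite step1 // (le_trans (ler_norm _)) // ltW.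
- move=> x rx; rewrite /= step0 //.
  have x0x : x0 != x by apply: contraTneq rx => ->; rewrite subrr normr0 -leNgt ltW.
  have /mx_norm_neq0 [p Ep] : mx_norm (x0 - x) != 0.
    by apply: contraTneq rx => E; rewrite -leNgt /Num.Def.normr/= E ltW.
  rewrite /Num.Def.normr/= Ep !mxE in rx.
  rewrite /N /c mulrAC ler_pdivlMr ?exprn_gt0 // ler_wpM2l //.
  rewrite (bigD1 p) //= -[leLHS]addr0 lerD ?sumr_ge0 // => [|q _]; last exact: sqr_ge0.
  rewrite -[leRHS]real_normK ?num_real // distrC ler_sqr ?nnegrE ?ltW //.
  by rewrite (lt_trans r0).
Qed.

End Bump.

(** * Germs of smooth functions on subsets of X^k *)

Section Germs.
Context {R : realType}.

Lemma open_forall (T : topologicalType) (I : finType) (A : I -> set T) :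
  (forall i, open (A i)) -> open [set x | forall i, A i x].
Proof.
move=> oA; rewrite openE => x Ax; apply: filter_forall => i.
by apply: open_nbhs_nbhs; split; [exact: oA|exact: Ax].
Qed.

Section Near.
Context {n k : nat} {X : manifold R n}.
Implicit Types (S P Q : set ('I_k -> X)) (p q : 'I_k -> X).

(** Neighbourhoods of [p] relative to [S], given by boxes of open sets, so that no
    topology on the type of tuples is involved. *)
Definition near_in S p P := exists N : 'I_k -> set X,
  (forall i, open (N i) /\ N i (p i)) /\
  forall q, S q -> (forall i, N i (q i)) -> P q.

Lemma near_inT S p P : (forall q, S q -> P q) -> near_in S p P.
Proof. by move=> h; exists (fun=> setT); split=> [i|q /h //]; split=> //; exact: openT. Qed.

Lemma near_inI S p P Q : near_in S p P -> near_in S p Q -> near_in S p (P `&` Q).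
Proof.
move=> [N [oN NP]] [N' [oN' NQ]]; exists (fun i => N i `&` N' i); split=> [i|q Sq NN].
  have [[oi pi] [oi' pi']] := (oN i, oN' i).
  by split=> //; exact: openI.
by split; [apply: NP => // i; case: (NN i)|apply: NQ => // i; case: (NN i)].
Qed.

Lemma near_inS S p P Q : (forall q, S q -> P q -> Q q) -> near_in S p P -> near_in S p Q.
Proof.
by move=> PQ [N [oN NP]]; exists N; split=> // q Sq Nq; apply: PQ => //; exact: NP.
Qed.

Lemma near_in_self S p P : S p -> near_in S p P -> P p.
Proof. by move=> Sp [N [oN NP]]; apply: NP => // i; case: (oN i). Qed.

Lemma near_in_near S p P : near_in S p P -> near_in S p (fun q => near_in S q P).
Proof.
move=> [N [oN NP]]; exists N; split=> // q Sq Nq; exists N; split=> // i.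
by split; [case: (oN i)|exact: Nq].
Qed.

Lemma near_in_open S p (i : 'I_k) (N : set X) : open N -> N (p i) ->
  near_in S p (fun q => N (q i)).
Proof.
move=> oN Np; exists (fun j => if j == i then N else setT); split=> [j|q _ /(_ i)].
  by case: eqP => [->|_] //; split=> //; exact: openT.
by rewrite eqxx.
Qed.

Lemma near_in_forall (I : finType) S p (P : I -> set ('I_k -> X)) :
  (forall i, near_in S p (P i)) -> near_in S p (fun q => forall i, P i q).
Proof.
move=> /choice [N HN]; exists (fun j => [set x | forall i, N i j x]); split=> [j|q Sq NN].
  split; last by move=> i; have [/(_ j) []] := HN i.
  by apply: open_forall => i; have [/(_ j) []] := HN i.
by move=> i; have [_] := HN i; apply=> // j; exact: NN.
Qed.

Definition charts_at (phi : 'I_k -> chart X n) p :=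
  forall i, atlas (phi i) /\ chart_dom (phi i) (p i).

Lemma charts_exist p : exists phi, charts_at phi p.
Proof.
have /choice [phi Hphi] : forall i, exists phi : chart X n, atlas phi /\ chart_dom phi (p i).
  by move=> i; have [phi ? ?] := atlas_cover (p i); exists phi.
by exists phi.
Qed.

Lemma chart_open (phi : chart X n) : atlas phi -> open (chart_dom phi).
Proof. by move=> /atlas_chart []. Qed.

Lemma chart_continuous (phi : chart X n) x : atlas phi -> chart_dom phi x ->
  {for x, continuous phi}.
Proof.
move=> /atlas_chart [od _ cphi _ _] dx; rewrite continuous_open_subspace // in cphi.
by apply: cphi; rewrite inE.
Qed.

Lemma chart_invK (phi : chart X n) x : atlas phi -> chart_dom phi x ->
  chart_inv phi (phi x) = x.
Proof. by move=> /atlas_chart [_ _ _ _]; exact. Qed.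

Lemma chart_image_open (phi : chart X n) (N : set X) : atlas phi -> open N ->
  open (phi @` (chart_dom phi `&` N)).
Proof.
move=> aphi oN; have [od oi _ ci invK] := atlas_chart aphi.
rewrite continuous_open_subspace // in ci.
have -> : phi @` (chart_dom phi `&` N) = phi @` chart_dom phi `&` chart_inv phi @^-1` N.
  apply/seteqP; split=> [y [x [dx Nx] <-]|y [[x dx <-]]] /=.
    by split; [exists x|rewrite /= invK].
  by rewrite invK // => Nx; exists x.
rewrite openE => y [iy Ny]; apply: filterI; first by apply: open_nbhs_nbhs; split.
by apply: (ci y); [rewrite inE|apply: open_nbhs_nbhs; split].
Qed.

Lemma coords_near S p phi (W : set 'M[R]_(k, n)) : charts_at phi p ->
  open W -> W (coords phi p) ->
  near_in S p (fun q => (forall i, chart_dom (phi i) (q i)) /\ W (coords phi q)).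
Proof.
move=> cphi oW Wp; have : nbhs (coords phi p) W by apply: open_nbhs_nbhs; split.
move=> [P nP PW].
exists (fun i => chart_dom (phi i) `&` (interior [set x | forall j, P i j (phi i x ord0 j)])).
split=> [i|q Sq Nq].
  have [ai di] := cphi i; split.
    by apply: openI; [exact: chart_open|exact: open_interior].
  split=> //; apply: filter_forall => j.
  have := nP i j; rewrite mxE => nPij.
  apply: (continuous_comp (chart_continuous ai di) (@coord_continuous _ _ _ ord0 j _)).
  exact: nPij.
split=> [i|]; first by case: (Nq i).
by apply: PW => i j; rewrite mxE; have [_ /interior_subset] := Nq i; exact.
Qed.

Lemma near_coords S p phi P : charts_at phi p -> near_in S p P ->
  exists W : set 'M[R]_(k, n), [/\ open W, W (coords phi p) &
    forall q, S q -> (forall i, chart_dom (phi i) (q i)) -> W (coords phi q) -> P q].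
Proof.
move=> cphi [N [oN NP]]; exists [set A | forall i, (phi i @` (chart_dom (phi i) `&` N i)) (row i A)].
have row_coords q i : row i (coords phi q) = phi i (q i).
  by apply/rowP => j; rewrite !mxE.
split.
- apply: open_forall => i; apply: (@open_comp _ _ (row i)).
    move=> A _; apply: continuous_mxP => j l.
    rewrite (_ : (fun y => _) = (fun y : 'M[R]_(k, n) => y i l)); first exact: coord_continuous.
    by apply/funext => B; rewrite mxE.
  by apply: chart_image_open; [case: (cphi i)|case: (oN i)].
- by move=> i /=; rewrite row_coords; exists (p i) => //; split; [case: (cphi i)|case: (oN i)].
- move=> q Sq dq Wq; apply: NP => // i; have := Wq i; rewrite row_coords.
  move=> [x [dx Nx] E]; have [ai _] := cphi i.
  by rewrite -(chart_invK ai (dq i)) -E chart_invK.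
Qed.

Lemma coordsE phi q i j : coords phi q i j = (phi i (q i) : 'rV[R]_n) ord0 j.
Proof. by rewrite mxE. Qed.

(** The germ at [p] of the condition in [smooth_on], for functions with values in
    a normed module. *)
Definition smooth_at (U : normedModType R) S (f : ('I_k -> X) -> U) p : Prop :=
  forall phi, charts_at phi p ->
    exists (W : set 'M[R]_(k, n)) (F : 'M[R]_(k, n) -> U),
      [/\ open W, W (coords phi p), smooth_fun W F &
          forall q, S q -> (forall i, chart_dom (phi i) (q i)) ->
            W (coords phi q) -> f q = F (coords phi q)].

Lemma smooth_at_eq (U : normedModType R) S (f g : ('I_k -> X) -> U) p :
  near_in S p (fun q => f q = g q) -> smooth_at S f p -> smooth_at S g p.
Proof.
move=> fg sf phi cphi; have [W [F [oW Wp sF E]]] := sf phi cphi.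
have [W' [oW' W'p W'E]] := near_coords cphi fg.
exists (W `&` W'), F; split=> //; first exact: openI.
  by move=> j; apply: class_C_sub (sF j) => x [].
by move=> q Sq dq [Wq W'q]; rewrite -W'E // E.
Qed.

Lemma smooth_at_near (U : normedModType R) S S' (f : ('I_k -> X) -> U) p :
  near_in S p S' -> smooth_at (S `&` S') f p -> smooth_at S f p.
Proof.
move=> sS sf phi cphi; have [W [F [oW Wp sF E]]] := sf phi cphi.
have [W' [oW' W'p W'E]] := near_coords cphi sS.
exists (W `&` W'), F; split=> //; first exact: openI.
  by move=> j; apply: class_C_sub (sF j) => x [].
by move=> q Sq dq [Wq W'q]; apply: E => //; split=> //; exact: W'E.
Qed.

Lemma smooth_at_open (U : normedModType R) S (f : ('I_k -> X) -> U) p (O : set U) :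
  S p -> smooth_at S f p -> open O -> O (f p) -> near_in S p (fun q => O (f q)).
Proof.
move=> Sp sf oO Op; have [phi cphi] := charts_exist p.
have [W [F [oW Wp sF E]]] := sf phi cphi.
have FE : f p = F (coords phi p) by apply: E => // i; case: (cphi i).
have oV : open (W `&` F @^-1` O).
  rewrite openE => A [WA OA]; apply: filterI; first by apply: open_nbhs_nbhs.
  by apply: ((sF 0%N).1 A WA); apply: open_nbhs_nbhs.
have Vp : (W `&` F @^-1` O) (coords phi p) by split=> //=; rewrite -FE.
apply: near_inS (coords_near S cphi oV Vp) => q Sq [dq [Wq /=]].
by rewrite -E.
Qed.

Lemma smooth_at_neq0 S (f : ('I_k -> X) -> R) p : S p -> smooth_at S f p ->
  f p != 0 -> near_in S p (fun q => f q != 0).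
Proof.
move=> Sp sf fp; apply: (smooth_at_open Sp sf (@open_neq R 0)).
exact: fp.
Qed.

Lemma smooth_at_cst (U : normedModType R) S p (a : U) : smooth_at S (fun=> a) p.
Proof.
move=> phi cphi; exists setT, (fun=> a); split=> //; first exact: openT.
by move=> j; exact: class_C_cst.
Qed.

Lemma smooth_at2 (U1 U2 U3 : normedModType R) S p (op : U1 -> U2 -> U3) f g :
  (forall W F G, open W -> smooth_fun W F -> smooth_fun W G ->
     smooth_fun W (fun A : 'M[R]_(k, n) => op (F A) (G A))) ->
  smooth_at S f p -> smooth_at S g p -> smooth_at S (fun q => op (f q) (g q)) p.
Proof.
move=> sop sf sg phi cphi; have [W [F [oW Wp sF E]]] := sf phi cphi.
have [W' [G [oW' W'p sG E']]] := sg phi cphi.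
exists (W `&` W'), (fun A => op (F A) (G A)); split=> //; first exact: openI.
  apply: sop; first exact: openI.
    by move=> j; apply: class_C_sub (sF j) => x [].
  by move=> j; apply: class_C_sub (sG j) => x [].
by move=> q Sq dq [Wq W'q]; rewrite E // E'.
Qed.

Lemma smooth_atD (U : normedModType R) S p (f g : ('I_k -> X) -> U) :
  smooth_at S f p -> smooth_at S g p -> smooth_at S (fun q => f q + g q) p.
Proof. by apply: smooth_at2 => W F G oW sF sG j; exact: class_CD. Qed.

Lemma smooth_atM S p (f g : ('I_k -> X) -> R) :
  smooth_at S f p -> smooth_at S g p -> smooth_at S (fun q => f q * g q) p.
Proof. by apply: smooth_at2 => W F G oW sF sG j; exact: class_CM. Qed.

Lemma smooth_at_sum (U : normedModType R) S p (I : Type) (s : seq I) (Q : pred I)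
    (f : I -> ('I_k -> X) -> U) :
  (forall i, Q i -> smooth_at S (f i) p) ->
  smooth_at S (fun q => \sum_(i <- s | Q i) f i q) p.
Proof.
move=> sf; elim: s => [|i s IH].
  apply: (@smooth_at_eq _ _ (fun=> 0)); last exact: smooth_at_cst.
  by apply: near_inT => q _; rewrite big_nil.
case Qi : (Q i).
  apply: smooth_at_eq (smooth_atD (sf i Qi) IH); apply: near_inT => q _.
  by rewrite big_cons Qi.
apply: smooth_at_eq IH; apply: near_inT => q _.
by rewrite big_cons Qi.
Qed.

Lemma smooth_at_prod S p (I : Type) (s : seq I) (Q : pred I)
    (f : I -> ('I_k -> X) -> R) :
  (forall i, Q i -> smooth_at S (f i) p) ->
  smooth_at S (fun q => \prod_(i <- s | Q i) f i q) p.
Proof.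
move=> sf; elim: s => [|i s IH].
  apply: (@smooth_at_eq R _ (fun=> 1)); last exact: smooth_at_cst.
  by apply: near_inT => q _; rewrite big_nil.
case Qi : (Q i).
  apply: smooth_at_eq (smooth_atM (sf i Qi) IH); apply: near_inT => q _.
  by rewrite big_cons Qi.
apply: smooth_at_eq IH; apply: near_inT => q _.
by rewrite big_cons Qi.
Qed.

Lemma smooth_at_mxP S p a b (f : ('I_k -> X) -> 'M[R]_(a, b)) :
  smooth_at S f p <-> forall i j, smooth_at S (fun q => f q i j : R) p.
Proof.
split=> [sf i j phi cphi|sf phi cphi].
  have [W [F [oW Wp sF E]]] := sf phi cphi.
  exists W, (fun A => F A i j); split=> //.
    by move=> l; apply: (class_C_mxP _ _ oW).1 (sF l) i j.
  by move=> q Sq dq Wq; rewrite E.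
have /choice [W HW] : forall ij : 'I_a * 'I_b, exists W : set 'M[R]_(k, n), exists F : 'M[R]_(k, n) -> R,
      [/\ open W, W (coords phi p), smooth_fun W F &
          forall q, S q -> (forall i, chart_dom (phi i) (q i)) ->
            W (coords phi q) -> f q ij.1 ij.2 = F (coords phi q)].
  by move=> [i j]; exact: sf.
have [F HF] := choice HW.
exists [set A | forall ij, W ij A], (fun A => \matrix_(i, j) F (i, j) A).
have oW : open [set A | forall ij, W ij A].
  by apply: open_forall => ij; case: (HF ij).
split=> //.
- by move=> ij; case: (HF ij).
- move=> l; apply/(class_C_mxP _ _ oW) => i j.
  have [_ _ sF _] := HF (i, j).
  apply: (@class_C_eq _ _ _ _ _ (F (i, j))) => //; first by move=> A _; rewrite mxE.
  by apply: class_C_sub (sF l) => A /(_ (i, j)).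
- move=> q Sq dq Wq; apply/matrixP => i j; rewrite mxE.
  by have [_ _ _ ->] := HF (i, j).
Qed.

Lemma smooth_at_compR a b S p (f : ('I_k -> X) -> 'M[R]_(a, b))
    (W' : set 'M[R]_(a, b)) (g : 'M[R]_(a, b) -> R) :
  S p -> smooth_at S f p -> open W' -> W' (f p) -> smooth_fun W' g ->
  smooth_at S (fun q => g (f q)) p.
Proof.
move=> Sp sf oW' W'p sg phi cphi; have [W [F [oW Wp sF E]]] := sf phi cphi.
have FE : f p = F (coords phi p) by apply: E => // i; case: (cphi i).
have cF A : W A -> {for A, continuous F} by exact: (sF 0%N).1.
exists (W `&` F @^-1` W'), (g \o F); split.
- rewrite openE => A [WA W'A]; apply: filterI; first by apply: open_nbhs_nbhs.
  by apply: (cF A WA); apply: open_nbhs_nbhs.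
- by split=> //=; rewrite -FE.
- move=> j; apply: (class_C_comp (W' := W')) => //.
  + rewrite openE => A [WA W'A]; apply: filterI; first by apply: open_nbhs_nbhs.
    by apply: (cF A WA); apply: open_nbhs_nbhs.
  + by move=> A [].
  + by apply: class_C_sub (sF j) => A [].
- by move=> q Sq dq [Wq W'q]; rewrite /= E.
Qed.

Lemma smooth_at_comp a b c d S p (f : ('I_k -> X) -> 'M[R]_(a, b))
    (W' : set 'M[R]_(a, b)) (g : 'M[R]_(a, b) -> 'M[R]_(c, d)) :
  S p -> smooth_at S f p -> open W' -> W' (f p) -> smooth_fun W' g ->
  smooth_at S (fun q => g (f q)) p.
Proof.
move=> Sp sf oW' W'p sg; apply/smooth_at_mxP => i j.
apply: (smooth_at_compR (g := fun A => g A i j) Sp sf oW' W'p) => l.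
exact: (class_C_mxP _ _ oW').1 (sg l) i j.
Qed.

Lemma smooth_at_mulmx a b c S p (f : ('I_k -> X) -> 'M[R]_(a, b))
    (g : ('I_k -> X) -> 'M[R]_(b, c)) :
  smooth_at S f p -> smooth_at S g p -> smooth_at S (fun q => f q *m g q) p.
Proof.
move=> /smooth_at_mxP sf /smooth_at_mxP sg; apply/smooth_at_mxP => i j.
apply: (@smooth_at_eq _ _ (fun q => \sum_l f q i l * g q l j)).
  by apply: near_inT => q _; rewrite mxE.
by apply: smooth_at_sum => l _; exact: smooth_atM.
Qed.

Lemma smooth_atZ a b S p (x : ('I_k -> X) -> R) (f : ('I_k -> X) -> 'M[R]_(a, b)) :
  smooth_at S x p -> smooth_at S f p -> smooth_at S (fun q => x q *: f q) p.
Proof.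
move=> sx /smooth_at_mxP sf; apply/smooth_at_mxP => i j.
apply: smooth_at_eq (smooth_atM sx (sf i j)).
by apply: near_inT => q _; rewrite mxE.
Qed.

Lemma smooth_at_inv S p (f : ('I_k -> X) -> R) : S p -> f p != 0 ->
  smooth_at S f p -> smooth_at S (fun q => (f q)^-1) p.
Proof.
move=> Sp fp sf phi cphi; have [W [F [oW Wp sF E]]] := sf phi cphi.
have FE : f p = F (coords phi p) by apply: E => // i; case: (cphi i).
have cF A : W A -> {for A, continuous F} by exact: (sF 0%N).1.
have oV : open (W `&` [set A | F A != 0]).
  rewrite openE => A [WA FA]; apply: filterI; first by apply: open_nbhs_nbhs.
  have : nbhs (F A) [set y | y != 0].
    by apply: open_nbhs_nbhs; split=> //; exact: open_neq.
  exact: (cF A WA).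
exists (W `&` [set A | F A != 0]), (fun A => (F A)^-1); split=> //.
- by split=> //=; rewrite -FE.
- move=> j; apply: class_C_inv => //; first by move=> A [].
  by apply: class_C_sub (sF j) => A [].
- by move=> q Sq dq [Wq W'q]; rewrite /= E.
Qed.

Lemma smooth_at_det a S p (f : ('I_k -> X) -> 'M[R]_a) :
  smooth_at S f p -> smooth_at S (fun q => \det (f q)) p.
Proof.
move=> /smooth_at_mxP sf; apply: smooth_at_sum => s _; apply: smooth_atM.
  exact: smooth_at_cst.
by apply: smooth_at_prod => i _; exact: sf.
Qed.

(** By Cramer's rule. *)
Lemma smooth_at_invmx a S p (f : ('I_k -> X) -> 'M[R]_a) : S p ->
  f p \in unitmx -> smooth_at S f p -> smooth_at S (fun q => invmx (f q)) p.
Proof.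
move=> Sp fp sf; have sdet := smooth_at_det sf.
have dp : \det (f p) != 0 by move: fp; rewrite unitmxE unitfE.
have nu : near_in S p (fun q => \det (f q) != 0).
  exact: smooth_at_neq0.
apply: (@smooth_at_eq _ _ (fun q => (\det (f q))^-1 *: \adj (f q))).
  by apply: near_inS nu => q _ dq; rewrite /invmx unitmxE unitfE dq.
apply: smooth_atZ; first exact: smooth_at_inv.
apply/smooth_at_mxP => i j.
apply: (@smooth_at_eq _ _ (fun q => cofactor (f q) j i)).
  by apply: near_inT => q _; rewrite mxE.
apply: smooth_atM; first exact: smooth_at_cst.
apply: smooth_at_det; apply/smooth_at_mxP => i' j'.
move/smooth_at_mxP: sf => sf.
apply: smooth_at_eq (sf (lift j i') (lift i j')).
by apply: near_inT => q _; rewrite !mxE.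
Qed.

End Near.
End Germs.

(** * Smooth maps between manifolds *)

Section Maps.
Context {R : realType}.

(** Compatibility of the charts of the atlas enters here. *)
Lemma smooth_at_chart n k (X : manifold R n) (S : set ('I_k -> X)) p i (psi : chart X n) :
  atlas psi -> chart_dom psi (p i) -> smooth_at S (fun q => psi (q i)) p.
Proof.
move=> apsi dpsi phi cphi; have [aphi dphi] := cphi i.
pose V := phi i @` (chart_dom (phi i) `&` chart_dom psi).
have oV : open V by apply: chart_image_open => //; exact: chart_open.
have row_coords q : row i (coords phi q) = phi i (q i).
  by apply/rowP => j; rewrite !mxE.
have srow j (W : set 'M[R]_(k, n)) : open W -> class_C j W (row i).
  move=> oW; apply/(class_C_mxP _ _ oW) => a b.
  apply: (@class_C_eq _ _ _ _ _ (fun A : 'M[R]_(k, n) => A i b)) => //.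
    by move=> A _; rewrite mxE.
  exact: class_C_coord.
have oW : open (row i @^-1` V).
  apply: (@open_comp _ _ (row i)) => // A _.
  exact: (srow 0%N setT openT).1.
exists (row i @^-1` V), (fun A => psi (chart_inv (phi i) (row i A))); split=> //.
- by rewrite /= row_coords; exists (p i).
- move=> j; apply/(class_C_mxP _ _ oW) => a b.
  apply: (class_C_comp (W' := V) (g := fun x => psi (chart_inv (phi i) x) a b)) => //.
    by apply: (class_C_mxP _ _ oV).1; exact: atlas_compat.
  exact: srow.
- by move=> q Sq dq _; rewrite row_coords chart_invK.
Qed.

Section MapAt.
Context {n k : nat} {X : manifold R n}.
Implicit Types (S P Q : set ('I_k -> X)) (p q : 'I_k -> X).

Definition map_smooth_at m (Y : manifold R m) S (f : ('I_k -> X) -> Y) p :=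
  forall psi : chart Y m, atlas psi -> chart_dom psi (f p) ->
    near_in S p (fun q => chart_dom psi (f q)) /\ smooth_at S (fun q => psi (f q)) p.

Lemma smooth_onP m (Y : manifold R m) S (f : ('I_k -> X) -> Y) :
  smooth_on S f <-> forall p, S p -> map_smooth_at S f p.
Proof.
split=> [sf p Sp psi apsi dpsi|sf p phi psi Sp cphi apsi dpsi].
  split; last first.
    move=> phi cphi; have [W [F [oW Wp sF E]]] := sf p phi psi Sp cphi apsi dpsi.
    by exists W, F; split=> // q Sq dq Wq; case: (E q Sq dq Wq).
  have [phi cphi] := charts_exist p.
  have [W [F [oW Wp sF E]]] := sf p phi psi Sp cphi apsi dpsi.
  by apply: near_inS (coords_near S cphi oW Wp) => q Sq [dq Wq]; case: (E q Sq dq Wq).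
have [nd sp] := sf p Sp psi apsi dpsi.
have [W [F [oW Wp sF E]]] := sp phi cphi.
have [W' [oW' W'p W'E]] := near_coords cphi nd.
exists (W `&` W'), F; split=> //; first exact: openI.
  by move=> j; apply: class_C_sub (sF j) => x [].
by move=> q Sq dq [Wq W'q]; split; [exact: W'E|exact: E].
Qed.

Lemma map_smooth_at_eq m (Y : manifold R m) S (f g : ('I_k -> X) -> Y) p : S p ->
  near_in S p (fun q => f q = g q) -> map_smooth_at S f p -> map_smooth_at S g p.
Proof.
move=> Sp fg sf psi apsi dpsi; have fgp := near_in_self Sp fg.
have [|nd sp] := sf psi apsi; first by rewrite fgp.
split; first by apply: near_inS (near_inI fg nd) => q Sq [<-].
by apply: smooth_at_eq sp; apply: near_inS fg => q _ ->.
Qed.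

Lemma map_smooth_at_near m (Y : manifold R m) S S' (f : ('I_k -> X) -> Y) p :
  near_in S p S' -> map_smooth_at (S `&` S') f p -> map_smooth_at S f p.
Proof.
move=> sS sf psi apsi dpsi; have [[N [oN NP]] sp] := sf psi apsi dpsi.
split; last exact: smooth_at_near sp.
have : near_in S p (fun q => S' q -> chart_dom psi (f q)).
  by exists N; split=> // q Sq Nq S'q; exact: NP.
by move=> h; apply: near_inS (near_inI sS h) => q Sq [S'q]; apply.
Qed.

Lemma map_smooth_at_proj S p i : map_smooth_at S (fun q => q i) p.
Proof.
move=> psi apsi dpsi; split; last exact: smooth_at_chart.
by apply: near_in_open => //; exact: chart_open.
Qed.

Lemma map_smooth_at_open m (Y : manifold R m) S (f : ('I_k -> X) -> Y) p (O : set Y) :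
  S p -> map_smooth_at S f p -> open O -> O (f p) -> near_in S p (fun q => O (f q)).
Proof.
move=> Sp sf oO Op; have [psi apsi dpsi] := atlas_cover (f p).
have [nd sp] := sf psi apsi dpsi.
have oI := chart_image_open apsi oO.
have := smooth_at_open Sp sp oI; move=> /(_ _) nI.
apply: near_inS (near_inI nd (nI _)) => [q Sq [dq [y [dy Oy] E]]|].
  by rewrite -(chart_invK apsi dq) -E chart_invK.
by exists (f p).
Qed.

Lemma near_in_comp l m (Y : manifold R m) S (f : 'I_l -> ('I_k -> X) -> Y) p
    (S' P' : set ('I_l -> Y)) :
  S p -> (forall j, map_smooth_at S (f j) p) ->
  near_in S p (fun q => S' (fun j => f j q)) ->
  near_in S' (fun j => f j p) P' -> near_in S p (fun q => P' (fun j => f j q)).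
Proof.
move=> Sp sf nS [N [oN NP]].
have nN : near_in S p (fun q => forall j, N j (f j q)).
  by apply: near_in_forall => j; apply: map_smooth_at_open; case: (oN j).
by apply: near_inS (near_inI nS nN) => q Sq [S'q Nq]; exact: NP.
Qed.

Lemma smooth_at_comp_map l m (Y : manifold R m) S (f : 'I_l -> ('I_k -> X) -> Y) p
    (S' : set ('I_l -> Y)) a b (h : ('I_l -> Y) -> 'M[R]_(a, b)) :
  S p -> (forall j, map_smooth_at S (f j) p) ->
  near_in S p (fun q => S' (fun j => f j q)) ->
  smooth_at S' h (fun j => f j p) -> smooth_at S (fun q => h (fun j => f j q)) p.
Proof.
move=> Sp sf nS sh; have [eta ceta] := charts_exist (fun j => f j p).
have [W [F [oW Wp sF E]]] := sh eta ceta.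
have nd : near_in S p (fun q => forall j, chart_dom (eta j) (f j q)).
  by apply: near_in_forall => j; have [aj dj] := ceta j; case: (sf j _ aj dj).
pose c q := coords eta (fun j => f j q).
have sc : smooth_at S c p.
  apply/smooth_at_mxP => i j; have [ai di] := ceta i.
  apply: (@smooth_at_eq _ _ _ _ _ _ (fun q => eta i (f i q) ord0 j : R)).
    by apply: near_inT => q _; rewrite coordsE.
  by have [_ /smooth_at_mxP] := sf i _ ai di.
apply: (@smooth_at_eq _ _ _ _ _ _ (F \o c)); last exact: (smooth_at_comp Sp sc oW Wp sF).
have nW := smooth_at_open Sp sc oW Wp.
apply: near_inS (near_inI nS (near_inI nd nW)) => q Sq [S'q [dq Wq]] /=.
by rewrite E.
Qed.

End MapAt.

Section MapComp.
Context {n k : nat} {X : manifold R n}.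
Implicit Types (S P Q : set ('I_k -> X)) (p q : 'I_k -> X).

Lemma map_smooth_at_comp l m m' (Y : manifold R m) (Z : manifold R m') S
    (f : 'I_l -> ('I_k -> X) -> Y) p (S' : set ('I_l -> Y)) (h : ('I_l -> Y) -> Z) :
  S p -> (forall j, map_smooth_at S (f j) p) ->
  near_in S p (fun q => S' (fun j => f j q)) ->
  map_smooth_at S' h (fun j => f j p) -> map_smooth_at S (fun q => h (fun j => f j q)) p.
Proof.
move=> Sp sf nS sh psi apsi dpsi; have [nd sp] := sh psi apsi dpsi.
split; first exact: (near_in_comp (P' := fun y => chart_dom psi (h y))) nd.
exact: smooth_at_comp_map sp.
Qed.

Lemma map_smooth_at_comp1 m m' (Y : manifold R m) (Z : manifold R m') S p
    (f : ('I_k -> X) -> Y) (h : Y -> Z) :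
  S p -> map_smooth_at S f p -> smooth h -> map_smooth_at S (fun q => h (f q)) p.
Proof.
move=> Sp sf /smooth_onP sh.
apply: (@map_smooth_at_comp 1 _ _ _ _ S (fun _ => f) p setT (fun y => h (y ord0))) => //.
  exact: near_inT.
exact: sh.
Qed.

Lemma map_smooth_at_comp2 m m' (Y : manifold R m) (Z : manifold R m') S p
    (f g : ('I_k -> X) -> Y) (S' : set ('I_2 -> Y)) (h : Y -> Y -> Z) :
  S p -> map_smooth_at S f p -> map_smooth_at S g p ->
  smooth_on S' (fun y => h (y ord0) (y ord_max)) ->
  (forall q, S q -> S' (fun j => if j == ord0 then f q else g q)) ->
  map_smooth_at S (fun q => h (f q) (g q)) p.
Proof.
move=> Sp sf sg /smooth_onP sh SS.
have H := @map_smooth_at_comp 2 _ _ _ _ S (fun j => if j == ord0 then f else g) p S' (fun y => h (y ord0) (y ord_max)).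
have E q : (fun j : 'I_2 => (if j == ord0 then f else g) q) = (fun j => if j == ord0 then f q else g q).
  by apply/funext => j; case: ifP.
apply: H => //.
- by move=> j; case: ifP.
- by apply: near_inT => q /SS; rewrite E.
- by rewrite E; apply: sh; exact: SS.
Qed.

(** Changes of charts of the target are smooth, so one chart suffices. *)
Lemma map_smooth_at_chart m (Y : manifold R m) S (f : ('I_k -> X) -> Y) p (psi : chart Y m) :
  S p -> atlas psi -> near_in S p (fun q => chart_dom psi (f q)) ->
  smooth_at S (fun q => psi (f q)) p -> map_smooth_at S f p.
Proof.
move=> Sp apsi nd sp psi' apsi' dpsi'; have dpsi := near_in_self Sp nd.
pose V := psi @` (chart_dom psi `&` chart_dom psi').
have oV : open V by apply: chart_image_open => //; exact: chart_open.
have Vp : V (psi (f p)) by exists (f p).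
have nV := smooth_at_open Sp sp oV Vp.
split.
  apply: near_inS (near_inI nd nV) => q Sq [dq [y [dy d'y] E]].
  by rewrite -(chart_invK apsi dq) -E chart_invK.
apply: (@smooth_at_eq _ _ _ _ _ _ (fun q => psi' (chart_inv psi (psi (f q))))).
  by apply: near_inS nd => q Sq dq; rewrite chart_invK.
apply: (smooth_at_comp (g := fun x => psi' (chart_inv psi x)) Sp sp oV Vp).
exact: atlas_compat.
Qed.

End MapComp.

(** Since [C] is closed, the function vanishes near every point off [C]. *)
Definition is_bump n (X : manifold R n) (x : X) (N : set X) (beta : X -> R) (V C : set X) :=
  [/\ [/\ open V, V x & V `<=` N], [/\ closed C & C `<=` N],
      forall y, V y -> beta y = 1, forall y, ~ C y -> beta y = 0 &
      forall k (S : set ('I_k -> X)) p i, S p -> smooth_at S (fun q => beta (q i)) p].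

(** A bump function of a chart, extended by 0.  The extension is smooth because
    the image in X of a closed ball of the chart is compact, hence closed: this
    uses that X is a Hausdorff space. *)
Lemma manifold_bump n (X : manifold R n) (x : X) (N : set X) : open N -> N x ->
  exists (beta : X -> R) (V C : set X), is_bump x N beta V C.
Proof.
move=> oN Nx; have [phi aphi dphi] := atlas_cover x.
have oI := chart_image_open aphi oN.
have : nbhs (phi x) (phi @` (chart_dom phi `&` N)).
  by apply: open_nbhs_nbhs; split=> //; exists x.
move=> /nbhs_normP [r0 /= r00 rI].
pose r := r0 / 2; have rgt0 : 0 < r by rewrite divr_gt0.
have [b [sb b1 b0]] := bump_exists (phi x) rgt0.
pose K : set 'rV[R]_n := [set y | `|phi x - y| <= r].
have KI : K `<=` phi @` (chart_dom phi `&` N).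
  by move=> y Ky; apply: rI => /=; rewrite (le_lt_trans Ky) // /r ltr_pdivrMr // ltr_pMr // ltr1n.
have cK : compact K.
  apply: bounded_closed_compact.
    exists (`|phi x| + r); split; first exact: num_real.
    move=> M rM y Ky; apply/ltW/(le_lt_trans _ rM).
    by rewrite -lerBlDl (le_trans _ Ky) // distrC lerB_dist.
  rewrite /K -[X in closed X]/((fun y => `|phi x - y|) @^-1` [set t | t <= r]).
  apply: closed_comp; last exact: closed_le.
  move=> y _; apply: continuous_comp; last exact: norm_continuous.
  by apply: continuousB; [exact: cst_continuous|exact: cvg_id].
pose C := chart_inv phi @` K.
have cC : closed C.
  apply: compact_closed; first exact: manifold_hausdorff.
  apply: continuous_compact => //.
  have [_ _ _ ci _] := atlas_chart aphi.
  apply: continuous_subspaceW ci => y /KI [z [dz _] <-]; exists z => //.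
have CN y : C y -> chart_dom phi y /\ N y.
  by move=> [z /KI [w [dw Nw] <-] <-]; rewrite chart_invK.
have oV := chart_continuous aphi dphi.
pose beta y := if `[< chart_dom phi y >] then b (phi y) else 0.
have bC y : ~ C y -> beta y = 0.
  move=> nC; rewrite /beta; case: asboolP => // dy; apply: b0.
  rewrite ltNge; apply/negP => Ky; apply: nC; exists (phi y) => //.
  by rewrite chart_invK.
have [V [oV' Vx] Vb] : exists2 V, open V /\ V x & V `<=` [set y | (chart_dom phi y /\ N y) /\ b (phi y) = 1].
  have : nbhs x [set y | (chart_dom phi y /\ N y) /\ b (phi y) = 1].
    apply: filterI; first apply: filterI; try by apply: open_nbhs_nbhs; split=> //; exact: chart_open.
    exact: (oV _ b1).
  by rewrite nbhsE => -[V [? ?] ?]; exists V.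
exists beta, V, C; split=> //.
- by split=> // y /Vb [[]].
- by split=> // y /CN [].
- by move=> y /Vb [[dy _] E]; rewrite /beta asboolT.
- move=> k S p i Sp; have [dp|ndp] := pselect (chart_dom phi (p i)); last first.
    have nCp : ~ C (p i) by move=> /CN [].
    apply: (@smooth_at_eq _ _ _ _ _ _ (fun=> 0)); last exact: smooth_at_cst.
    have := near_in_open S (closed_openC cC) nCp.
    by apply: near_inS => q Sq /bC ->.
  apply: (@smooth_at_eq _ _ _ _ _ _ (fun q => b (phi (q i)))).
    have := near_in_open S (chart_open aphi) dp.
    by apply: near_inS => q Sq dq; rewrite /beta asboolT.
  exact: (smooth_at_compR Sp (smooth_at_chart S aphi dp) openT I sb).
Qed.

End Maps.

(** * Fibres and trivializations of vector bundles *)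

Section Bundles.
Context {R : realType}.

Section Fibre.
Context {n r : nat} {B : manifold R n} (E : vbundle B r).
Implicit Types (e : E) (b : B).

(** The charts of [vbundle_chart], with bijectivity of [a] on each fibre in place
    of the description of the image of the chart. *)
Record trivialization (Phi : chart E (n + r)) (phi : chart B n) (U : set B)
    (a : E -> 'rV[R]_r) : Prop := Trivialization {
  triv_atlas : atlas phi;
  triv_open : open U;
  triv_sub : U `<=` chart_dom phi;
  triv_dom : chart_dom Phi = vproj (v := E) @^-1` U;
  triv_map : forall e, U (vproj e) -> Phi e = row_mx (phi (vproj e)) (a e);
  triv_inv : forall b w, U b -> exists2 e, vproj e = b & a e = w;
  triv_inj : forall e e', U (vproj e) -> vproj e = vproj e' -> a e = a e' -> e = e';
  triv_add : forall e e', U (vproj e) -> vproj e = vproj e' -> a (vadd e e') = a e + a e';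
  triv_scale : forall x e, U (vproj e) -> a (vscale x e) = x *: a e;
  triv_zero : forall b, U b -> a (vzero E b) = 0 }.

Lemma trivializationP Phi : atlas Phi -> exists phi U a, trivialization Phi phi U a.
Proof.
move=> aPhi; have [phi [U [a [[h1 h2 h3 h4] h5 h6 [h7 h8 h9]]]]] := vbundle_chart aPhi.
exists phi, U, a; split=> //.
- move=> b w Ub; have : (Phi @` chart_dom Phi) (row_mx (phi b) w).
    by rewrite h6 /= row_mxKl; exists b.
  move=> [e]; rewrite h4 /= => Ue; rewrite h5 // => /eq_row_mx [E1 E2].
  exists e => //; rewrite -(chart_invK h1 (h3 _ Ub)) -E1 chart_invK //; exact: h3.
- move=> e e' Ue pe ae; have Ue' : U (vproj e') by rewrite -pe.
  rewrite -(chart_invK aPhi (x := e)) ?h4 // -(chart_invK aPhi (x := e')) ?h4 //.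
  by rewrite !h5 // pe ae.
Qed.

Lemma triv_exists b : exists Phi phi U a, [/\ atlas Phi, trivialization Phi phi U a & U b].
Proof.
have [Phi aPhi dPhi] := atlas_cover (vzero E b).
have [phi [U [a tr]]] := trivializationP aPhi; exists Phi, phi, U, a; split=> //.
by move: dPhi; rewrite (triv_dom tr) /= vproj_zero.
Qed.

(** Coordinates chosen independently at each point [b], without any smoothness
    in [b]: they serve to prove identities in one fibre. *)
Definition fibre_coord : B -> E -> 'rV[R]_r :=
  fun b => xget (fun=> 0) [set a | exists Phi phi U, trivialization Phi phi U a /\ U b].

Lemma fibre_coordP b : exists Phi phi U, trivialization Phi phi U (fibre_coord b) /\ U b.
Proof.
have [Phi [phi [U [a [_ tr Ub]]]]] := triv_exists b.
by apply: (@xgetPex _ (fun=> 0) [set a | exists Phi phi U, trivialization Phi phi U a /\ U b]); exists a, Phi, phi, U.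
Qed.

Lemma fibre_coord_inj b e e' : vproj e = b -> vproj e' = b ->
  fibre_coord b e = fibre_coord b e' -> e = e'.
Proof.
have [Phi [phi [U [tr Ub]]]] := fibre_coordP b; move=> pe pe'.
by apply: (triv_inj tr); rewrite ?pe // pe'.
Qed.

Lemma fibre_coordD b e e' : vproj e = b -> vproj e' = b ->
  fibre_coord b (vadd e e') = fibre_coord b e + fibre_coord b e'.
Proof.
have [Phi [phi [U [tr Ub]]]] := fibre_coordP b; move=> pe pe'.
by apply: (triv_add tr); rewrite ?pe // pe'.
Qed.

Lemma fibre_coordZ b x e : vproj e = b ->
  fibre_coord b (vscale x e) = x *: fibre_coord b e.
Proof.
have [Phi [phi [U [tr Ub]]]] := fibre_coordP b; move=> pe.
by apply: (triv_scale tr); rewrite ?pe.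
Qed.

Lemma fibre_coord0 b : fibre_coord b (vzero E b) = 0.
Proof. by have [Phi [phi [U [tr Ub]]]] := fibre_coordP b; exact: (triv_zero tr). Qed.

Lemma vaddC e e' : vproj e = vproj e' -> vadd e e' = vadd e' e.
Proof.
move=> pe; apply: (@fibre_coord_inj (vproj e)); rewrite ?vproj_add //.
by rewrite !fibre_coordD // addrC.
Qed.

Lemma vaddA e1 e2 e3 : vproj e1 = vproj e2 -> vproj e2 = vproj e3 ->
  vadd e1 (vadd e2 e3) = vadd (vadd e1 e2) e3.
Proof.
move=> p12 p23; have p13 : vproj e1 = vproj e3 by rewrite p12.
apply: (@fibre_coord_inj (vproj e1)); rewrite ?vproj_add //.
by rewrite !fibre_coordD ?vproj_add // addrA.
Qed.

Lemma vadd0 e b : vproj e = b -> vadd e (vzero E b) = e.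
Proof.
move=> <-; apply: (@fibre_coord_inj (vproj e)); rewrite ?vproj_add ?vproj_zero //.
by rewrite fibre_coordD ?vproj_zero // fibre_coord0 addr0.
Qed.

Lemma v0add e b : vproj e = b -> vadd (vzero E b) e = e.
Proof. by move=> pe; rewrite vaddC ?vproj_zero ?pe // vadd0. Qed.

Lemma vaddN e b : vproj e = b -> vadd e (vscale (-1) e) = vzero E b.
Proof.
move=> <-; apply: (@fibre_coord_inj (vproj e)); rewrite ?vproj_add ?vproj_scale ?vproj_zero //.
by rewrite fibre_coordD ?vproj_scale // fibre_coordZ // fibre_coord0 scaleN1r subrr.
Qed.

Lemma vscale0 e b : vproj e = b -> vscale 0 e = vzero E b.
Proof.
move=> <-; apply: (@fibre_coord_inj (vproj e)); rewrite ?vproj_scale ?vproj_zero //.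
by rewrite fibre_coordZ // fibre_coord0 scale0r.
Qed.

Lemma vscale1 e : vscale 1 e = e.
Proof.
apply: (@fibre_coord_inj (vproj e)); rewrite ?vproj_scale //.
by rewrite fibre_coordZ // scale1r.
Qed.

Lemma vscaleA x y e : vscale x (vscale y e) = vscale (x * y) e.
Proof.
apply: (@fibre_coord_inj (vproj e)); rewrite ?vproj_scale //.
by rewrite !fibre_coordZ ?vproj_scale // scalerA.
Qed.

Lemma vscale_zero x b : vscale x (vzero E b) = vzero E b.
Proof.
apply: (@fibre_coord_inj b); rewrite ?vproj_scale ?vproj_zero //.
by rewrite fibre_coordZ ?vproj_zero // fibre_coord0 scaler0.
Qed.

Lemma vscaleDr x e e' : vproj e = vproj e' ->
  vscale x (vadd e e') = vadd (vscale x e) (vscale x e').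
Proof.
move=> pe; apply: (@fibre_coord_inj (vproj e)); rewrite ?vproj_scale ?vproj_add ?vproj_scale //.
by rewrite fibre_coordZ ?vproj_add // !fibre_coordD ?vproj_scale ?fibre_coordZ // scalerDr.
Qed.

Lemma vproj_sum (I : Type) (s : seq I) (P : pred I) (F : I -> E) b :
  (forall i, P i -> vproj (F i) = b) ->
  vproj (\big[@vadd _ _ _ _ E/vzero E b]_(i <- s | P i) F i) = b.
Proof.
move=> pF; elim/big_rec: _ => [|i x Pi px]; first exact: vproj_zero.
by rewrite vproj_add pF.
Qed.

Lemma fibre_coord_sum (I : Type) (s : seq I) (P : pred I) (F : I -> E) b :
  (forall i, P i -> vproj (F i) = b) ->
  fibre_coord b (\big[@vadd _ _ _ _ E/vzero E b]_(i <- s | P i) F i)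
    = \sum_(i <- s | P i) fibre_coord b (F i).
Proof.
move=> pF; elim: s => [|i s IH]; first by rewrite !big_nil fibre_coord0.
rewrite !big_cons; case Pi : (P i) => //.
by rewrite fibre_coordD ?IH ?vproj_sum ?pF.
Qed.

End Fibre.

Section SmoothFibre.
Context {n k m r : nat} {X : manifold R n} {B : manifold R m} (E : vbundle B r).
Implicit Types (S : set ('I_k -> X)) (p q : 'I_k -> X).

Lemma smooth_at_lsubmx a b c S p (f : ('I_k -> X) -> 'M[R]_(a, b + c)) :
  smooth_at S f p -> smooth_at S (fun q => lsubmx (f q)) p.
Proof.
move=> /smooth_at_mxP sf; apply/smooth_at_mxP => i j.
by apply: smooth_at_eq (sf i (lshift c j)); apply: near_inT => q _; rewrite mxE.
Qed.

Lemma smooth_at_rsubmx a b c S p (f : ('I_k -> X) -> 'M[R]_(a, b + c)) :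
  smooth_at S f p -> smooth_at S (fun q => rsubmx (f q)) p.
Proof.
move=> /smooth_at_mxP sf; apply/smooth_at_mxP => i j.
by apply: smooth_at_eq (sf i (rshift b j)); apply: near_inT => q _; rewrite mxE.
Qed.

Lemma smooth_at_row_mx a b c S p (f : ('I_k -> X) -> 'M[R]_(a, b))
    (g : ('I_k -> X) -> 'M[R]_(a, c)) :
  smooth_at S f p -> smooth_at S g p -> smooth_at S (fun q => row_mx (f q) (g q)) p.
Proof.
move=> /smooth_at_mxP sf /smooth_at_mxP sg; apply/smooth_at_mxP => i j.
case: (split_ordP j) => j' ->.
  by apply: smooth_at_eq (sf i j'); apply: near_inT => q _; rewrite row_mxEl.
by apply: smooth_at_eq (sg i j'); apply: near_inT => q _; rewrite row_mxEr.
Qed.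

Lemma smooth_at_triv S p (u : ('I_k -> X) -> E) Phi phi U a : S p ->
  atlas Phi -> trivialization Phi phi U a -> U (vproj (u p)) -> map_smooth_at S u p ->
  [/\ near_in S p (fun q => U (vproj (u q))),
      smooth_at S (fun q => phi (vproj (u q))) p & smooth_at S (fun q => a (u q)) p].
Proof.
move=> Sp aPhi tr Up su; have [|nU sP] := su Phi aPhi; first by rewrite (triv_dom tr).
have {}nU : near_in S p (fun q => U (vproj (u q))).
  by apply: near_inS nU => q Sq; rewrite (triv_dom tr).
split=> //.
  apply: smooth_at_eq (smooth_at_lsubmx sP); apply: near_inS nU => q Sq Uq.
  by rewrite (triv_map tr) // row_mxKl.
apply: smooth_at_eq (smooth_at_rsubmx sP); apply: near_inS nU => q Sq Uq.
by rewrite (triv_map tr) // row_mxKr.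
Qed.

Lemma map_smooth_at_triv S p (u : ('I_k -> X) -> E) Phi phi U a : S p ->
  atlas Phi -> trivialization Phi phi U a ->
  near_in S p (fun q => U (vproj (u q))) ->
  smooth_at S (fun q => phi (vproj (u q))) p -> smooth_at S (fun q => a (u q)) p ->
  map_smooth_at S u p.
Proof.
move=> Sp aPhi tr nU sphi sa; apply: (map_smooth_at_chart Sp aPhi).
  by apply: near_inS nU => q Sq; rewrite (triv_dom tr).
apply: smooth_at_eq (smooth_at_row_mx sphi sa); apply: near_inS nU => q Sq Uq.
by rewrite (triv_map tr).
Qed.

Lemma map_smooth_at_vadd S p (u v : ('I_k -> X) -> E) : S p ->
  near_in S p (fun q => vproj (u q) = vproj (v q)) ->
  map_smooth_at S u p -> map_smooth_at S v p ->
  map_smooth_at S (fun q => vadd (u q) (v q)) p.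
Proof.
move=> Sp puv su sv; have [Phi [phi [U [a [aPhi tr Up]]]]] := triv_exists E (vproj (u p)).
have [nU sphi sa] := smooth_at_triv Sp aPhi tr Up su.
have Up' : U (vproj (v p)) by rewrite -(near_in_self Sp puv).
have [_ _ sa'] := smooth_at_triv Sp aPhi tr Up' sv.
have nn := near_inI puv nU.
apply: (map_smooth_at_triv Sp aPhi tr).
- by apply: near_inS nn => q Sq [pq Uq]; rewrite vproj_add.
- by apply: smooth_at_eq sphi; apply: near_inS nn => q Sq [pq Uq]; rewrite vproj_add.
- apply: smooth_at_eq (smooth_atD sa sa'); apply: near_inS nn => q Sq [pq Uq].
  by rewrite (triv_add tr).
Qed.

Lemma map_smooth_at_vscale S p (x : ('I_k -> X) -> R) (u : ('I_k -> X) -> E) : S p ->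
  smooth_at S x p -> map_smooth_at S u p ->
  map_smooth_at S (fun q => vscale (x q) (u q)) p.
Proof.
move=> Sp sx su; have [Phi [phi [U [a [aPhi tr Up]]]]] := triv_exists E (vproj (u p)).
have [nU sphi sa] := smooth_at_triv Sp aPhi tr Up su.
apply: (map_smooth_at_triv Sp aPhi tr).
- by apply: near_inS nU => q Sq Uq; rewrite vproj_scale.
- by apply: smooth_at_eq sphi; apply: near_inS nU => q Sq Uq; rewrite vproj_scale.
- apply: smooth_at_eq (smooth_atZ sx sa); apply: near_inS nU => q Sq Uq.
  by rewrite (triv_scale tr).
Qed.

Lemma map_smooth_at_vzero S p (b : ('I_k -> X) -> B) : S p ->
  map_smooth_at S b p -> map_smooth_at S (fun q => vzero E (b q)) p.
Proof.
move=> Sp sb; have [Phi [phi [U [a [aPhi tr Up]]]]] := triv_exists E (b p).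
have nU := map_smooth_at_open Sp sb (triv_open tr) Up.
have [_ sphi] := sb _ (triv_atlas tr) (triv_sub tr Up).
apply: (map_smooth_at_triv Sp aPhi tr).
- by apply: near_inS nU => q Sq Uq; rewrite vproj_zero.
- by apply: smooth_at_eq sphi; apply: near_inS nU => q Sq Uq; rewrite vproj_zero.
- apply: (@smooth_at_eq _ _ _ _ _ _ (fun=> 0)); last exact: smooth_at_cst.
  by apply: near_inS nU => q Sq Uq; rewrite (triv_zero tr).
Qed.

Lemma map_smooth_at_vproj S p (u : ('I_k -> X) -> E) : S p ->
  map_smooth_at S u p -> map_smooth_at S (fun q => vproj (u q)) p.
Proof.
move=> Sp su; have [Phi [phi [U [a [aPhi tr Up]]]]] := triv_exists E (vproj (u p)).
have [nU sphi _] := smooth_at_triv Sp aPhi tr Up su.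
apply: (map_smooth_at_chart Sp (triv_atlas tr)) => //.
by apply: near_inS nU => q _; exact: (triv_sub tr).
Qed.

End SmoothFibre.
End Bundles.

(** * Gluing local sections of a vector bundle *)

Section Gluing.
Context {R : realType} {n k m r : nat} {X : manifold R n} {B : manifold R m}
        (E : vbundle B r).
Implicit Types (p q : 'I_k -> X).

Definition box (N : 'I_k -> set X) : set ('I_k -> X) := [set q | forall i, N i (q i)].

Lemma near_in_box S p (N : 'I_k -> set X) : (forall i, open (N i)) -> box N p ->
  near_in S p (box N).
Proof. by move=> oN Np; exists N; split=> // i; split. Qed.

(** Shrink the boxes to boxes of basic open sets, which a natural number codes;
    for each code that occurs, keep one point of [S]. *)
Lemma countable_box_cover (S : set ('I_k -> X)) p0 (V : ('I_k -> X) -> 'I_k -> set X) :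
  S p0 -> (forall p i, S p -> open (V p i) /\ V p i (p i)) ->
  exists c : nat -> 'I_k -> X, (forall j, S (c j)) /\
    forall q, S q -> exists j, box (V (c j)) q.
Proof.
move=> Sp0 oV; have [BB /countable_injP [g ginj] [BBo BBx]] := @manifold_second_countable _ _ X.
have /choice [U HU] : forall p, exists U : 'I_k -> set X, S p ->
    forall i, [/\ BB (U i), U i (p i) & U i `<=` V p i].
  move=> p; have [Sp|nSp] := pselect (S p); last by exists (fun=> set0).
  have /choice [U HU] : forall i, exists U : set X, [/\ BB U, U (p i) & U `<=` V p i].
    move=> i; have [oVi Vpi] := oV p i Sp.
    have [U [BU Up] UV] := BBx (p i) _ (open_nbhs_nbhs (conj oVi Vpi)).
    by exists U.
  by exists U.
pose code p := pickle [ffun i => g (U p i)].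
have /choice [c Hc] : forall j, exists p, S p /\ forall q, S q -> code q = j -> code p = j.
  move=> j; have [[p [Sp cp]]|np] := pselect (exists p, S p /\ code p = j).
    by exists p; split=> // q.
  by exists p0; split=> // q Sq cq; case: np; exists q.
exists c; split=> [j|q Sq]; first by case: (Hc j).
exists (code q) => i; have [Sc /(_ q Sq erefl)] := Hc (code q).
move=> /(pcan_inj pickleK) /ffunP /(_ i); rewrite !ffunE => E'.
have [BU Uq _] := HU q Sq i; have [BU' _ UV] := HU _ Sc i.
by apply: UV; rewrite (ginj _ _ _ _ E') // inE.
Qed.

(** A substitute for a partition of unity.  Let the local sections s_0, s_1, ...
    be defined on boxes N_0, N_1, ... such that smaller boxes V_i in N_i still cover,
    and let chi_i be a bump function, 1 on V_i and 0 off N_i.  Starting from s_j,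
    replace a section u by (1 - chi_i) u + chi_i s_i successively for
    i = j - 1, ..., 0; this gives a section L_j on N_j.  Step i forgets everything
    before it on V_i, so L_j = L_i on V_i for i <= j.  Hence the section whose value
    at q is L_j(q), for the first j with q in V_j, equals one fixed L_j near each
    point. *)
Lemma glue_sections (S : set ('I_k -> X)) (A : ('I_k -> X) -> set E)
    (d : ('I_k -> X) -> E) :
  (forall q e e' t, S q -> A q e -> A q e' -> A q (vadd (vscale (1 - t) e) (vscale t e'))) ->
  (forall q e e', S q -> A q e -> A q e' -> vproj e = vproj e') ->
  (forall p, S p -> exists s : ('I_k -> X) -> E,
     near_in S p (fun q => A q (s q) /\ map_smooth_at S s q)) ->
  exists s : ('I_k -> X) -> E, forall q, S q -> A q (s q) /\ map_smooth_at S s q.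
Proof.
move=> affA fibA loc.
have [[p0 Sp0]|nS] := pselect (exists p, S p); last first.
  by exists d => q Sq; case: nS; exists q.
have /choice [s Hs] : forall p, exists s : ('I_k -> X) -> E, S p ->
     near_in S p (fun q => A q (s q) /\ map_smooth_at S s q).
  by move=> p; have [/loc [s ?]|?] := pselect (S p); [exists s|exists d].
have /choice [N HN] : forall p, exists N : 'I_k -> set X, S p ->
    (forall i, open (N i) /\ N i (p i)) /\
    forall q, S q -> box N q -> A q (s p q) /\ map_smooth_at S (s p) q.
  by move=> p; have [/Hs [N ?]|?] := pselect (S p); [exists N|exists (fun=> set0)].
have /choice [bu Hbu] : forall p, exists bu : 'I_k -> (X -> R) * set X * set X, S p ->
    forall i, is_bump (p i) (N p i) (bu i).1.1 (bu i).1.2 (bu i).2.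
  move=> p; have [Sp|?] := pselect (S p); last by exists (fun=> (fun=> 0, set0, set0)).
  have /choice [bu Hbu] : forall i, exists bu : (X -> R) * set X * set X,
      is_bump (p i) (N p i) bu.1.1 bu.1.2 bu.2.
    move=> i; have [/(_ i) [oN Np] _] := HN p Sp.
    by have [beta [V [C HVC]]] := manifold_bump oN Np; exists (beta, V, C).
  by exists bu.
pose V p i := (bu p i).1.2.
have [c [Sc cov]] : exists c : nat -> 'I_k -> X, (forall j, S (c j)) /\
    forall q, S q -> exists j, box (V (c j)) q.
  by apply: countable_box_cover Sp0 _ => p i Sp; have [[]] := Hbu p Sp i.
pose chi j q : R := \prod_i (bu (c j) i).1.1 (q i).
have oN j i : open (N (c j) i) by have [/(_ i) []] := HN _ (Sc j).
have oV j i : open (V (c j) i).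
  by have [[]] := Hbu _ (Sc j) i.
have VN j : box (V (c j)) `<=` box (N (c j)).
  by move=> q Vq i; have [[_ _ WN] _ _ _ _] := Hbu _ (Sc j) i; exact/WN/Vq.
have chi1 j q : box (V (c j)) q -> chi j q = 1.
  move=> Vq; apply: big1 => i _; have [_ _ h1 _ _] := Hbu _ (Sc j) i.
  exact/h1/Vq.
have schi j q : S q -> smooth_at S (chi j) q.
  move=> Sq; apply: smooth_at_prod => i _; have [_ _ _ _ h] := Hbu _ (Sc j) i.
  exact: h.
have chi0 j q : S q -> ~ box (N (c j)) q -> near_in S q (fun q' => chi j q' = 0).
  move=> Sq /existsNP [i Nqi]; have [_ [cC CN] _ b0 _] := Hbu _ (Sc j) i.
  have nC : ~ (bu (c j) i).2 (q i) by move/CN.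
  apply: near_inS (near_in_open S (closed_openC cC) nC) => q' _ nC'.
  by rewrite /chi (bigD1 i) //= b0 // mul0r.
pose blend j (u : ('I_k -> X) -> E) q : E :=
  if `[< box (N (c j)) q >] then vadd (vscale (1 - chi j q) (u q)) (vscale (chi j q) (s (c j) q))
  else u q.
have sgood j q : S q -> box (N (c j)) q -> A q (s (c j) q) /\ map_smooth_at S (s (c j)) q.
  by move=> Sq Nq; have [_] := HN _ (Sc j); exact.
have Ablend j u q : S q -> A q (u q) -> A q (blend j u q).
  move=> Sq Aq; rewrite /blend; case: asboolP => // Nq; apply: affA => //.
  by case: (sgood j q Sq Nq).
have blend_near j u q : S q -> near_in S q (fun q' => A q' (u q')) ->
    ~ box (N (c j)) q -> near_in S q (fun q' => u q' = blend j u q').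
  move=> Sq nA nN; apply: near_inS (near_inI nA (chi0 j q Sq nN)) => q' Sq' [Aq' chi0'].
  rewrite /blend; case: asboolP => // Nq'; rewrite chi0' subr0 vscale1.
  have pE : vproj (s (c j) q') = vproj (u q') by apply: fibA Aq' => //; case: (sgood j q' Sq' Nq').
  by rewrite (vscale0 pE) vadd0.
have smooth_blend j u q : S q -> near_in S q (fun q' => A q' (u q')) ->
    map_smooth_at S u q -> map_smooth_at S (blend j u) q.
  move=> Sq nA su; have [Nq|nNq] := pselect (box (N (c j)) q); last first.
    exact: map_smooth_at_eq Sq (blend_near j u q Sq nA nNq) su.
  have nN := near_in_box S (oN j) Nq.
  apply: (@map_smooth_at_eq _ _ _ _ _ _ _ (fun q => vadd (vscale (1 - chi j q) (u q)) (vscale (chi j q) (s (c j) q)))) => //.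
    by apply: near_inS nN => q' _ Nq'; rewrite /blend asboolT.
  apply: map_smooth_at_vadd => //.
  - apply: near_inS (near_inI nA nN) => q' Sq' [Aq' Nq']; rewrite !vproj_scale.
    by apply: fibA Aq' _ => //; case: (sgood j q' Sq' Nq').
  - apply: map_smooth_at_vscale => //.
    apply: (@smooth_at_eq _ _ _ _ _ _ (fun q => 1 + (-1) * chi j q)).
      by apply: near_inT => q' _; rewrite mulN1r.
    apply: smooth_atD; first exact: smooth_at_cst.
    by apply: smooth_atM; [exact: smooth_at_cst|exact: schi].
  - by apply: map_smooth_at_vscale; [|exact: schi|case: (sgood j q Sq Nq)].
pose L j := foldr blend (s (c j)) (iota 0 j).
have Lgood j q : S q -> box (N (c j)) q -> A q (L j q) /\ map_smooth_at S (L j) q.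
  rewrite /L; elim: (iota 0 j) q => [|i l IH] q Sq Nq /=; first exact: sgood.
  have [Aq sq] := IH q Sq Nq; split; first exact: Ablend.
  apply: smooth_blend => //; apply: near_inS (near_in_box S (oN j) Nq) => q' Sq' Nq'.
  by case: (IH q' Sq' Nq').
have Leq i j q : (i <= j)%N -> S q -> box (V (c i)) q -> box (N (c j)) q -> L j q = L i q.
  move=> ij Sq Viq Njq; have Niq := VN _ _ Viq; case: (ltngtP i j) ij => // [ij|-> //] _.
  have -> : L j = foldr blend (s (c j)) (iota 0 i ++ i :: iota i.+1 (j - i.+1)).
    by rewrite /L -[in iota 0 j](subnKC ij) addSnnS iotaD.
  rewrite foldr_cat /=.
  set u := foldr _ _ (iota i.+1 _); have Au : A q (u q).
    rewrite /u; elim: (iota _ _) => [|a l IH] /=; last exact: Ablend.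
    by case: (sgood j q Sq Njq).
  (* The value of a blend at q depends on its argument at q only. *)
  have loc_eq (v w : ('I_k -> X) -> E) l : v q = w q -> foldr blend v l q = foldr blend w l q.
    by move=> vw; elim: l => [//|a l IH] /=; rewrite /blend IH.
  apply: loc_eq; rewrite /blend asboolT // chi1 // subrr vscale1.
  have pE : vproj (u q) = vproj (s (c i) q) by apply: fibA Au _ => //; case: (sgood i q Sq Niq).
  by rewrite (vscale0 pE) v0add.
have first_index q : S q -> exists j, box (V (c j)) q /\ forall i, box (V (c i)) q -> (j <= i)%N.
  move=> Sq; have [j Vj] := cov q Sq.
  have ex : exists j, `[< box (V (c j)) q >] by exists j; apply/asboolP.
  by case: (ex_minnP ex) => i /asboolP Vi mi; exists i; split=> // l Vl; apply: mi; apply/asboolP.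
have /choice [f Hf] : forall q, exists j, S q ->
    box (V (c j)) q /\ forall i, box (V (c i)) q -> (j <= i)%N.
  by move=> q; have [/first_index [j ?]|?] := pselect (S q); [exists j|exists 0%N].
exists (fun q => L (f q) q) => q Sq; have [Vq _] := Hf q Sq.
have [Aq sq] := Lgood _ q Sq (VN _ _ Vq); split=> //.
apply: map_smooth_at_eq sq => //.
apply: near_inS (near_in_box S (oV _) Vq) => q' Sq' Vq'; have [Vf min_f] := Hf q' Sq'.
by apply: Leq => //; [exact: min_f|exact: VN].
Qed.

End Gluing.

(** * Fibrewise linear equations of constant rank *)

Section Lift.
Context {R : realType}.

Lemma rank_minor b c (T : 'M[R]_(b, c)) :
  exists (P : 'M[R]_(\rank T, b)) (Q : 'M[R]_(c, \rank T)), P *m T *m Q \in unitmx.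
Proof.
exists (pinvmx (col_base T)), (pinvmx (row_base T)).
suff -> : pinvmx (col_base T) *m T *m pinvmx (row_base T) = 1%:M by exact: unitmx1.
rewrite -[X in _ *m X *m _](mulmx_base T) mulmxA mulVpmx ?col_base_full // mul1mx.
by rewrite mulmxVp ?row_base_free.
Qed.

(** A family of linear systems of constant rank is solved by one formula as long
    as the same minor stays invertible: the rows of [P *m T] then span those
    of [T]. *)
Lemma minor_solve b c r (T : 'M[R]_(b, c)) (P : 'M[R]_(r, b)) (Q : 'M[R]_(c, r))
    (y : 'rV[R]_c) (x : 'rV[R]_b) :
  \rank T = r -> P *m T *m Q \in unitmx -> y = x *m T ->
  y *m Q *m invmx (P *m T *m Q) *m P *m T = y.
Proof.
move=> rT uT yx; have yT : (y <= P *m T)%MS.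
  have rPT : (\rank T <= \rank (P *m T))%N.
    rewrite rT; have := mxrankM_maxl (P *m T) Q.
    by rewrite mxrank_unit.
  have [_ E] := mxrank_leqif_sup (submxMl P T).
  have : (T <= P *m T)%MS by rewrite -E eqn_leq rPT mxrankS // submxMl.
  by apply: submx_trans; rewrite yx submxMl.
have /submxP [z ->] := yT.
by rewrite -!mulmxA; congr (z *m _); rewrite !mulmxA mulmxV // mul1mx.
Qed.

Lemma near_line (X : normedModType R) (W : set X) (y v : X) : open W -> W y ->
  \forall h \near (0 : R), W (y + h *: v).
Proof.
move=> oW Wy; have : nbhs (y + (0 : R) *: v) W.
  by rewrite scale0r addr0; apply: open_nbhs_nbhs.
apply: (@continuous_comp _ _ _ (fun h : R => h *: v) (fun x => y + x)).
  exact: scalel_continuous.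
by apply: continuousD; [exact: cst_continuous|exact: cvg_id].
Qed.

Lemma derive_line (X : normedModType R) (F : X -> R) (y v : X) (c : R) :
  (\forall h \near (0 : R), F (y + h *: v) = F y + h * c) -> 'D_v F y = c.
Proof.
move=> nF; apply/cvg_lim => //; apply: cvg_near_cst.
have nF' : \forall h \near (0 : R)^', F (y + h *: v) = F y + h * c by apply: cvg_within nF.
near=> h; rewrite /= [h *: v + y]addrC (near nF' h) // addrC addKr.
have h0 : h != 0 by near: h; exact: nbhs_dnbhs_neq.
by rewrite -[LHS]/(h^-1 * (h * c)) mulKf.
Unshelve. all: by end_near. Qed.

Section Morphism.
Context {m n a b : nat} {G : manifold R m} {M : manifold R n} {V : vbundle G b}
        {E : vbundle M a}.
Variables (f0 : G -> M) (f : V -> E).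
Hypothesis mor : vbundle_morphism f0 f.

Definition triv_vec (Phi : chart V (m + b)) (phi : chart G m) (g : G) (w : 'rV[R]_b) : V :=
  chart_inv Phi (row_mx (phi g) w).

Lemma triv_vecP Phi phi U al g w : atlas Phi -> trivialization Phi phi U al -> U g ->
  vproj (triv_vec Phi phi g w) = g /\ al (triv_vec Phi phi g w) = w.
Proof.
move=> aPhi tr Ug; have [e pe ae] := triv_inv tr w Ug.
have -> : triv_vec Phi phi g w = e; last by [].
rewrite /triv_vec -pe -{1}ae -(triv_map tr) ?pe // chart_invK //.
by rewrite (triv_dom tr) /= pe.
Qed.

Definition mx_of (Phi : chart V (m + b)) (phi : chart G m) (al' : E -> 'rV[R]_a) (g : G) :
    'M[R]_(b, a) :=
  \matrix_i al' (f (triv_vec Phi phi g (delta_mx 0 i))).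

Lemma mx_ofP Phi phi U al Psi psi U' al' v :
  atlas Phi -> trivialization Phi phi U al ->
  atlas Psi -> trivialization Psi psi U' al' ->
  U (vproj v) -> U' (f0 (vproj v)) -> al' (f v) = al v *m mx_of Phi phi al' (vproj v).
Proof.
move=> aPhi tr aPsi tr' Uv U'v; have [fp fD fZ] := mor.
set g := vproj v in Uv U'v *; pose h w := al' (f (triv_vec Phi phi g w)).
have tvP w := triv_vecP w aPhi tr Uv.
have hD w w' : h (w + w') = h w + h w'.
  rewrite /h; have -> : triv_vec Phi phi g (w + w') = vadd (triv_vec Phi phi g w) (triv_vec Phi phi g w').
    apply: (triv_inj tr); rewrite ?vproj_add ?(tvP _).1 //.
    by rewrite (triv_add tr) ?(tvP _).1 ?(tvP _).2.
  by rewrite fD ?(tvP _).1 // (triv_add tr') ?fp ?(tvP _).1.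
have hZ x w : h (x *: w) = x *: h w.
  rewrite /h; have -> : triv_vec Phi phi g (x *: w) = vscale x (triv_vec Phi phi g w).
    apply: (triv_inj tr); rewrite ?vproj_scale ?(tvP _).1 //.
    by rewrite (triv_scale tr) ?(tvP _).1 ?(tvP _).2.
  by rewrite fZ (triv_scale tr') ?fp ?(tvP _).1.
have h0 : h 0 = 0 by rewrite -(scale0r 0) hZ scale0r.
have -> : al' (f v) = h (al v).
  congr (al' (f _)); apply: (triv_inj tr); rewrite ?(tvP _).1 ?(tvP _).2 //.
rewrite {1}(row_sum_delta (al v)) (big_morph h hD h0) mulmx_sum_row.
by apply: eq_bigr => i _; rewrite hZ rowK.
Qed.

Lemma smooth_at_mx_of k l (X : manifold R l) (S : set ('I_k -> X)) p (g : ('I_k -> X) -> G)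
    Phi phi U al Psi psi U' al' : smooth f ->
  atlas Phi -> trivialization Phi phi U al ->
  atlas Psi -> trivialization Psi psi U' al' -> S p ->
  map_smooth_at S g p -> U (g p) -> U' (f0 (g p)) ->
  smooth_at S (fun q => mx_of Phi phi al' (g q)) p.
Proof.
move=> sf aPhi tr aPsi tr' Sp sg Ug U'g; have [fp _ _] := mor.
have nU := map_smooth_at_open Sp sg (triv_open tr) Ug.
apply/smooth_at_mxP => i j; pose v q := triv_vec Phi phi (g q) (delta_mx 0 i).
have sv : map_smooth_at S v p.
  apply: (map_smooth_at_triv Sp aPhi tr).
  - by apply: near_inS nU => q Sq Uq; rewrite (triv_vecP _ aPhi tr Uq).1.
  - have [_] := sg _ (triv_atlas tr) (triv_sub tr Ug).
    apply: smooth_at_eq; apply: near_inS nU => q Sq Uq.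
    by rewrite (triv_vecP _ aPhi tr Uq).1.
  - apply: (@smooth_at_eq _ _ _ _ _ _ (fun=> delta_mx 0 i)); last exact: smooth_at_cst.
    by apply: near_inS nU => q Sq Uq; rewrite (triv_vecP _ aPhi tr Uq).2.
have sfv := map_smooth_at_comp1 Sp sv sf.
have U'v : U' (vproj (f (v p))) by rewrite fp (triv_vecP _ aPhi tr Ug).1.
have [_ _ /smooth_at_mxP sa] := smooth_at_triv Sp aPsi tr' U'v sfv.
by apply: smooth_at_eq (sa 0 j); apply: near_inT => q _; rewrite mxE.
Qed.

Lemma morphism_zero g : f (vzero V g) = vzero E (f0 g).
Proof.
have [fp _ fZ] := mor.
rewrite -(vscale0 (vproj_zero V g)) fZ (@vscale0 _ _ _ _ _ _ (f0 g)) //.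
by rewrite fp vproj_zero.
Qed.

(** The derivative of a bundle map at a zero vector is block diagonal, because
    zero vectors are mapped to zero vectors; so if it is onto, its vertical block
    is, and that block is the map on the fibre. *)
Lemma submersion_fibre_onto e g : submersion f -> vproj e = f0 g ->
  exists2 v, vproj v = g & f v = e.
Proof.
move=> [sf dsurj] pe; have [fp fD fZ] := mor.
have [Phi [phi [U [al [aPhi tr Ug]]]]] := triv_exists V g.
have [Psi [psi [U' [al' [aPsi tr' U'g]]]]] := triv_exists E (f0 g).
have dPhi : chart_dom Phi (vzero V g) by rewrite (triv_dom tr) /= vproj_zero.
have dPsi : chart_dom Psi (f (vzero V g)).
  by rewrite (triv_dom tr') /= morphism_zero vproj_zero.
have [u Du] := dsurj _ _ _ aPhi dPhi aPsi dPsi (row_mx 0 (al' e)).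
exists (triv_vec Phi phi g (rsubmx u)); first by case: (triv_vecP (rsubmx u) aPhi tr Ug).
have [pv av] := triv_vecP (rsubmx u) aPhi tr Ug.
apply: (triv_inj tr'); rewrite ?fp ?pv //.
set y0 := Phi (vzero V g); set H := fun y => _ in Du.
have y0E : y0 = row_mx (phi g) 0.
  by rewrite /y0 (triv_map tr) vproj_zero // (triv_zero tr).
have [W [F [oW Wy0 sF FE]]] : exists W (F : 'rV[R]_(m + b) -> 'rV[R]_(n + a)),
    [/\ open W, W y0, smooth_fun W F & forall y, W y -> [/\ H y = F y,
      U' (vproj (f (chart_inv Phi y))) & exists2 v, U (vproj v) & Phi v = y]].
  have coordsE1 v : coords (fun _ : 'I_1 => Phi) (fun _ => v) = Phi v.
    by apply/rowP => j; rewrite mxE.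
  have [W [F [oW Wp sF FE]]] := sf (fun _ => vzero V g) (fun _ => Phi) Psi I
    (fun _ => conj aPhi dPhi) aPsi dPsi.
  exists (W `&` (Phi @` chart_dom Phi)), F; split=> //.
  - by apply: openI => //; case: (atlas_chart aPhi).
  - by split; [rewrite /y0 -coordsE1|exists (vzero V g)].
  - by move=> j; apply: class_C_sub (sF j) => y [].
  - move=> y [Wy [v dv vy]]; have := FE (fun _ => v) I (fun _ => dv).
    rewrite coordsE1 vy => /(_ Wy) [dfv fvE].
    rewrite /H -vy chart_invK // vy; split=> //.
      by move: dfv; rewrite (triv_dom tr').
    by exists v => //; move: dv; rewrite (triv_dom tr).
apply/rowP => j; pose Hj y : R := F y 0 (rshift n j).
have CH : class_C 1 W Hj by apply: (class_C_mxP _ _ oW).1 (sF 1%N) _ _.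
have [dH _] := C1_differentiable oW Wy0 CH.
have HjE y : W y -> Hj y = al' (f (chart_inv Phi y)) 0 j.
  move=> Wy; have [HE U'y _] := FE y Wy.
  by rewrite /Hj -HE /H (triv_map tr') // row_mxEr.
have Dj : 'D_u Hj y0 = al' e 0 j.
  have [_ dF] := sF 1%N; have [dFu _] := dF u.
  have DF : 'D_u H y0 = 'D_u F y0.
    apply: near_eq_derive; apply: filterS (open_nbhs_nbhs (conj oW Wy0)) => y Wy.
    by case: (FE y Wy).
  move: Du; rewrite DF derive_mx; last exact: dFu.
  move=> /(congr1 (fun w : 'rV_(n + a) => w 0 (rshift n j))).
  by rewrite row_mxEr mxE.
have Hj0 : Hj y0 = 0.
  by rewrite HjE // chart_invK // morphism_zero (triv_zero tr') // mxE.
pose u1 := row_mx (lsubmx u) 0 : 'rV[R]_(m + b).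
pose u2 := row_mx 0 (rsubmx u) : 'rV[R]_(m + b).
have D1 : 'D_u1 Hj y0 = 0.
  apply: derive_line; apply: filterS (near_line u1 oW Wy0) => h Wh.
  have [_ U'h [v Uv vE]] := FE _ Wh.
  rewrite Hj0 mulr0 addr0 HjE // -vE chart_invK ?(triv_dom tr) //.
  have av0 : al v = 0.
    move: vE; rewrite (triv_map tr) // y0E /u1 scale_row_mx scaler0 add_row_mx addr0.
    by move/eq_row_mx => [].
  have -> : v = vzero V (vproj v).
    by apply: (triv_inj tr) => //; rewrite ?vproj_zero // av0 (triv_zero tr).
  move: U'h; rewrite -vE chart_invK ?(triv_dom tr) // fp => U'h.
  by rewrite morphism_zero (triv_zero tr') ?mxE.
pose v2 := triv_vec Phi phi g (rsubmx u).
have D2 : 'D_u2 Hj y0 = al' (f v2) 0 j.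
  apply: derive_line; apply: filterS (near_line u2 oW Wy0) => h Wh.
  rewrite Hj0 add0r HjE //.
  have -> : y0 + h *: u2 = Phi (vscale h v2).
    rewrite (triv_map tr) ?vproj_scale ?pv // (triv_scale tr) ?pv // av y0E /u2.
    by rewrite scale_row_mx scaler0 add_row_mx addr0 add0r.
  rewrite chart_invK //; last by rewrite (triv_dom tr) /= vproj_scale pv.
  by rewrite fZ (triv_scale tr') ?fp ?pv // mxE.
have uE : u = u1 + u2.
  by rewrite /u1 /u2 add_row_mx addr0 add0r hsubmxK.
have := deriveE u dH; rewrite {2}uE linearD -!deriveE // D1 D2 Dj add0r.
by move->.
Qed.

End Morphism.

(** Near a point, a maximal invertible minor of the matrix of the two maps gives
    a smooth solution ([minor_solve]); the solutions in a fibre form an affine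
    subspace, so that the local ones glue. *)
Lemma lift_pair m n1 n2 a1 a2 b l k (G : manifold R m) (M1 : manifold R n1) (M2 : manifold R n2)
    (V : vbundle G b) (E1 : vbundle M1 a1) (E2 : vbundle M2 a2)
    (f01 : G -> M1) (f02 : G -> M2) (f1 : V -> E1) (f2 : V -> E2)
    (X : manifold R l) (S : set ('I_k -> X))
    (g : ('I_k -> X) -> G) (e1 : ('I_k -> X) -> E1) (e2 : ('I_k -> X) -> E2) (rho : nat) :
  vbundle_morphism f01 f1 -> smooth f1 -> vbundle_morphism f02 f2 -> smooth f2 ->
  (forall q, S q -> map_smooth_at S g q) ->
  (forall q, S q -> map_smooth_at S e1 q) -> (forall q, S q -> map_smooth_at S e2 q) ->
  (forall q, S q -> exists v, [/\ vproj v = g q, f1 v = e1 q & f2 v = e2 q]) ->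
  (forall q Phi phi U al Psi1 psi1 U1 al1 Psi2 psi2 U2 al2, S q ->
     atlas Phi -> @trivialization _ _ _ _ V Phi phi U al -> U (g q) ->
     atlas Psi1 -> @trivialization _ _ _ _ E1 Psi1 psi1 U1 al1 -> U1 (f01 (g q)) ->
     atlas Psi2 -> @trivialization _ _ _ _ E2 Psi2 psi2 U2 al2 -> U2 (f02 (g q)) ->
     \rank (row_mx (mx_of f1 Phi phi al1 (g q)) (mx_of f2 Phi phi al2 (g q))) = rho) ->
  exists s : ('I_k -> X) -> V, forall q, S q ->
    [/\ vproj (s q) = g q, f1 (s q) = e1 q & f2 (s q) = e2 q] /\ map_smooth_at S s q.
Proof.
move=> mor1 sf1 mor2 sf2 sg se1 se2 sol rk.
have [[fp1 fD1 fZ1] [fp2 fD2 fZ2]] := (mor1, mor2).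
have pe1 q : S q -> vproj (e1 q) = f01 (g q) by move=> /sol [v [<- <- _]].
have pe2 q : S q -> vproj (e2 q) = f02 (g q) by move=> /sol [v [<- _ <-]].
apply: (glue_sections (A := fun q => [set v | [/\ vproj v = g q, f1 v = e1 q & f2 v = e2 q]])
  (fun q => vzero V (g q))).
- move=> q v v' t Sq [pv fv1 fv2] [pv' fv1' fv2'].
  have affine x y (r n : nat) (B : manifold R n) (E : vbundle B r) (e : E) :
      x = 1 - y -> vadd (vscale x e) (vscale y e) = e.
    move=> ->; apply: (@fibre_coord_inj _ _ _ _ _ (vproj e)); rewrite ?vproj_add ?vproj_scale //.
    by rewrite fibre_coordD ?vproj_scale // !fibre_coordZ // -scalerDl subrK scale1r.
  split; first by rewrite vproj_add !vproj_scale ?pv ?pv'.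
    by rewrite fD1 ?vproj_scale ?pv ?pv' // !fZ1 fv1 fv1' affine.
  by rewrite fD2 ?vproj_scale ?pv ?pv' // !fZ2 fv2 fv2' affine.
- by move=> q v v' Sq [-> _ _] [-> _ _].
move=> p Sp.
have [Phi [phi [U [al [aPhi tr Ug]]]]] := triv_exists V (g p).
have [Psi1 [psi1 [U1 [al1 [aPsi1 tr1 U1g]]]]] := triv_exists E1 (f01 (g p)).
have [Psi2 [psi2 [U2 [al2 [aPsi2 tr2 U2g]]]]] := triv_exists E2 (f02 (g p)).
pose T q := row_mx (mx_of f1 Phi phi al1 (g q)) (mx_of f2 Phi phi al2 (g q)).
have [P [Q uPQ]] := rank_minor (T p).
have Tp : \rank (T p) = rho by apply: rk Sp _ tr _ _ tr1 _ _ tr2 _.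
pose good q := [/\ U (g q), U1 (f01 (g q)), U2 (f02 (g q)) & P *m T q *m Q \in unitmx].
have sT q : S q -> U (g q) -> U1 (f01 (g q)) -> U2 (f02 (g q)) -> smooth_at S T q.
  move=> Sq Uq U1q U2q; apply: smooth_at_row_mx.
    by apply: (smooth_at_mx_of mor1 sf1 aPhi tr aPsi1 tr1) => //; exact: sg.
  by apply: (smooth_at_mx_of mor2 sf2 aPhi tr aPsi2 tr2) => //; exact: sg.
have sPTQ q : S q -> U (g q) -> U1 (f01 (g q)) -> U2 (f02 (g q)) ->
    smooth_at S (fun q => P *m T q *m Q) q.
  move=> Sq Uq U1q U2q; apply: smooth_at_mulmx; last exact: smooth_at_cst.
  by apply: smooth_at_mulmx; [exact: smooth_at_cst|exact: sT].
have near_good : near_in S p good.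
  have nU := map_smooth_at_open Sp (sg p Sp) (triv_open tr) Ug.
  have nU1 : near_in S p (fun q => U1 (f01 (g q))).
    have := map_smooth_at_open Sp (map_smooth_at_vproj Sp (se1 p Sp)) (triv_open tr1).
    by rewrite pe1 // => /(_ U1g); apply: near_inS => q Sq; rewrite pe1.
  have nU2 : near_in S p (fun q => U2 (f02 (g q))).
    have := map_smooth_at_open Sp (map_smooth_at_vproj Sp (se2 p Sp)) (triv_open tr2).
    by rewrite pe2 // => /(_ U2g); apply: near_inS => q Sq; rewrite pe2.
  have sdet := smooth_at_det (sPTQ p Sp Ug U1g U2g).
  have dp : \det (P *m T p *m Q) != 0 by move: uPQ; rewrite unitmxE unitfE.
  apply: near_inS (near_inI nU (near_inI nU1 (near_inI nU2 (smooth_at_neq0 Sp sdet dp)))).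
  by move=> q Sq [Uq [U1q [U2q dq]]]; split=> //; rewrite unitmxE unitfE.
pose y q := row_mx (al1 (e1 q)) (al2 (e2 q)).
pose x q := y q *m Q *m invmx (P *m T q *m Q) *m P.
exists (fun q => triv_vec Phi phi (g q) (x q)).
apply: near_inS (near_in_near near_good) => q Sq nq.
have [Uq U1q U2q uq] := near_in_self Sq nq.
have [pv av] := triv_vecP (x q) aPhi tr Uq.
split.
  have [v0 [pv0 f1v0 f2v0]] := sol q Sq.
  have yE : y q = al v0 *m T q.
    have := mx_ofP mor1 aPhi tr aPsi1 tr1 (v := v0); rewrite pv0 => /(_ Uq U1q).
    have := mx_ofP mor2 aPhi tr aPsi2 tr2 (v := v0); rewrite pv0 => /(_ Uq U2q).
    by rewrite /y /T mul_mx_row -f1v0 -f2v0 => <- <-.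
  have rq : \rank (T q) = \rank (T p) by rewrite Tp; apply: rk Sq _ tr _ _ tr1 _ _ tr2 _.
  have := minor_solve rq uq yE; rewrite -/(x q) /T mul_mx_row => /eq_row_mx [E1' E2'].
  split=> //.
    apply: (triv_inj tr1); rewrite ?fp1 ?pv ?pe1 //.
    by have := mx_ofP mor1 aPhi tr aPsi1 tr1; move=> ->; rewrite pv ?av ?E1'.
  apply: (triv_inj tr2); rewrite ?fp2 ?pv ?pe2 //.
  by have := mx_ofP mor2 aPhi tr aPsi2 tr2; move=> ->; rewrite pv ?av ?E2'.
have nU : near_in S q (fun q => U (g q)) by apply: near_inS nq => q' _ [].
apply: (map_smooth_at_triv Sq aPhi tr).
- by apply: near_inS nU => q' Sq' Uq'; rewrite (triv_vecP _ aPhi tr Uq').1.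
- have [_] := sg q Sq _ (triv_atlas tr) (triv_sub tr Uq).
  apply: smooth_at_eq; apply: near_inS nU => q' Sq' Uq'.
  by rewrite (triv_vecP _ aPhi tr Uq').1.
- apply: (@smooth_at_eq _ _ _ _ _ _ x).
    by apply: near_inS nU => q' Sq' Uq'; rewrite (triv_vecP _ aPhi tr Uq').2.
  have [_ _ sa1] := smooth_at_triv Sq aPsi1 tr1 (eq_ind_r U1 U1q (pe1 q Sq)) (se1 q Sq).
  have [_ _ sa2] := smooth_at_triv Sq aPsi2 tr2 (eq_ind_r U2 U2q (pe2 q Sq)) (se2 q Sq).
  apply: smooth_at_mulmx; last exact: smooth_at_cst.
  apply: smooth_at_mulmx.
    by apply: smooth_at_mulmx; [exact: smooth_at_row_mx|exact: smooth_at_cst].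
  by apply: smooth_at_invmx => //; exact: sPTQ.
Qed.

End Lift.

(** * Strings of arrows *)

Section Groupoid.
Context {R : realType} {n d : nat} {M : manifold R n} {G : manifold R d}.
Variable GG : lie_groupoid M G.
Local Notation nrv k := (@nerve _ _ _ M G k).
Local Notation face := (face GG).
Local Notation composable := (composable GG).
Local Notation base := (base GG).
Local Notation first_arrow := (first_arrow GG).
Local Notation src := (gsrc GG).
Local Notation tgt := (gtgt GG).
Local Notation one := (gone GG).
Local Notation inv := (ginv GG).
Local Notation "g · h" := (gmul GG g h) (at level 40, left associativity).

Lemma gmulK g h : src g = tgt h -> (g · h) · inv h = g.
Proof.
by move=> gh; rewrite -gmulA ?gtgt_inv // gmulgV -gh gmulg1.
Qed.

Lemma gmulVK g h : src g = src h -> (g · inv h) · h = g.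
Proof.
by move=> gh; rewrite -gmulA ?gtgt_inv ?gsrc_inv // gmulVg -gh gmulg1.
Qed.

Lemma gmulKg g h : src g = tgt h -> inv g · (g · h) = h.
Proof.
by move=> gh; rewrite gmulA ?gsrc_inv // gmulVg gh gmul1g.
Qed.

Lemma gmulI g g' h : src g = tgt h -> src g' = tgt h -> g · h = g' · h -> g = g'.
Proof. by move=> gh gh' E; rewrite -(gmulK gh) E gmulK. Qed.

Lemma ginv_uniq g h : src g = tgt h -> g · h = one (tgt g) -> h = inv g.
Proof.
move=> gh E; rewrite -(gmulKg gh) E -[in RHS](gmulg1 GG (inv g)).
by rewrite gsrc_inv.
Qed.

Lemma ginvM g h : src g = tgt h -> inv (g · h) = inv h · inv g.
Proof.
move=> gh; symmetry; apply: ginv_uniq; first by rewrite gsrc_mul // gtgt_mul ?gtgt_inv ?gsrc_inv.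
by rewrite gmulA ?gsrc_mul ?gtgt_inv ?gsrc_inv // gmulK // gmulgV gtgt_mul.
Qed.

Lemma ginv_one x : inv (one x) = one x.
Proof.
symmetry; apply: ginv_uniq; first by rewrite gsrc_one gtgt_one.
by rewrite -{1}(gtgt_one GG x) gmul1g gtgt_one.
Qed.

Lemma gmul_cancel g h l : src g = tgt h -> tgt h = tgt l -> (g · h) · (inv h · l) = g · l.
Proof.
move=> gh hl; have c1 : src (g · h) = tgt (inv h) by rewrite gsrc_mul ?gtgt_inv.
by rewrite gmulA ?gmulK // gsrc_inv.
Qed.

Lemma gmul_divr g h l : src g = tgt h -> src l = tgt h -> (g · h) · inv (l · h) = g · inv l.
Proof. by move=> gh lh; rewrite ginvM // gmul_cancel // gtgt_inv. Qed.

Lemma gmul_one g x : src g = x -> g · one x = g.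
Proof. by move=> <-; rewrite gmulg1. Qed.

Lemma gone_mul g x : tgt g = x -> one x · g = g.
Proof. by move=> <-; rewrite gmul1g. Qed.

(** Natural number indices turn identities between faces into arithmetic; they
    are meaningful up to [k]. *)
Definition str k (p : nrv k.+1) (x : nat) : G := (p : 'I_k.+1 -> G) (inord x).

Lemma str_inj k (p q : nrv k.+1) : (forall x, (x <= k)%N -> str p x = str q x) -> p = q.
Proof.
move=> pq; apply/funext => j; rewrite -(inord_val j); apply: pq.
by rewrite -ltnS.
Qed.

Lemma str_face k (i : nat) (p : nrv k.+2) (x : nat) : (x <= k)%N ->
  str (face i p) x = if (x.+1 < i)%N then str p x
    else if x.+1 == i then str p x · str p x.+1 else str p x.+1.
Proof.
move=> xk; rewrite /str /face inordK //.
have -> : lift ord_max (inord x : 'I_k.+1) = inord x :> 'I_k.+2.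
  by apply: val_inj; rewrite /= /bump !inordK // ?ltnS ?leqW // ltnNge xk.
have -> // : lift ord0 (inord x : 'I_k.+1) = inord x.+1 :> 'I_k.+2.
by apply: val_inj; rewrite /= /bump !inordK.
Qed.

Lemma composableP k (p : nrv k.+1) :
  composable p <-> forall x, (x < k)%N -> src (str p x) = tgt (str p x.+1).
Proof.
split=> [cp x xk|h i j ij]; first by apply: cp; rewrite !inordK // ?leqW // ltnS ltnW.
have := h i; rewrite -ij -ltnS (leq_trans _ (ltn_ord j)) ?ij // => /(_ isT).
by rewrite /str -ij !inord_val.
Qed.

Lemma str0 k (p : nrv k.+1) : str p 0 = first_arrow p.
Proof. by rewrite /str /=; congr (p _); apply: val_inj; rewrite /= inordK. Qed.

Lemma face1 (i : nat) (p : nrv 1) :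
  face i p = if i == 0%N then src (str p 0) else tgt (str p 0).
Proof. by rewrite str0. Qed.

Lemma composable_face k i (p : nrv k.+1) : (i <= k.+1)%N -> composable p -> composable (face i p).
Proof.
case: k p => [//|k] p ik /composableP cp; apply/composableP => x xk.
rewrite !str_face; try lia; have c1 := cp x; have c2 := cp x.+1.
case: (ltngtP x.+1 i) => h1; case: (ltngtP x.+2 i) => h2; try lia.
- by apply: c1; lia.
- by rewrite gtgt_mul; [apply: c1|apply: c2]; lia.
- by apply: c2; lia.
- by rewrite gsrc_mul; [apply: c2|apply: c1]; lia.
Qed.

Lemma face_face k i j (p : nrv k.+2) : (i < j <= k.+2)%N -> composable p ->
  face i (face j p) = face j.-1 (face i p).
Proof.
move=> /andP[ij jk] /composableP cp; case: k p jk cp => [|k] p jk cp.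
  rewrite !face1 !str_face //; have := cp 0%N isT.
  case: j ij jk => [|[|[|j]]] //; case: i => [|[|i]] //= _ _ c; by rewrite ?gsrc_mul ?gtgt_mul.
apply: str_inj => x xk; have c1 := cp x; have c2 := cp x.+1.
have k1 : (x <= k.+1)%N by lia. have k2 : (x.+1 <= k.+1)%N by lia.
rewrite !str_face //; do ![case: ltngtP => ? //=]; try lia.
all: try (by rewrite gmulA; [|apply: c1; lia|apply: c2; lia]).
all: by congr str; lia.
Qed.

Lemma src_first_arrow k (p : nrv k.+1) : composable p -> src (first_arrow p) = base (face 0 p).
Proof.
case: k p => [|k] p cp; first by rewrite /base /= gtgt_one.
by rewrite /base -!str0 str_face //=; move/composableP: cp; apply.
Qed.

Lemma first_arrow_face k i (p : nrv k.+2) : (2 <= i)%N -> first_arrow (face i p) = first_arrow p.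
Proof. by move=> i2; rewrite -!str0 str_face // i2. Qed.

Lemma first_arrow_face1 k (p : nrv k.+2) :
  first_arrow (face 1 p) = first_arrow p · first_arrow (face 0 p).
Proof. by rewrite -!str0 !str_face. Qed.

Lemma base_face k i (p : nrv k.+1) : (0 < i)%N -> composable p -> base (face i p) = base p.
Proof.
case: k p => [|k] p i0 cp; first by rewrite /base face1 gtn_eqF //= gtgt_one str0.
case: i i0 => [//|[|i]] _; last by rewrite /base first_arrow_face.
by rewrite /base first_arrow_face1 gtgt_mul // src_first_arrow.
Qed.

(** A unit in front of the string: a section of [face 0], through which a function
    of the string without its first arrow is recovered from its values. *)
Definition degen k : nrv k -> nrv k.+1 :=
  match k with
  | 0 => fun x => (fun=> one x)
  | k'.+1 => fun q : 'I_k'.+1 -> G =>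
      fun j => if unlift ord0 j is Some i then q i else one (base (q : nrv k'.+1))
  end.

Lemma str_degen k (q : nrv k.+1) x : (x <= k.+1)%N ->
  str (degen q) x = if x is x'.+1 then str q x' else one (base q).
Proof.
move=> xk; rewrite /str /=; case: x xk => [|x] xk.
  have -> : inord 0 = ord0 :> 'I_k.+2 by apply: val_inj; rewrite /= inordK.
  by rewrite unlift_none.
have -> : inord x.+1 = lift ord0 (inord x : 'I_k.+1) :> 'I_k.+2.
  by apply: val_inj; rewrite /= /bump !inordK.
by rewrite liftK.
Qed.

Lemma first_arrow_degen k (q : nrv k) : first_arrow (degen q) = one (base q).
Proof. by case: k q => [|k] q; [rewrite /base /= gtgt_one|rewrite -str0 str_degen]. Qed.

Lemma composable_degen k (q : nrv k) : composable q -> composable (degen q).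
Proof.
case: k q => [|k] q cq; first by move=> i j; rewrite !ord1.
move/composableP: cq => cq; apply/composableP => -[|x] xk; rewrite !str_degen; try lia.
  by rewrite gsrc_one str0.
by apply: cq; lia.
Qed.

Lemma face0_degen k (q : nrv k) : face 0 (degen q) = q.
Proof.
case: k q => [|k] q; first by rewrite face1 /str /= gsrc_one.
by apply: str_inj => x xk; rewrite str_face //= str_degen.
Qed.

End Groupoid.

(** * Smooth functions on the nerve *)

Section NerveSmooth.
Context {R : realType} {n d : nat} {M : manifold R n} {G : manifold R d}.
Variable GG : lie_groupoid M G.

Local Notation nrv k := (@nerve _ _ _ M G k).
Local Notation face := (face GG).
Local Notation composable := (composable GG).
Local Notation base := (base GG).
Local Notation first_arrow := (first_arrow GG).

(** The nerve in degree [k] sits in a power of one manifold: M in degree 0,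
    where the string has one entry, and G in positive degrees. *)
Definition ndim k := if k is _.+1 then d else n.

Definition nman k : manifold R (ndim k) := match k with 0 => M | _.+1 => G end.

Definition of_entries k : ('I_k.-1.+1 -> nman k) -> nrv k :=
  match k with 0 => fun q => q ord0 | _.+1 => fun q => q end.

Definition entries k : nrv k -> 'I_k.-1.+1 -> nman k :=
  match k with 0 => fun x _ => x | _.+1 => fun q => q end.

Lemma of_entriesK k (q : 'I_k.-1.+1 -> nman k) : entries (of_entries q) = q.
Proof. by case: k q => [|k] q //; apply/funext => i; rewrite ord1. Qed.

Lemma entriesK k (q : nrv k) : of_entries (entries q) = q.
Proof. by case: k q. Qed.

Lemma nerve_smoothP k m (Y : manifold R m) (S : set (nrv k)) (f : nrv k -> Y) :
  nerve_smooth S f <->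
  forall q, S (of_entries q) -> map_smooth_at (of_entries (k := k) @^-1` S) (f \o of_entries (k := k)) q.
Proof. by case: k S f => [|k] S f; exact: smooth_onP. Qed.

Implicit Types (k m : nat).

Lemma nerve_smooth_eq k m (Y : manifold R m) (S : set (nrv k)) (f g : nrv k -> Y) :
  (forall q, S q -> f q = g q) -> nerve_smooth S f -> nerve_smooth S g.
Proof.
move=> fg /nerve_smoothP sf; apply/nerve_smoothP => q Sq.
apply: map_smooth_at_eq (sf q Sq) => //.
by apply: near_inT => q' Sq'; exact: fg.
Qed.

Lemma nerve_smooth_comp k m m' (Y : manifold R m) (Z : manifold R m') (S : set (nrv k))
    (f : nrv k -> Y) (h : Y -> Z) :
  smooth h -> nerve_smooth S f -> nerve_smooth S (fun q => h (f q)).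
Proof.
move=> sh /nerve_smoothP sf; apply/nerve_smoothP => q Sq.
by apply: map_smooth_at_comp1 sh => //; exact: sf.
Qed.

Lemma nerve_smooth_comp2 k m m' (Y : manifold R m) (Z : manifold R m') (S : set (nrv k))
    (f g : nrv k -> Y) (S' : set ('I_2 -> Y)) (h : Y -> Y -> Z) :
  smooth_on S' (fun y => h (y ord0) (y ord_max)) ->
  (forall q, S q -> S' (fun j => if j == ord0 then f q else g q)) ->
  nerve_smooth S f -> nerve_smooth S g -> nerve_smooth S (fun q => h (f q) (g q)).
Proof.
move=> sh SS /nerve_smoothP sf /nerve_smoothP sg; apply/nerve_smoothP => q Sq.
apply: (map_smooth_at_comp2 Sq (sf q Sq) (sg q Sq) sh) => q' Sq'.
exact: SS.
Qed.

Lemma nerve_smooth_gmul k n' d' (M' : manifold R n') (G' : manifold R d')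
    (GG' : lie_groupoid M' G') (S : set (nrv k)) (f g : nrv k -> G') :
  (forall q, S q -> gsrc GG' (f q) = gtgt GG' (g q)) ->
  nerve_smooth S f -> nerve_smooth S g -> nerve_smooth S (fun q => gmul GG' (f q) (g q)).
Proof.
move=> fg; have := @nerve_smooth_comp2 k _ _ G' G' S f g _ (gmul GG') (@gmul_smooth _ _ _ _ _ GG').
by apply=> q Sq; exact: fg.
Qed.

Section StructureMaps.
Context {k n' d' : nat} {M' : manifold R n'} {G' : manifold R d'}.
Variables (GG' : lie_groupoid M' G') (S : set (nrv k)).

Lemma nerve_smooth_gone (f : nrv k -> M') :
  nerve_smooth S f -> nerve_smooth S (fun q => gone GG' (f q)).
Proof. exact: (nerve_smooth_comp (@gone_smooth _ _ _ _ _ GG')). Qed.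

Lemma nerve_smooth_ginv (f : nrv k -> G') :
  nerve_smooth S f -> nerve_smooth S (fun q => ginv GG' (f q)).
Proof. exact: (nerve_smooth_comp (@ginv_smooth _ _ _ _ _ GG')). Qed.

Lemma nerve_smooth_gsrc (f : nrv k -> G') :
  nerve_smooth S f -> nerve_smooth S (fun q => gsrc GG' (f q)).
Proof. by have [ssrc _] := gsrc_submersion GG'; exact: (nerve_smooth_comp ssrc). Qed.

Lemma nerve_smooth_gtgt (f : nrv k -> G') :
  nerve_smooth S f -> nerve_smooth S (fun q => gtgt GG' (f q)).
Proof. by have [stgt _] := gtgt_submersion GG'; exact: (nerve_smooth_comp stgt). Qed.

End StructureMaps.

Lemma nerve_smooth_vadd k m r (B : manifold R m) (E : vbundle B r) (S : set (nrv k))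
    (f g : nrv k -> E) :
  (forall q, S q -> vproj (f q) = vproj (g q)) ->
  nerve_smooth S f -> nerve_smooth S g -> nerve_smooth S (fun q => vadd (f q) (g q)).
Proof.
move=> fg /nerve_smoothP sf /nerve_smoothP sg; apply/nerve_smoothP => q Sq.
apply: map_smooth_at_vadd; [by []| |exact: sf|exact: sg].
by apply: near_inT => q' Sq'; exact: fg.
Qed.

Lemma nerve_smooth_vscale k m r (B : manifold R m) (E : vbundle B r) (S : set (nrv k))
    x (f : nrv k -> E) :
  nerve_smooth S f -> nerve_smooth S (fun q => vscale x (f q)).
Proof.
move=> /nerve_smoothP sf; apply/nerve_smoothP => q Sq.
by apply: (@map_smooth_at_vscale _ _ _ _ _ _ _ _ _ _ (fun=> x)); [|exact: smooth_at_cst|exact: sf].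
Qed.

Lemma nerve_smooth_vzero k m r (B : manifold R m) (E : vbundle B r) (S : set (nrv k))
    (f : nrv k -> B) :
  nerve_smooth S f -> nerve_smooth S (fun q => vzero E (f q)).
Proof.
move=> /nerve_smoothP sf; apply/nerve_smoothP => q Sq.
by apply: map_smooth_at_vzero; [|exact: sf].
Qed.

Lemma nerve_smooth_sum k m r (B : manifold R m) (E : vbundle B r) (S : set (nrv k))
    (b : nrv k -> B) (I : Type) (s : seq I) (P : pred I) (F : I -> nrv k -> E) :
  (forall i q, P i -> S q -> vproj (F i q) = b q) -> nerve_smooth S b ->
  (forall i, P i -> nerve_smooth S (F i)) ->
  nerve_smooth S (fun q => \big[@vadd _ _ _ _ E/vzero E (b q)]_(i <- s | P i) F i q).
Proof.
move=> pF sb sF; elim: s => [|i s IH].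
  by apply: nerve_smooth_eq (nerve_smooth_vzero E sb) => q Sq; rewrite big_nil.
case Pi : (P i).
  apply: nerve_smooth_eq (nerve_smooth_vadd _ (sF i Pi) IH) => q Sq; first by rewrite big_cons Pi.
  by rewrite pF // vproj_sum // => j Pj; exact: pF.
by apply: nerve_smooth_eq IH => q Sq; rewrite big_cons Pi.
Qed.

Lemma nerve_smooth_entry k (S : set (nrv k)) i : nerve_smooth S (fun q => entries q i).
Proof.
apply/nerve_smoothP => q Sq.
apply: (@map_smooth_at_eq _ _ _ _ _ _ _ (fun q : 'I_k.-1.+1 -> nman k => q i)) => //.
  by apply: near_inT => q' _; rewrite /= of_entriesK.
exact: map_smooth_at_proj.
Qed.

Lemma nerve_smooth_pullback k l m (Y : manifold R m) (S : set (nrv k)) (S' : set (nrv l))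
    (h : nrv k -> nrv l) (f : nrv l -> Y) :
  (forall q, S q -> S' (h q)) -> (forall i, nerve_smooth S (fun q => entries (h q) i)) ->
  nerve_smooth S' f -> nerve_smooth S (fun q => f (h q)).
Proof.
move=> SS sh /nerve_smoothP sf; apply/nerve_smoothP => q Sq.
apply: (@map_smooth_at_eq _ _ _ _ _ _ _ (fun q => (f \o of_entries (k := l)) (fun j => entries (h (of_entries q)) j))) => //.
  by apply: near_inT => q' _ /=; rewrite entriesK.
apply: (map_smooth_at_comp (S' := of_entries (k := l) @^-1` S')) => //.
- by move=> j; exact: (nerve_smoothP _ _).1 (sh j) q Sq.
- by apply: near_inT => q' Sq' /=; rewrite entriesK; exact: SS.
- by apply: sf; rewrite entriesK; exact: SS.
Qed.

Lemma nerve_smooth_str k (S : set (nrv k.+1)) x : nerve_smooth S (fun q => str q x).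
Proof. exact: (@nerve_smooth_entry k.+1 S (inord x)). Qed.

Lemma nerve_smooth_first_arrow k (S : set (nrv k)) : nerve_smooth S (first_arrow (k := k)).
Proof.
case: k S => [|k] S; last exact: (@nerve_smooth_entry k.+1 S ord0).
exact: (nerve_smooth_gone GG (@nerve_smooth_entry 0 S ord0)).
Qed.

Lemma nerve_smooth_base k (S : set (nrv k)) : nerve_smooth S (base (k := k)).
Proof.
exact: (nerve_smooth_gtgt GG (nerve_smooth_first_arrow S)).
Qed.

Lemma nerve_smooth_face k m (Y : manifold R m) i (f : nrv k -> Y) : (i <= k.+1)%N ->
  nerve_smooth (composable (k := k)) f ->
  nerve_smooth (composable (k := k.+1)) (fun p => f (face i p)).
Proof.
move=> ik; apply: nerve_smooth_pullback => [p cp|j]; first exact: composable_face.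
case: k f ik j => [|k] f ik j.
  case: i {ik} => [|i].
    exact: (nerve_smooth_gsrc GG (@nerve_smooth_entry 1 _ ord0)).
  exact: (nerve_smooth_gtgt GG (@nerve_smooth_entry 1 _ ord0)).
have jk : (j <= k)%N by rewrite -ltnS ltn_ord.
have E p : entries (face i p) j = if (j.+1 < i)%N then str p j
    else if j.+1 == i then gmul GG (str p j) (str p j.+1) else str p j.+1.
  by rewrite -(str_face GG i p jk) /str inord_val.
apply: (@nerve_smooth_eq _ _ _ _ (fun p : nrv k.+2 => if (j.+1 < i)%N then str p j
    else if j.+1 == i then gmul GG (str p j) (str p j.+1) else str p j.+1)).
  by move=> p _; rewrite E.
case: ltngtP => _; try exact: nerve_smooth_str.
apply: nerve_smooth_gmul; [|exact: nerve_smooth_str|exact: nerve_smooth_str].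
by move=> p /composableP; apply; lia.
Qed.

Lemma nerve_smooth_degen k m (Y : manifold R m) (f : nrv k.+1 -> Y) :
  nerve_smooth (composable (k := k.+1)) f ->
  nerve_smooth (composable (k := k)) (fun q => f (degen GG q)).
Proof.
apply: nerve_smooth_pullback => [q cq|]; first exact: composable_degen.
case: k f => [|k] f j.
  exact: (nerve_smooth_gone GG (@nerve_smooth_entry 0 _ ord0)).
have jk : (j <= k.+1)%N by rewrite -ltnS ltn_ord.
have E q : entries (degen GG q) j = if val j is x.+1 then str q x else gone GG (base q).
  by rewrite -(str_degen GG q jk) /str inord_val.
apply: (@nerve_smooth_eq _ _ _ _ (fun q : nrv k.+1 => if val j is x.+1 then str q x else gone GG (base q))).
  by move=> p _; rewrite E.
case: (val j) => [|x]; last exact: nerve_smooth_str.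
by apply: nerve_smooth_gone; exact: nerve_smooth_base.
Qed.

(** [lift_pair] on the nerve, where strings of degree 0 are points of M. *)
Lemma nerve_lift_pair k m n1 n2 a1 a2 b (H : manifold R m) (M1 : manifold R n1) (M2 : manifold R n2)
    (V : vbundle H b) (E1 : vbundle M1 a1) (E2 : vbundle M2 a2)
    (f01 : H -> M1) (f02 : H -> M2) (f1 : V -> E1) (f2 : V -> E2)
    (S : set (nrv k)) (g : nrv k -> H) (e1 : nrv k -> E1) (e2 : nrv k -> E2) (rho : nat) :
  vbundle_morphism f01 f1 -> smooth f1 -> vbundle_morphism f02 f2 -> smooth f2 ->
  nerve_smooth S g -> nerve_smooth S e1 -> nerve_smooth S e2 ->
  (forall q, S q -> exists v, [/\ vproj v = g q, f1 v = e1 q & f2 v = e2 q]) ->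
  (forall q Phi phi U al Psi1 psi1 U1 al1 Psi2 psi2 U2 al2, S q ->
     atlas Phi -> @trivialization _ _ _ _ V Phi phi U al -> U (g q) ->
     atlas Psi1 -> @trivialization _ _ _ _ E1 Psi1 psi1 U1 al1 -> U1 (f01 (g q)) ->
     atlas Psi2 -> @trivialization _ _ _ _ E2 Psi2 psi2 U2 al2 -> U2 (f02 (g q)) ->
     \rank (row_mx (mx_of f1 Phi phi al1 (g q)) (mx_of f2 Phi phi al2 (g q))) = rho) ->
  exists2 s : nrv k -> V, nerve_smooth S s & forall q, S q ->
    [/\ vproj (s q) = g q, f1 (s q) = e1 q & f2 (s q) = e2 q].
Proof.
move=> mor1 sf1 mor2 sf2 /nerve_smoothP sg /nerve_smoothP se1 /nerve_smoothP se2 sol rk.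
have [] := @lift_pair _ _ _ _ _ _ _ _ _ _ _ _ _ _ _ _ _ f1 f2 _ (of_entries (k := k) @^-1` S)
  (fun q => g (of_entries q)) (fun q => e1 (of_entries q)) (fun q => e2 (of_entries q)) rho
  mor1 sf1 mor2 sf2 sg se1 se2 _ _.
- by move=> q Sq; exact: sol.
- by move=> q Phi phi U al Psi1 psi1 U1 al1 Psi2 psi2 U2 al2 Sq; exact: rk.
move=> s Hs; exists (fun q => s (entries q)).
  apply/nerve_smoothP => q Sq; have [_ ss] := Hs q Sq.
  apply: map_smooth_at_eq ss => //.
  by apply: near_inT => q' _; rewrite /= of_entriesK.
move=> q Sq; have [|] := Hs (entries q); first by rewrite /= entriesK.
by rewrite entriesK.
Qed.

Lemma ptws_open_box k l (X : manifold R l) (O : set {ptws 'I_k -> X}) (p : 'I_k -> X) :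
  open O -> O p -> near_in setT p (O : set ('I_k -> X)).
Proof.
move=> oO Op; pose F : set_system ('I_k -> X) := near_in setT p.
have FF : Filter F.
  split; first exact: near_inT.
    by move=> P Q; exact: near_inI.
  by move=> P Q PQ; apply: near_inS => q _; exact: PQ.
have : F --> (p : {ptws 'I_k -> X}).
  apply/cvg_sup => i P [_] [[W oW] <-] /= Wp WP.
  by apply: near_inS (near_in_open setT oW Wp) => q _; exact: WP.
by apply; exact: open_nbhs_nbhs.
Qed.

(** [glue_sections] on the nerve, whose open sets contain boxes ([ptws_open_box]). *)
Lemma nerve_glue_sections k m r (B : manifold R m) (E : vbundle B r) (S : set (nrv k))
    (A : nrv k -> set E) (d0 : nrv k -> E) :
  (forall q e e' t, S q -> A q e -> A q e' -> A q (vadd (vscale (1 - t) e) (vscale t e'))) ->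
  (forall q e e', S q -> A q e -> A q e' -> vproj e = vproj e') ->
  (forall p, S p -> exists (O : set (nrv k)) (s : nrv k -> E),
     [/\ open O, O p, nerve_smooth (S `&` O) s & forall q, S q -> O q -> A q (s q)]) ->
  exists2 s : nrv k -> E, nerve_smooth S s & forall q, S q -> A q (s q).
Proof.
move=> affA fibA loc.
have near_open (O : set (nrv k)) p : open O -> O (of_entries p) ->
    near_in setT p (of_entries (k := k) @^-1` O).
  case: k O p {S A d0 affA fibA loc} => [|k] O p oO Op; last exact: ptws_open_box.
  exact: near_in_open.
have [] := @glue_sections _ _ _ _ _ _ _ E (of_entries (k := k) @^-1` S)
  (fun q => A (of_entries q)) (fun q => d0 (of_entries q)).
- by move=> q; exact: affA.
- by move=> q; exact: fibA.
- move=> p Sp; have [N [s [oN Np /nerve_smoothP ss sA]]] := loc _ Sp.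
  exists (s \o of_entries (k := k)).
  have nO : near_in (of_entries (k := k) @^-1` S) p (of_entries (k := k) @^-1` N).
    by have [B' [oB BP]] := near_open N p oN Np; exists B'; split=> // q _; exact: BP.
  apply: near_inS (near_in_near nO) => q Sq nq.
  have Nq := near_in_self Sq nq; split; first exact: sA.
  by apply: map_smooth_at_near nq _; apply: ss.
move=> s Hs; exists (fun q => s (entries q)).
  apply/nerve_smoothP => q Sq; have [_ ss] := Hs q Sq.
  apply: map_smooth_at_eq ss => //.
  by apply: near_inT => q' _; rewrite /= of_entriesK.
move=> q Sq; have [|] := Hs (entries q); first by rewrite /= entriesK.
by rewrite entriesK.
Qed.

End NerveSmooth.

(** * Linear algebra in a fibre *)

Section FibreTactic.
Context {R : realType} {n r : nat} {B : manifold R n} {E : vbundle B r}.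

Lemma vprojD (e e' : E) b : vproj e = b -> vproj e' = b -> vproj (vadd e e') = b.
Proof. by move=> pe pe'; rewrite vproj_add pe. Qed.

Lemma vprojZ t (e : E) b : vproj e = b -> vproj (vscale t e) = b.
Proof. by rewrite vproj_scale. Qed.

End FibreTactic.

Ltac vproj_solve :=
  repeat match goal with
  | |- vproj (vadd _ _) = _ => apply: vprojD
  | |- vproj (vscale _ _) = _ => apply: vprojZ
  | |- vproj (vzero _ _) = _ => exact: vproj_zero
  end;
  solve [done | congruence].

(** Identities between vectors of the fibre at [b], by comparing their
    coordinates. *)
Ltac fibre b :=
  apply: (@fibre_coord_inj _ _ _ _ _ b); [vproj_solve | vproj_solve |
  repeat first [ rewrite (@fibre_coordD _ _ _ _ _ b); [|vproj_solve|vproj_solve]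
               | rewrite (@fibre_coordZ _ _ _ _ _ b); [|vproj_solve]
               | rewrite (@fibre_coord0 _ _ _ _ _ b)];
  apply/rowP => ?; rewrite !mxE; ring].

(** * The core, the anchor and the cokernel *)

Section VBAlgebra.
Context {R : realType} {n d a b : nat} {M : manifold R n} {G : manifold R d}
        {GG : lie_groupoid M G} {E : vbundle M a} {V : vbundle G b}.
Variable VV : vb_groupoid GG E V.
Local Notation src := (gsrc GG).
Local Notation tgt := (gtgt GG).
Local Notation S := (gsrc VV).
Local Notation T := (gtgt VV).
Local Notation inv := (ginv VV).
Local Notation "v · w" := (gmul VV v w) (at level 40, left associativity).
Local Notation "0_ g" := (vzero V g) (at level 8, format "0_ g").

Implicit Types (v w : V) (e : E) (g h : G) (x : M).

Lemma proj_src v : vproj (S v) = src (vproj v). Proof. by have [-> _ _] := vb_src VV. Qed.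
Lemma proj_tgt v : vproj (T v) = tgt (vproj v). Proof. by have [-> _ _] := vb_tgt VV. Qed.
Lemma proj_inv v : vproj (inv v) = ginv GG (vproj v). Proof. by have [-> _ _] := vb_inv VV. Qed.

Lemma srcD v w : vproj v = vproj w -> S (vadd v w) = vadd (S v) (S w).
Proof. by have [_ + _] := vb_src VV; exact. Qed.
Lemma tgtD v w : vproj v = vproj w -> T (vadd v w) = vadd (T v) (T w).
Proof. by have [_ + _] := vb_tgt VV; exact. Qed.
Lemma invD v w : vproj v = vproj w -> inv (vadd v w) = vadd (inv v) (inv w).
Proof. by have [_ + _] := vb_inv VV; exact. Qed.
Lemma srcZ t v : S (vscale t v) = vscale t (S v).
Proof. by have [_ _ ->] := vb_src VV. Qed.
Lemma tgtZ t v : T (vscale t v) = vscale t (T v).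
Proof. by have [_ _ ->] := vb_tgt VV. Qed.
Lemma invZ t v : inv (vscale t v) = vscale t (inv v).
Proof. by have [_ _ ->] := vb_inv VV. Qed.

Lemma src0 g : S (0_g) = vzero E (src g). Proof. exact: morphism_zero (vb_src VV) g. Qed.
Lemma tgt0 g : T (0_g) = vzero E (tgt g). Proof. exact: morphism_zero (vb_tgt VV) g. Qed.
Lemma inv0 g : inv (0_g) = 0_(ginv GG g). Proof. exact: morphism_zero (vb_inv VV) g. Qed.
Lemma one0 x : gone VV (vzero E x) = 0_(gone GG x).
Proof. exact: morphism_zero (vb_one VV) x. Qed.

Lemma mul0 g h : src g = tgt h -> 0_g · 0_h = 0_(gmul GG g h).
Proof.
move=> gh; have c : S (0_g) = T (0_h) by rewrite src0 tgt0 gh.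
rewrite -[in LHS](vscale0 (vproj_zero V g)) -[in LHS](vscale0 (vproj_zero V h)).
by rewrite vb_mul_scale // (@vscale0 _ _ _ _ _ _ (gmul GG g h)) // vb_mul_proj // !vproj_zero.
Qed.

Lemma mulD v v' w w' : vproj v = vproj v' -> vproj w = vproj w' -> S v = T w -> S v' = T w' ->
  vadd v v' · vadd w w' = vadd (v · w) (v' · w').
Proof. exact: vb_mul_add. Qed.

Lemma src_inv v : S (inv v) = T v. Proof. exact: gsrc_inv. Qed.
Lemma tgt_inv v : T (inv v) = S v. Proof. exact: gtgt_inv. Qed.

Lemma src_sum (I : Type) (s : seq I) (P : pred I) (F : I -> V) g :
  (forall i, P i -> vproj (F i) = g) ->
  S (\big[@vadd _ _ _ _ V/0_g]_(i <- s | P i) F i)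
    = \big[@vadd _ _ _ _ E/vzero E (src g)]_(i <- s | P i) S (F i).
Proof.
move=> pF; elim: s => [|i s IH]; first by rewrite !big_nil src0.
rewrite !big_cons; case Pi : (P i) => //.
by rewrite srcD ?IH // vproj_sum ?pF.
Qed.

Lemma core_proj x v : core VV x v -> vproj v = gone GG x. Proof. by case. Qed.
Lemma core_src x v : core VV x v -> S v = vzero E x. Proof. by case. Qed.
Lemma core_tgt_proj x v : core VV x v -> vproj (T v) = x.
Proof. by move=> [pv _]; rewrite proj_tgt pv gtgt_one. Qed.

Lemma core0 x : core VV x (0_(gone GG x)).
Proof. by split; rewrite ?vproj_zero // src0 gsrc_one. Qed.

Lemma coreD x v w : core VV x v -> core VV x w -> core VV x (vadd v w).
Proof.
move=> [pv sv] [pw sw]; split; first by rewrite vproj_add pv.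
by rewrite srcD ?pv // sv sw vadd0 // vproj_zero.
Qed.

Lemma coreZ x t v : core VV x v -> core VV x (vscale t v).
Proof. by move=> [pv sv]; split; rewrite ?vproj_scale // srcZ sv vscale_zero. Qed.

Lemma image_anchor_proj x e : image_anchor VV x e -> vproj e = x.
Proof. by move=> [v cv <-]; exact: core_tgt_proj. Qed.

Lemma image_anchor0 x : image_anchor VV x (vzero E x).
Proof. by exists (0_(gone GG x)); [exact: core0|rewrite /core_anchor tgt0 gtgt_one]. Qed.

Lemma image_anchorD x e e' : image_anchor VV x e -> image_anchor VV x e' ->
  image_anchor VV x (vadd e e').
Proof.
move=> [v cv <-] [w cw <-]; exists (vadd v w); first exact: coreD.
by rewrite /core_anchor tgtD // (core_proj cv) (core_proj cw).
Qed.

Lemma image_anchorZ x t e : image_anchor VV x e -> image_anchor VV x (vscale t e).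
Proof.
by move=> [v cv <-]; exists (vscale t v); [exact: coreZ|rewrite /core_anchor tgtZ].
Qed.

Lemma coker_class_self e : coker_class VV e e.
Proof. by exists (vzero E (vproj e)); [exact: image_anchor0|rewrite vadd0]. Qed.

Lemma coker_class_eq e e' : coker_class VV e e' -> coker_class VV e' = coker_class VV e.
Proof.
move=> [u iu <-]; have pu := image_anchor_proj iu; have peu : vproj (vadd e u) = vproj e.
  by rewrite vproj_add.
apply/seteqP; split=> y [w]; rewrite ?peu => iw <-; have pw := image_anchor_proj iw.
  by exists (vadd u w); [exact: image_anchorD|rewrite vaddA // pu].
exists (vadd (vscale (-1) u) w); rewrite ?peu.
  by apply: image_anchorD => //; exact: image_anchorZ.
by fibre (vproj e).
Qed.

Lemma coker_classP e e' : vproj e = vproj e' ->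
  (coker_class VV e = coker_class VV e' <-> image_anchor VV (vproj e) (vadd e (vscale (-1) e'))).
Proof.
move=> pe; split=> [E1|i].
  have : coker_class VV e' e by rewrite -E1; exact: coker_class_self.
  move=> [u]; rewrite -pe => iu Eu; suff -> : vadd e (vscale (-1) e') = u by [].
  by have pu := image_anchor_proj iu; rewrite -{1}Eu; fibre (vproj e).
apply: coker_class_eq; exists (vadd e (vscale (-1) e')); first by rewrite -pe.
by fibre (vproj e).
Qed.

Lemma coker_class0P e : (coker_class VV e = coker_class VV (vzero E (vproj e))
  <-> image_anchor VV (vproj e) e).
Proof.
have -> : image_anchor VV (vproj e) e = image_anchor VV (vproj e) (vadd e (vscale (-1) (vzero E (vproj e)))).
  by rewrite vscale_zero vadd0.
by apply: coker_classP; rewrite vproj_zero.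
Qed.

Local Notation Q := (coker_rep VV).

Lemma coker_add e e' : vproj e = vproj e' ->
  @radd _ _ _ _ _ Q (coker_class VV e) (coker_class VV e') = coker_class VV (vadd e e').
Proof.
move=> pe; apply/seteqP; split=> [y [u [w [[u' iu <-] [w' iw <-] ->]]]|y [u]].
  have pu := image_anchor_proj iu; have pw := image_anchor_proj iw.
  rewrite -pe in iw pw; exists (vadd u' w'); first by rewrite vproj_add //; exact: image_anchorD.
  by fibre (vproj e).
rewrite vproj_add // => iu <-; have pu := image_anchor_proj iu.
exists (vadd e u), e'; split; [by exists u|exact: coker_class_self|].
by fibre (vproj e).
Qed.

Lemma coker_scale t e :
  @rscale _ _ _ _ _ Q t (coker_class VV e) = coker_class VV (vscale t e).
Proof.
apply/seteqP; split=> [y [u [w iw <-]]|y]; last first.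
  by exists e => //; exact: coker_class_self.
have pw := image_anchor_proj iw.
rewrite (@coker_class_eq (vscale t e)) //; exists (vscale t w).
  by rewrite vproj_scale; exact: image_anchorZ.
by rewrite vscaleDr.
Qed.

Lemma coker_sum (I : Type) (s : seq I) (P : pred I) (F : I -> E) x :
  (forall i, P i -> vproj (F i) = x) ->
  \big[@radd _ _ _ _ _ Q/coker_class VV (vzero E x)]_(i <- s | P i) coker_class VV (F i)
  = coker_class VV (\big[@vadd _ _ _ _ E/vzero E x]_(i <- s | P i) F i).
Proof.
move=> pF; elim: s => [|i s IH]; first by rewrite !big_nil.
rewrite !big_cons; case Pi : (P i) => //.
by rewrite IH coker_add // vproj_sum ?pF.
Qed.

Lemma src_onto g e : vproj e = src g -> exists2 v, vproj v = g & S v = e.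
Proof.
exact: (submersion_fibre_onto (vb_src VV) (@gsrc_submersion _ _ _ _ _ (vb_lie VV))).
Qed.

(** Division by the zero vector over the same arrow turns such an element into an
    element of the core with the same target. *)
Lemma zero_src_tgt v : S v = vzero E (src (vproj v)) -> image_anchor VV (tgt (vproj v)) (T v).
Proof.
set g := vproj v => sv; exists (v · inv (0_g)).
  split; first by rewrite vb_mul_proj ?proj_inv ?vproj_zero ?gmulgV // tgt_inv sv src0.
  by rewrite gsrc_mul ?src_inv ?tgt0 // tgt_inv sv src0.
by rewrite /core_anchor gtgt_mul // tgt_inv sv src0.
Qed.

(** If the sources of [v] and [w] differ by the anchor of [u], subtracting
    0_g u^-1 as well makes the source of the difference zero, and its target then
    lies in the image of the anchor ([zero_src_tgt]). *)
Lemma coker_action_unique v w : vproj v = vproj w ->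
  coker_class VV (S v) = coker_class VV (S w) -> coker_class VV (T v) = coker_class VV (T w).
Proof.
set g := vproj v => pw /(coker_classP (_ : vproj (S v) = vproj (S w))).
rewrite !proj_src -pw => /(_ erefl) [u cu Eu].
have pu := core_proj cu; have su := core_src cu.
have c0 : S (0_g) = T (inv u) by rewrite src0 tgt_inv su.
pose z := 0_g · inv u.
have pz : vproj z = g.
  by rewrite /z vb_mul_proj // vproj_zero proj_inv pu ginv_one gmulg1.
pose y := vadd v (vscale (-1) (vadd w z)).
have py : vproj y = g by rewrite /y vproj_add // vproj_scale vproj_add -?pw ?pz.
have sy : S y = vzero E (src g).
  rewrite /y srcD ?vproj_scale ?vproj_add -?pw ?pz // srcZ srcD -?pw ?pz //.
  rewrite /z gsrc_mul // src_inv -/(core_anchor _ u) Eu.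
  have pS : vproj (S v) = src g by rewrite proj_src.
  have pS' : vproj (S w) = src g by rewrite proj_src -pw.
  by fibre (src g).
have : image_anchor VV (tgt g) (T y) by rewrite -py; apply: zero_src_tgt; rewrite py.
have Ty : T y = vadd (T v) (vscale (-1) (T w)).
  rewrite /y tgtD ?vproj_scale ?vproj_add -?pw ?pz // tgtZ tgtD -?pw ?pz //.
  rewrite /z gtgt_mul // tgt0 vadd0 //.
  by rewrite proj_tgt -pw.
by rewrite Ty => i; apply/coker_classP; rewrite !proj_tgt -?pw.
Qed.

Lemma coker_action v :
  @raction _ _ _ _ _ Q (vproj v) (coker_class VV (S v)) = coker_class VV (T v).
Proof.
apply/seteqP; split=> [y [w [pw Sw]]|y Ty]; last by exists v; split=> //; exact: coker_class_self.
by rewrite (@coker_action_unique v w) //; symmetry; exact: coker_class_eq.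
Qed.

End VBAlgebra.

(** * The VB-complex *)

(** The term (i, j) with i <= j cancels against the term (j + 1, i). *)
Lemma cosimplicial_sum0 (K : pzRingType) (U : lmodType K) (X : nat -> nat -> U) (m : nat) :
  (forall i j, (0 < i <= j)%N -> (j < m)%N -> X i j = X j.+1 i) ->
  \sum_(1 <= i < m.+1) (-1) ^+ i *: \sum_(1 <= j < m) (-1) ^+ j *: X i j = 0.
Proof.
move=> XE; pose F i j := (-1) ^+ (i + j) *: X i j.
transitivity (\sum_(1 <= i < m.+1) \sum_(1 <= j < m) F i j).
  by apply: eq_bigr => i _; rewrite scaler_sumr; apply: eq_bigr => j _; rewrite scalerA -exprD.
have split_col j : (1 <= j < m)%N -> \sum_(1 <= i < m.+1) F i j =
    \sum_(1 <= i < m) (if (i <= j)%N then F i j else 0) +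
    \sum_(1 <= i < m) (if (j <= i)%N then F i.+1 j else 0).
  move=> /andP[j0 jm]; rewrite (@big_cat_nat _ _ _ j.+1) //=; last exact: leqW.
  rewrite [X in _ + X]big_add1 /=; congr (_ + _).
    rewrite (big_nat_widen _ _ m) //= big_mkcond; apply: eq_bigr => i _.
    by rewrite ltnS.
  by rewrite (big_nat_widenl _ 1) //= big_mkcond; apply: eq_bigr => i _.
rewrite exchange_big_nat /= big_nat (eq_bigr _ split_col) -big_nat big_split /=.
rewrite [X in _ + X]exchange_big_nat /= -big_split /= big_nat big1 // => j /andP[j0 jm].
rewrite -big_split /= big_nat big1 // => i /andP[i0 im].
case: ifP => ij; last by rewrite addr0.
by rewrite /F -XE ?i0 // addSn addnC exprS mulN1r scaleNr subrr.
Qed.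

Section CochainAlgebra.
Context {R : realType} {n d a b : nat} {M : manifold R n} {G : manifold R d}
        {GG : lie_groupoid M G} {E : vbundle M a} {V : vbundle G b}.
Variable VV : vb_groupoid GG E V.
Local Notation src := (gsrc GG).
Local Notation tgt := (gtgt GG).
Local Notation S := (gsrc VV).
Local Notation T := (gtgt VV).
Local Notation inv := (ginv VV).
Local Notation "v · w" := (gmul VV v w) (at level 40, left associativity).
Local Notation "0_ g" := (vzero V g) (at level 8, format "0_ g").
Local Notation nrv k := (@nerve _ _ _ M G k).
Local Notation face := (face GG).
Local Notation composable := (composable GG).
Local Notation base := (base GG).
Local Notation first_arrow := (first_arrow GG).
Local Notation degen := (degen GG).

Implicit Types (v w : V) (e : E) (g h : G) (x : M) (k : nat).

Lemma mulinvD v v' w w' : vproj v = vproj v' -> vproj w = vproj w' -> S v = S w -> S v' = S w' ->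
  vadd v v' · inv (vadd w w') = vadd (v · inv w) (v' · inv w').
Proof.
by move=> pv pw vw vw'; rewrite invD // mulD ?proj_inv ?pw // tgt_inv.
Qed.

Lemma mulinvZ t v w : S v = S w -> vscale t v · inv (vscale t w) = vscale t (v · inv w).
Proof. by move=> vw; rewrite invZ vb_mul_scale // tgt_inv. Qed.

Lemma mulinv_sum (I : Type) (s : seq I) (P : pred I) (F F' : I -> V) g h :
  src g = src h -> (forall i, P i -> vproj (F i) = g) -> (forall i, P i -> vproj (F' i) = h) ->
  (forall i, P i -> S (F i) = S (F' i)) ->
  \big[@vadd _ _ _ _ V/0_g]_(i <- s | P i) F i · inv (\big[@vadd _ _ _ _ V/0_h]_(i <- s | P i) F' i)
  = \big[@vadd _ _ _ _ V/0_(gmul GG g (ginv GG h))]_(i <- s | P i) (F i · inv (F' i)).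
Proof.
move=> gh pF pF' sF; elim: s => [|i s IH].
  by rewrite !big_nil inv0 mul0 // gtgt_inv.
rewrite !big_cons; case Pi : (P i) => //.
rewrite mulinvD ?IH ?vproj_sum ?pF ?pF' ?sF //.
rewrite [LHS]src_sum // [RHS]src_sum // gh.
exact: eq_bigr.
Qed.

Definition in_ker x v := core VV x v /\ T v = vzero E x.

Lemma in_ker_core x v : in_ker x v -> core VV x v. Proof. by case. Qed.

Lemma in_kerD x v w : in_ker x v -> in_ker x w -> in_ker x (vadd v w).
Proof.
move=> [cv tv] [cw tw]; split; first exact: coreD.
by rewrite tgtD ?(core_proj cv) ?(core_proj cw) // tv tw vadd0 // vproj_zero.
Qed.

Lemma in_kerZ x t v : in_ker x v -> in_ker x (vscale t v).
Proof. by move=> [cv tv]; split; [exact: coreZ|rewrite tgtZ tv vscale_zero]. Qed.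

Lemma in_ker0 x : in_ker x (0_(gone GG x)).
Proof. by split; [exact: core0|rewrite tgt0 gtgt_one]. Qed.

Lemma in_ker_sum (I : Type) (s : seq I) (P : pred I) (F : I -> V) x :
  (forall i, P i -> in_ker x (F i)) ->
  in_ker x (\big[@vadd _ _ _ _ V/0_(gone GG x)]_(i <- s | P i) F i).
Proof.
move=> kF; elim/big_rec: _ => [|i y Pi ky]; first exact: in_ker0.
by apply: in_kerD => //; exact: kF.
Qed.

Lemma core_mul0_comp x v g : core VV x v -> tgt g = x -> S v = T (0_g).
Proof. by move=> [_ ->] <-; rewrite tgt0. Qed.

Lemma core_mul0_proj x v g : core VV x v -> tgt g = x -> vproj (v · 0_g) = g.
Proof.
move=> cv tg; rewrite vb_mul_proj ?(core_mul0_comp cv tg) // (core_proj cv) vproj_zero.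
by rewrite gone_mul.
Qed.

Lemma src_mul0 x v g : core VV x v -> tgt g = x -> S (v · 0_g) = vzero E (src g).
Proof. by move=> cv tg; rewrite gsrc_mul ?(core_mul0_comp cv tg) // src0. Qed.

Lemma tgt_mul0 x v g : core VV x v -> tgt g = x -> T (v · 0_g) = T v.
Proof. by move=> cv tg; rewrite gtgt_mul // (core_mul0_comp cv tg). Qed.

Lemma mul0D x v w g : core VV x v -> core VV x w -> tgt g = x ->
  vadd v w · 0_g = vadd (v · 0_g) (w · 0_g).
Proof.
move=> cv cw tg; rewrite -mulD ?(core_proj cv) ?(core_proj cw) ?(core_mul0_comp _ tg) //.
by rewrite vadd0 // vproj_zero.
Qed.

Lemma mul0Z x t v g : core VV x v -> tgt g = x -> vscale t v · 0_g = vscale t (v · 0_g).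
Proof.
by move=> cv tg; rewrite -vb_mul_scale ?(core_mul0_comp cv tg) // vscale_zero.
Qed.

Lemma mul0_sum (I : Type) (s : seq I) (P : pred I) (F : I -> V) x g :
  tgt g = x -> (forall i, P i -> in_ker x (F i)) ->
  \big[@vadd _ _ _ _ V/0_(gone GG x)]_(i <- s | P i) F i · 0_g
  = \big[@vadd _ _ _ _ V/0_g]_(i <- s | P i) (F i · 0_g).
Proof.
move=> tg kF; elim: s => [|i s IH].
  by rewrite !big_nil mul0 ?gsrc_one // gone_mul.
rewrite !big_cons; case Pi : (P i) => //.
by rewrite (mul0D (x := x)) ?IH //; apply: in_ker_core; [exact: kF|exact: in_ker_sum].
Qed.

(** By the interchange law, v (-v) = (v + 0) (0 + (-v)) = v + (-v), where the zeros
    over the unit act as units. *)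
Lemma ker_inv x v : in_ker x v -> inv v = vscale (-1) v.
Proof.
move=> [cv tv]; have pv := core_proj cv; have sv := core_src cv.
have c1 : S v = T (0_(gone GG x)) by rewrite sv tgt0 gtgt_one.
have c2 : S (0_(gone GG x)) = T (vscale (-1) v) by rewrite src0 gsrc_one tgtZ tv vscale_zero.
symmetry; apply: ginv_uniq; first by rewrite sv tgtZ tv vscale_zero.
rewrite -{1}(vadd0 pv) -{1}(@v0add _ _ _ _ _ (vscale (-1) v) (gone GG x)) ?vproj_scale //.
rewrite mulD ?vproj_zero ?vproj_scale //.
rewrite -(one0 VV) gmul_one ?sv // gone_mul; last by rewrite tgtZ tv vscale_zero.
by rewrite (vaddN pv) tv one0.
Qed.

(** The interchange law again: a product of vectors which can be multiplied by
    zeros on either side is a sum. *)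
Lemma ker_mul_shift x g A B : tgt g = x -> in_ker x A -> in_ker (src g) B ->
  A · (0_g · inv B) = vadd (A · 0_g) (vscale (-1) (0_g · B)).
Proof.
move=> tg [cA tA] kB; have [cB tB] := kB.
have pB := core_proj cB; have sB := core_src cB.
have c0 : S (0_g) = T B by rewrite src0 tB.
have c1 : S (0_g) = T (vscale (-1) B) by rewrite tgtZ tB src0 vscale_zero.
have p0B : vproj (0_g · B) = g by rewrite vb_mul_proj // vproj_zero pB gmulg1.
have t0B : T (0_g · B) = vzero E x by rewrite gtgt_mul // tgt0 tg.
rewrite (ker_inv kB) -{1}(vscale_zero V (-1) g) vb_mul_scale //.
rewrite -{1}(vadd0 (core_proj cA)).
rewrite -{1}(@v0add _ _ _ _ _ (vscale (-1) (0_g · B)) g) ?vproj_scale //.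
rewrite mulD ?vproj_zero ?vproj_scale ?p0B ?(core_proj cA) //.
- congr vadd; rewrite -(one0 VV) gone_mul //.
  by rewrite tgtZ t0B vscale_zero.
- by rewrite (core_mul0_comp cA tg).
- by rewrite src0 gsrc_one tgtZ t0B vscale_zero.
Qed.

Section Cochains.
Context {k : nat} (c : nrv k.+1 -> V).
Hypothesis Cc : vb_cochain VV c.

Lemma vbc_proj p : composable p -> vproj (c p) = first_arrow p.
Proof. by have [+ _ _] := Cc; exact. Qed.

Lemma vbc_src p q : composable p -> composable q -> face 0 p = face 0 q -> S (c p) = S (c q).
Proof. by have [_ + _] := Cc; exact. Qed.

Lemma vbc_smooth : nerve_smooth (composable (k := k.+1)) c.
Proof. by have [] := Cc. Qed.

(** Any composable string whose face 0 is [q] gives the same vector ([vbc_sourceE]). *)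
Definition vbc_source (q : nrv k) : E := S (c (degen q)).

Lemma vbc_sourceE p : composable p -> S (c p) = vbc_source (face 0 p).
Proof.
move=> cp; apply: vbc_src => //; rewrite ?face0_degen //.
by apply: composable_degen; exact: composable_face.
Qed.

Lemma vbc_source_proj q : composable q -> vproj (vbc_source q) = base q.
Proof.
move=> cq; rewrite /vbc_source proj_src vbc_proj ?first_arrow_degen ?gsrc_one //.
exact: composable_degen.
Qed.

Lemma vbc_source_smooth : nerve_smooth (composable (k := k)) vbc_source.
Proof. by apply: nerve_smooth_gsrc; apply: nerve_smooth_degen; exact: vbc_smooth. Qed.

(** With this twist of the first face, the differential is the alternating sum
    of the cofaces from 1 on ([vb_diffE]). *)
Definition coface (i : nat) (p : nrv k.+2) : V :=
  if i == 1%N then c (face 1 p) · inv (c (face 0 p)) else c (face i p).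

Lemma coface1_comp p : composable p -> S (c (face 1 p)) = S (c (face 0 p)).
Proof.
move=> cp; apply: vbc_src; try exact: composable_face.
by rewrite (@face_face _ _ _ _ _ GG _ 0 1).
Qed.

Lemma coface_proj i p : composable p -> (0 < i <= k.+2)%N -> vproj (coface i p) = first_arrow p.
Proof.
move=> cp ik; rewrite /coface; case: eqP => [_|/eqP i1].
  have c1 := coface1_comp cp.
  rewrite vb_mul_proj ?tgt_inv // proj_inv !vbc_proj; try exact: composable_face.
  by rewrite first_arrow_face1 gmulK // src_first_arrow.
by rewrite vbc_proj ?first_arrow_face //; [lia|apply: composable_face => //; lia].
Qed.

Lemma coface_src1 p : composable p -> S (coface 1 p) = T (c (face 0 p)).
Proof. by move=> cp; rewrite /coface /= gsrc_mul ?src_inv // tgt_inv coface1_comp. Qed.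

Lemma vb_diffE p : vb_diff VV c p =
  \big[@vadd _ _ _ _ V/0_(first_arrow p)]_(1 <= i < k.+3) vscale ((-1) ^+ i) (coface i p).
Proof.
rewrite big_ltn // expr1 /=; congr vadd.
rewrite big_nat [RHS]big_nat; apply: eq_bigr => i /andP[i2 _].
by rewrite /coface gtn_eqF.
Qed.

Lemma vb_diff_proj p : composable p -> vproj (vb_diff VV c p) = first_arrow p.
Proof.
move=> cp; rewrite vb_diffE big_nat; apply: vproj_sum => i ik.
by rewrite vproj_scale coface_proj.
Qed.

Lemma fibre_diff p : composable p ->
  fibre_coord (first_arrow p) (vb_diff VV c p) =
  \sum_(1 <= i < k.+3) (-1) ^+ i *: fibre_coord (first_arrow p) (coface i p).
Proof.
move=> cp; rewrite vb_diffE big_nat fibre_coord_sum => [|i ik]; last first.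
  by rewrite vproj_scale coface_proj.
rewrite [RHS]big_nat; apply: eq_bigr => i ik.
by rewrite fibre_coordZ // coface_proj.
Qed.

(** A lift to E of the differential, in the cokernel complex, of the class of the
    source of [c]: the target of [c q] represents the action of the first arrow on
    the class of the source ([coker_action]). *)
Definition diff_source (q : nrv k.+1) : E :=
  vadd (T (c q)) (\big[@vadd _ _ _ _ E/vzero E (base q)]_(1 <= i < k.+2)
    vscale ((-1) ^+ i) (vbc_source (face i q))).

Lemma diff_source_proj q : composable q -> vproj (diff_source q) = base q.
Proof.
move=> cq; rewrite /diff_source; apply: vprojD; first by rewrite proj_tgt vbc_proj.
rewrite big_nat; apply: vproj_sum => i /andP[i0 ik]; rewrite vproj_scale vbc_source_proj.
  by rewrite base_face.
exact: composable_face.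
Qed.

(** The source of the first coface is the target of [c (face 0 p)]; the other
    cofaces give the sources of [c] on the faces of [face 0 p]. *)
Lemma src_vb_diff p : composable p ->
  S (vb_diff VV c p) = vscale (-1) (diff_source (face 0 p)).
Proof.
move=> cp; have cp0 : composable (face 0 p) by exact: composable_face.
move q_def : (face 0 p) cp0 => q cp0.
have pF i : (1 <= i < k.+2)%N -> vproj (vscale ((-1) ^+ i) (vbc_source (face i q))) = base q.
  move=> /andP[i0 ik]; rewrite vproj_scale vbc_source_proj ?base_face //.
  exact: composable_face.
have pT : vproj (T (c q)) = base q by rewrite proj_tgt vbc_proj.
apply: (@fibre_coord_inj _ _ _ _ _ (base q)).
- by rewrite proj_src vb_diff_proj // src_first_arrow ?q_def.
- by rewrite vproj_scale diff_source_proj.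
rewrite fibre_coordZ ?diff_source_proj // /diff_source.
rewrite (@fibre_coordD _ _ _ _ _ (base q)) //; last by rewrite big_nat; exact: vproj_sum.
rewrite big_nat fibre_coord_sum //.
rewrite vb_diffE big_nat src_sum; last first.
  by move=> i ik; rewrite vproj_scale coface_proj.
rewrite src_first_arrow // q_def fibre_coord_sum; last first.
  by move=> i ik; rewrite proj_src vproj_scale coface_proj // src_first_arrow // q_def.
rewrite -[in LHS]big_nat big_ltn // scalerDr; congr (_ + _).
  by rewrite srcZ coface_src1 // expr1 fibre_coordZ q_def.
rewrite big_add1 /= -[in RHS]big_nat scaler_sumr big_nat [RHS]big_nat; apply: eq_bigr => i /andP[i0 ik].
rewrite srcZ /coface gtn_eqF ?ltnS // vbc_sourceE; last by apply: composable_face.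
rewrite (@face_face _ _ _ _ _ GG _ 0 i.+1) // q_def.
have pS : vproj (vbc_source (face i q)) = base q.
  by rewrite vbc_source_proj ?base_face //; exact: composable_face.
by rewrite /= !fibre_coordZ // scalerA exprS.
Qed.

End Cochains.

End CochainAlgebra.

Section Differential.
Context {R : realType} {n d a b : nat} {M : manifold R n} {G : manifold R d}
        {GG : lie_groupoid M G} {E : vbundle M a} {V : vbundle G b}.
Variable VV : vb_groupoid GG E V.
Local Notation src := (gsrc GG).
Local Notation tgt := (gtgt GG).
Local Notation S := (gsrc VV).
Local Notation T := (gtgt VV).
Local Notation inv := (ginv VV).
Local Notation "v · w" := (gmul VV v w) (at level 40, left associativity).
Local Notation "0_ g" := (vzero V g) (at level 8, format "0_ g").
Local Notation nrv k := (@nerve _ _ _ M G k).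
Local Notation face := (face GG).
Local Notation composable := (composable GG).
Local Notation base := (base GG).
Local Notation first_arrow := (first_arrow GG).
Local Notation degen := (degen GG).

Implicit Types (v w : V) (e : E) (g h : G) (x : M) (k : nat).

Lemma base0 (x : nrv 0) : base x = x. Proof. exact: gtgt_one. Qed.

Lemma core_mul_shift x g A z : tgt g = x -> core VV x A -> vproj z = g ->
  T z = vzero E x -> A · z = vadd (A · 0_g) z.
Proof.
move=> tg cA pz tz; have c0 := core_mul0_comp cA tg.
rewrite -{1}(vadd0 (core_proj cA)) -{1}(v0add pz).
rewrite mulD ?vproj_zero ?(core_proj cA) //; last by rewrite src0 gsrc_one.
by congr vadd; rewrite -(one0 VV) gone_mul.
Qed.

Lemma core_shift_div g h A B : src g = tgt h -> core VV (tgt g) A -> core VV (tgt h) B ->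
  (A · 0_(gmul GG g h)) · inv (B · 0_h) = A · (0_g · inv B).
Proof.
move=> gh cA cB.
have c1 : S A = T (0_g) by exact: core_mul0_comp cA _.
have c2 : S (0_g) = T (0_h) by rewrite src0 tgt0 gh.
have c3 : S B = T (0_h) by exact: core_mul0_comp cB _.
rewrite -(mul0 VV gh) gmulA // ginvM // gmul_cancel ?gsrc_mul //.
  by rewrite -gmulA // tgt_inv (core_src cB) src0 gh.
by rewrite tgt_inv c3.
Qed.

Section Linear.
Context {k : nat} (c c' : nrv k.+1 -> V).
Hypotheses (Cc : vb_cochain VV c) (Cc' : vb_cochain VV c').

Lemma cofaceD i p : composable p -> (0 < i <= k.+2)%N ->
  coface VV (fun q => vadd (c q) (c' q)) i p = vadd (coface VV c i p) (coface VV c' i p).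
Proof.
move=> cp ik; rewrite /coface; case: eqP => // _.
have cf j : (j <= k.+2)%N -> composable (face j p) by move=> jk; exact: composable_face.
rewrite mulinvD ?(vbc_proj Cc) ?(vbc_proj Cc') //; try exact: cf.
  exact: coface1_comp Cc _ _.
exact: coface1_comp Cc' _ _.
Qed.

Lemma cofaceZ t i p : composable p -> (0 < i <= k.+2)%N ->
  coface VV (fun q => vscale t (c q)) i p = vscale t (coface VV c i p).
Proof.
move=> cp ik; rewrite /coface; case: eqP => // _.
by rewrite mulinvZ //; exact: coface1_comp Cc _ _.
Qed.

Lemma vb_cochainD_succ : vb_cochain VV (fun q => vadd (c q) (c' q)).
Proof.
split.
- by move=> p cp; rewrite vproj_add (vbc_proj Cc) // (vbc_proj Cc').
- move=> p q cp cq pq; rewrite !srcD ?(vbc_proj Cc) ?(vbc_proj Cc') //.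
  by rewrite (vbc_src Cc cp cq pq) (vbc_src Cc' cp cq pq).
- apply: nerve_smooth_vadd; [|exact: vbc_smooth Cc|exact: vbc_smooth Cc'].
  by move=> q cq; rewrite (vbc_proj Cc) // (vbc_proj Cc').
Qed.

Lemma vb_cochainZ_succ t : vb_cochain VV (fun q => vscale t (c q)).
Proof.
split.
- by move=> p cp; rewrite vproj_scale (vbc_proj Cc).
- by move=> p q cp cq pq; rewrite !srcZ (vbc_src Cc cp cq pq).
- by apply: nerve_smooth_vscale; exact: vbc_smooth Cc.
Qed.

End Linear.

Lemma vb_cochainD k (c c' : nrv k -> V) : vb_cochain VV c -> vb_cochain VV c' ->
  vb_cochain VV (fun q => vadd (c q) (c' q)).
Proof.
case: k c c' => [|k] c c' Cc Cc'; last exact: vb_cochainD_succ.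
have [[cc sc] [cc' sc']] := (Cc, Cc'); split=> [x|]; first exact: coreD.
apply: (@nerve_smooth_vadd _ _ _ _ _ 0) sc sc' => q _.
by rewrite (core_proj (cc q)) (core_proj (cc' q)).
Qed.

Lemma vb_cochainZ k t (c : nrv k -> V) : vb_cochain VV c ->
  vb_cochain VV (fun q => vscale t (c q)).
Proof.
case: k c => [|k] c Cc; last exact: vb_cochainZ_succ.
have [cc sc] := Cc; split=> [x|]; first exact: coreZ.
exact: (@nerve_smooth_vscale _ _ _ _ _ 0).
Qed.

Lemma vb_cochain_agree k (c c' : nrv k -> V) : (forall p, composable p -> c p = c' p) ->
  vb_cochain VV c -> vb_cochain VV c'.
Proof.
case: k c c' => [|k] c c' cc' Cc.
  suff -> : c' = c by [].
  by apply/funext => x; rewrite cc'.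
split.
- by move=> p cp; rewrite -cc' // (vbc_proj Cc).
- by move=> p q cp cq pq; rewrite -!cc' //; exact: vbc_src Cc _ _ cp cq pq.
- by apply: nerve_smooth_eq (vbc_smooth Cc).
Qed.

Lemma vb_cochain0 k : vb_cochain VV (fun p : nrv k => 0_(first_arrow p)).
Proof.
case: k => [|k].
  split=> [x|]; first by rewrite -[first_arrow _]/(gone GG x); exact: core0.
  apply: (@nerve_smooth_vzero _ _ _ _ _ 0); exact: (@nerve_smooth_first_arrow _ _ _ _ _ GG 0 setT).
split.
- by move=> p cp; rewrite vproj_zero.
- by move=> p q cp cq pq; rewrite !src0 !src_first_arrow // pq.
- by apply: nerve_smooth_vzero; exact: nerve_smooth_first_arrow.
Qed.

Lemma vb_cochain_proj k (c : nrv k -> V) p : vb_cochain VV c -> composable p ->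
  vproj (c p) = first_arrow p.
Proof.
case: k c p => [|k] c p Cc cp; last exact: vbc_proj Cc _ cp.
by have [cc _] := Cc; rewrite (core_proj (cc p)).
Qed.

Lemma vb_cochain_smooth k (c : nrv k -> V) : vb_cochain VV c ->
  nerve_smooth (composable (k := k)) c.
Proof. by case: k c => [|k] c Cc; [case: Cc|exact: vbc_smooth Cc]. Qed.

Lemma vb_diff_agree k (c c' : nrv k -> V) : (forall p, composable p -> c p = c' p) ->
  forall p, composable p -> vb_diff VV c p = vb_diff VV c' p.
Proof.
case: k c c' => [|k] c c' cc' p cp; first by rewrite /vb_diff !cc'.
rewrite !vb_diffE !big_nat; apply: eq_bigr => i /andP[i0 ik].
have cf j : (j <= k.+2)%N -> composable (face j p) by move=> jk; exact: composable_face.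
by congr vscale; rewrite /coface; case: eqP => _; rewrite !cc' //; apply: cf.
Qed.

Section Degree0.
Variable c : nrv 0 -> V.
Hypothesis Cc : vb_cochain VV c.

Let cc x : core VV x (c x). Proof. by case: Cc. Qed.

Definition left_part (g : G) := c (tgt g) · 0_g.
Definition right_part (g : G) := 0_g · inv (c (src g)).

Lemma right_part_comp g : S (0_g) = T (inv (c (src g))).
Proof. by rewrite tgt_inv (core_src (cc _)) src0. Qed.

Lemma left_part_proj g : vproj (left_part g) = g.
Proof. exact: core_mul0_proj (cc _) _. Qed.

Lemma right_part_proj g : vproj (right_part g) = g.
Proof.
rewrite /right_part vb_mul_proj ?right_part_comp // vproj_zero proj_inv (core_proj (cc _)).
by rewrite ginv_one gmulg1.
Qed.

Lemma left_part_src g : S (left_part g) = vzero E (src g).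
Proof. exact: src_mul0 (cc _) _. Qed.

Lemma right_part_src g : S (right_part g) = T (c (src g)).
Proof. by rewrite /right_part gsrc_mul ?right_part_comp // src_inv. Qed.

Lemma right_part_tgt g : T (right_part g) = vzero E (tgt g).
Proof. by rewrite /right_part gtgt_mul ?right_part_comp // tgt0. Qed.

Lemma vb_diff0E p : vb_diff VV c p = vadd (left_part (first_arrow p)) (right_part (first_arrow p)).
Proof. by []. Qed.

Lemma src_vb_diff0 p : S (vb_diff VV c p) = T (c (src (first_arrow p))).
Proof.
rewrite vb_diff0E srcD ?left_part_proj ?right_part_proj // left_part_src right_part_src.
by rewrite v0add // proj_tgt (core_proj (cc _)) gtgt_one.
Qed.

Lemma vb_cochain_diff0 : vb_cochain VV (vb_diff VV c).
Proof.
split.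
- by move=> p cp; rewrite vb_diff0E vproj_add ?left_part_proj ?right_part_proj.
- by move=> p q cp cq pq; rewrite !src_vb_diff0 !src_first_arrow // pq.
have sc := vb_cochain_smooth Cc.
have sf i := @nerve_smooth_face _ _ _ _ _ GG _ _ _ i c.
have s0 : nerve_smooth (composable (k := 1)) (fun p => 0_(first_arrow p)).
  by apply: nerve_smooth_vzero; exact: nerve_smooth_first_arrow.
apply: nerve_smooth_vadd.
- by move=> p cp; rewrite left_part_proj right_part_proj.
- apply: nerve_smooth_gmul => //; last exact: (sf 1%N).
  by move=> p cp; exact: core_mul0_comp (cc _) _.
- apply: nerve_smooth_gmul => //; first by move=> p cp; rewrite right_part_comp.
  by apply: nerve_smooth_ginv; exact: (sf 0%N).
Qed.

(** The two cofaces of the differential of a section of the core are equal. *)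
Lemma vb_diff_diff0 p : composable p -> vb_diff VV (vb_diff VV c) p = 0_(first_arrow p).
Proof.
move=> cp; have Cd := vb_cochain_diff0.
have cf j : (j <= 2)%N -> composable (face j p) by move=> jk; exact: composable_face.
have p1 := coface_proj Cd cp (isT : (0 < 1 <= 2)%N).
have p2 := coface_proj Cd cp (isT : (0 < 2 <= 2)%N).
suff E12 : coface VV (vb_diff VV c) 1 p = coface VV (vb_diff VV c) 2 p.
  rewrite vb_diffE big_ltn // big_ltn // big_geq // E12.
  by fibre (first_arrow p).
rewrite /coface eqxx (_ : (2 == 1)%N = false) // !vb_diff0E.
move: cp p1 p2; set g := str p 0; set h := str p 1 => cp p1 p2.
have gh : src g = tgt h by move/composableP: cp => /(_ 0%N isT).
have f0 : first_arrow (face 0 p) = h by rewrite -str0 str_face.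
have f1 : first_arrow (face 1 p) = gmul GG g h by rewrite -str0 str_face.
have f2 : first_arrow (face 2 p) = g by rewrite -str0 str_face.
rewrite f0 f1 f2 mulinvD ?left_part_proj ?right_part_proj //; last first.
  by rewrite !right_part_src gsrc_mul.
  by rewrite !left_part_src gsrc_mul.
have -> : right_part (gmul GG g h) · inv (right_part h) = 0_g.
  rewrite /right_part gsrc_mul // gmul_divr ?right_part_comp ?src0 ?gsrc_mul //.
  by rewrite inv0 mul0 ?gtgt_inv ?gsrc_mul // gmulK.
have -> : left_part (gmul GG g h) · inv (left_part h) = c (tgt g) · right_part g.
  by rewrite /left_part gtgt_mul // core_shift_div // /right_part gh.
rewrite (core_mul_shift (x := tgt g) (g := g)) //.
- by rewrite vadd0 // vproj_add // ?left_part_proj ?right_part_proj.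
- exact: right_part_proj.
- exact: right_part_tgt.
Qed.

End Degree0.

Lemma vb_diffD k (c c' : nrv k -> V) p : vb_cochain VV c -> vb_cochain VV c' -> composable p ->
  vb_diff VV (fun q => vadd (c q) (c' q)) p = vadd (vb_diff VV c p) (vb_diff VV c' p).
Proof.
case: k c c' p => [|k] c c' p Cc Cc' cp.
  have [[cc _] [cc' _]] := (Cc, Cc').
  have p1 := left_part_proj Cc (first_arrow p); have p2 := right_part_proj Cc (first_arrow p).
  have p3 := left_part_proj Cc' (first_arrow p); have p4 := right_part_proj Cc' (first_arrow p).
  rewrite !vb_diff0E.
  have -> : left_part (fun q : nrv 0 => vadd (c q) (c' q)) (first_arrow p) =
      vadd (left_part c (first_arrow p)) (left_part c' (first_arrow p)).
    by rewrite /left_part (mul0D (cc _) (cc' _)).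
  have -> : right_part (fun q : nrv 0 => vadd (c q) (c' q)) (first_arrow p) =
      vadd (right_part c (first_arrow p)) (right_part c' (first_arrow p)).
    rewrite /right_part invD ?(core_proj (cc _)) ?(core_proj (cc' _)) //.
    rewrite -mulD ?proj_inv ?(core_proj (cc _)) ?(core_proj (cc' _)) //.
    - by rewrite vadd0 // vproj_zero.
    - exact: right_part_comp Cc _.
    - exact: right_part_comp Cc' _.
  move: (left_part c _) (left_part c' _) (right_part c _) (right_part c' _) p1 p2 p3 p4.
  by move=> x1 x2 x3 x4 *; fibre (first_arrow p).
have Cd := vb_cochainD Cc Cc'.
apply: (@fibre_coord_inj _ _ _ _ _ (first_arrow p)).
- by rewrite (vb_diff_proj Cd).
- by rewrite vproj_add (vb_diff_proj Cc) // (vb_diff_proj Cc').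
rewrite fibre_coordD ?(vb_diff_proj Cc) ?(vb_diff_proj Cc') //.
rewrite (fibre_diff Cd) // (fibre_diff Cc) // (fibre_diff Cc') // -big_split /=.
rewrite big_nat [RHS]big_nat; apply: eq_bigr => i ik.
by rewrite (cofaceD Cc Cc') // fibre_coordD ?(coface_proj Cc) ?(coface_proj Cc') // scalerDr.
Qed.

Lemma vb_diffZ k t (c : nrv k -> V) p : vb_cochain VV c -> composable p ->
  vb_diff VV (fun q => vscale t (c q)) p = vscale t (vb_diff VV c p).
Proof.
case: k c p => [|k] c p Cc cp.
  have [cc _] := Cc.
  have p1 := left_part_proj Cc (first_arrow p); have p2 := right_part_proj Cc (first_arrow p).
  rewrite !vb_diff0E.
  have -> : left_part (fun q : nrv 0 => vscale t (c q)) (first_arrow p) =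
      vscale t (left_part c (first_arrow p)).
    by rewrite /left_part (mul0Z _ (cc _)).
  have -> : right_part (fun q : nrv 0 => vscale t (c q)) (first_arrow p) =
      vscale t (right_part c (first_arrow p)).
    by rewrite /right_part invZ -vb_mul_scale ?(right_part_comp Cc) // vscale_zero.
  move: (left_part c _) (right_part c _) p1 p2.
  by move=> x1 x2 *; fibre (first_arrow p).
have Cd := vb_cochainZ t Cc.
apply: (@fibre_coord_inj _ _ _ _ _ (first_arrow p)).
- by rewrite (vb_diff_proj Cd).
- by rewrite vproj_scale (vb_diff_proj Cc).
rewrite fibre_coordZ ?(vb_diff_proj Cc) //.
rewrite (fibre_diff Cd) // (fibre_diff Cc) // scaler_sumr.
rewrite big_nat [RHS]big_nat; apply: eq_bigr => i ik.
by rewrite (cofaceZ Cc) // fibre_coordZ ?(coface_proj Cc) // !scalerA mulrC.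
Qed.

Section PositiveDegree.
Context {k : nat} (c : nrv k.+1 -> V).
Hypothesis Cc : vb_cochain VV c.

Lemma coface_smooth i : (i <= k.+2)%N ->
  nerve_smooth (composable (k := k.+2)) (coface VV c i).
Proof.
move=> ik; have sf j jk := @nerve_smooth_face _ _ _ _ _ GG _ _ _ j c jk (vbc_smooth Cc).
rewrite /coface; case: eqP => _; last exact: sf.
apply: nerve_smooth_gmul; last by apply: nerve_smooth_ginv; exact: sf.
  by move=> p cp; rewrite tgt_inv; exact: coface1_comp Cc _ cp.
exact: sf.
Qed.

Lemma vb_cochain_diff_succ : vb_cochain VV (vb_diff VV c).
Proof.
split.
- by move=> p; exact: vb_diff_proj Cc _.
- by move=> p q cp cq pq; rewrite !(src_vb_diff Cc) // pq.
apply: (@nerve_smooth_eq _ _ _ _ _ _ _ _ _ (fun p : nrv k.+2 =>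
  \big[@vadd _ _ _ _ V/0_(first_arrow p)]_(1 <= i < k.+3 | (0 < i <= k.+2)%N) vscale ((-1) ^+ i) (coface VV c i p))).
  by move=> p cp; rewrite vb_diffE [RHS]big_nat.
apply: nerve_smooth_sum.
- by move=> i p ik cp; rewrite vproj_scale (coface_proj Cc).
- exact: nerve_smooth_first_arrow.
- move=> i /andP[_ ik]; apply: nerve_smooth_vscale; exact: coface_smooth.
Qed.

(** For i = 1 this uses that division is linear on pairs with equal sources. *)
Lemma coface_vb_diff i p : composable p -> (0 < i <= k.+3)%N ->
  fibre_coord (first_arrow p) (coface VV (vb_diff VV c) i p) =
  \sum_(1 <= j < k.+3) (-1) ^+ j *: fibre_coord (first_arrow p) (coface VV (coface VV c j) i p).
Proof.
move=> cp /andP[i0 ik].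
have cf j : (j <= k.+3)%N -> composable (face j p) by move=> jk; exact: composable_face.
rewrite [in LHS]/coface; case: eqP => [i1|/eqP i1]; last first.
  have fi : first_arrow (face i p) = first_arrow p by rewrite first_arrow_face //; lia.
  rewrite -fi (fibre_diff Cc) ?fi //; last exact: cf.
  by apply: eq_bigr => j _; rewrite /coface (negbTE i1).
rewrite !vb_diffE !big_nat.
have src_gh : src (first_arrow (face 1 p)) = src (first_arrow (face 0 p)).
  by rewrite first_arrow_face1 gsrc_mul // src_first_arrow.
have src_j j : (0 < j <= k.+2)%N -> S (coface VV c j (face 1 p)) = S (coface VV c j (face 0 p)).
  move=> /andP[j0 jk]; have f01 : face 0 (face 1 p) = face 0 (face 0 p).
    by rewrite (@face_face _ _ _ _ _ GG _ 0 1).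
  case: (j =P 1%N) => [->|j1].
    by rewrite !(coface_src1 Cc) ?f01 //; exact: cf.
  rewrite /coface; move/eqP/negbTE: (j1) => ->.
  apply: (vbc_src Cc); try (by apply: composable_face => //; exact: cf).
  have jk' : (0 < j <= k.+2)%N by rewrite j0.
  by rewrite (face_face jk' (cf 1%N isT)) (face_face jk' (cf 0%N isT)) f01.
have pF l : (l <= k.+3)%N -> forall j, (0 < j < k.+3)%N ->
    vproj (vscale ((-1) ^+ j) (coface VV c j (face l p))) = first_arrow (face l p).
  by move=> lk j jk; rewrite vproj_scale (coface_proj Cc) //; exact: cf.
have sF j : (0 < j < k.+3)%N -> S (vscale ((-1) ^+ j) (coface VV c j (face 1 p))) =
    S (vscale ((-1) ^+ j) (coface VV c j (face 0 p))).
  by move=> jk; rewrite !srcZ src_j.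
have -> := mulinv_sum (index_iota 1 k.+3) src_gh (pF 1%N isT) (pF 0%N isT) sF.
have gE : gmul GG (first_arrow (face 1 p)) (ginv GG (first_arrow (face 0 p))) = first_arrow p.
  by rewrite first_arrow_face1 gmulK // src_first_arrow.
have projE j : (0 < j <= k.+2)%N ->
    vproj (coface VV c j (face 1 p) · inv (coface VV c j (face 0 p))) = first_arrow p.
  move=> jk; rewrite vb_mul_proj ?tgt_inv ?src_j // proj_inv !(coface_proj Cc) ?gE //; exact: cf.
rewrite gE fibre_coord_sum => [|j jk]; last first.
  by rewrite mulinvZ ?src_j // vproj_scale projE.
apply: eq_bigr => j jk.
by rewrite mulinvZ ?src_j // fibre_coordZ ?projE // /coface i1.
Qed.

(** The cosimplicial identities.  For i = j = 1 both sides are quotients with a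
    common factor, which cancels: (v w^-1) (u w^-1)^-1 = v u^-1. *)
Lemma coface_coface i j p : composable p -> (0 < i <= j)%N -> (j <= k.+2)%N ->
  coface VV (coface VV c j) i p = coface VV (coface VV c i) j.+1 p.
Proof.
move=> cp /andP[i0 ij] jk.
have cf l : (l <= k.+3)%N -> composable (face l p) by move=> lk; exact: composable_face.
have ff l m : (l <= m <= k.+2)%N -> face l (face m.+1 p) = face m (face l p).
  by move=> lm; rewrite (@face_face _ _ _ _ _ GG _ l m.+1).
have coE (l : nat) m (e : nrv l.+1 -> V) q : (1 < m)%N -> coface VV e m q = e (face m q).
  by move=> m1; rewrite /coface gtn_eqF.
have co1 (l : nat) (e : nrv l.+1 -> V) q : coface VV e 1 q = e (face 1 q) · inv (e (face 0 q)) by [].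
rewrite [RHS]coE ?ltnS ?(leq_trans i0) //.
case: (i =P 1%N) => [i1|i1]; last by rewrite !coE ?ff ?ij //; lia.
rewrite i1 !co1; case: (j =P 1%N) => [j1|j1].
  2: by rewrite (ff 1%N j) ?(ff 0%N j) ?coE //; lia.
have c1 := cf 1%N isT; have c0 := cf 0%N isT.
have E01 : face 0 (face 1 p) = face 0 (face 0 p) by rewrite ff.
rewrite j1 !co1 (ff 1%N 1%N) // (ff 0%N 1%N) // E01 gmul_divr ?tgt_inv //.
  by rewrite -E01; exact: coface1_comp Cc _ c1.
exact: coface1_comp Cc _ c0.
Qed.

Lemma vb_diff_diff_succ p : composable p ->
  vb_diff VV (vb_diff VV c) p = 0_(first_arrow p).
Proof.
move=> cp; have Cd := vb_cochain_diff_succ.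
apply: (@fibre_coord_inj _ _ _ _ _ (first_arrow p)).
- exact: vb_diff_proj Cd _ cp.
- exact: vproj_zero.
rewrite (fibre_diff Cd) // fibre_coord0.
rewrite big_nat (eq_bigr (fun i => (-1) ^+ i *:
   \sum_(1 <= j < k.+3) (-1) ^+ j *: fibre_coord (first_arrow p) (coface VV (coface VV c j) i p))).
  rewrite -big_nat; apply: (cosimplicial_sum0 (X := fun i j => fibre_coord (first_arrow p) (coface VV (coface VV c j) i p))).
  by move=> i j ij jk; rewrite coface_coface.
by move=> i ik; rewrite coface_vb_diff.
Qed.

End PositiveDegree.

Lemma vb_cochain_diff k (c : nrv k -> V) : vb_cochain VV c -> vb_cochain VV (vb_diff VV c).
Proof. by case: k c => [|k] c; [exact: vb_cochain_diff0|exact: vb_cochain_diff_succ]. Qed.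

Lemma vb_diff_diff k (c : nrv k -> V) p : vb_cochain VV c -> composable p ->
  vb_diff VV (vb_diff VV c) p = 0_(first_arrow p).
Proof. by case: k c p => [|k] c p Cc; [exact: vb_diff_diff0|exact: vb_diff_diff_succ]. Qed.

End Differential.

(** * The kernel complex and the map r *)

Section KernelComplex.
Context {R : realType} {n d a b : nat} {M : manifold R n} {G : manifold R d}
        {GG : lie_groupoid M G} {E : vbundle M a} {V : vbundle G b}.
Variable VV : vb_groupoid GG E V.
Local Notation src := (gsrc GG).
Local Notation tgt := (gtgt GG).
Local Notation S := (gsrc VV).
Local Notation T := (gtgt VV).
Local Notation inv := (ginv VV).
Local Notation "v · w" := (gmul VV v w) (at level 40, left associativity).
Local Notation "0_ g" := (vzero V g) (at level 8, format "0_ g").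
Local Notation nrv k := (@nerve _ _ _ M G k).
Local Notation face := (face GG).
Local Notation composable := (composable GG).
Local Notation base := (base GG).
Local Notation first_arrow := (first_arrow GG).
Local Notation degen := (degen GG).

Implicit Types (v w : V) (e : E) (g h : G) (x : M) (k : nat).

Local Notation r := (r_map VV).
Local Notation kcochain := (@cochain _ _ _ _ _ (ker_complex VV)).
Local Notation kdiff := (@rep_diff _ _ _ _ _ GG (ker_rep VV)).

Lemma kcochain_in k (f : nrv k -> V) p : kcochain f -> composable p -> in_ker VV (base p) (f p).
Proof. by move=> [kf _] cp; exact: kf. Qed.

Lemma kcochain_smooth k (f : nrv k -> V) : kcochain f -> nerve_smooth (composable (k := k)) f.
Proof. by case. Qed.

Lemma r0E (f : nrv 0 -> V) x : kcochain f -> r f x = f x.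
Proof.
move=> kf; have [cf _] := kcochain_in kf (I : @composable 0 x); rewrite base0 in cf.
change (f x · 0_(gone GG x) = f x).
by rewrite -(one0 VV) gmul_one // (core_src cf).
Qed.

Lemma r_src k (f : nrv k -> V) p : kcochain f -> composable p ->
  S (r f p) = vzero E (src (first_arrow p)).
Proof. by move=> kf cp; apply: src_mul0 (in_ker_core (kcochain_in kf cp)) _. Qed.

Lemma r_proj k (f : nrv k -> V) p : kcochain f -> composable p -> vproj (r f p) = first_arrow p.
Proof. by move=> kf cp; apply: core_mul0_proj (in_ker_core (kcochain_in kf cp)) _. Qed.

Lemma r_cochain k (f : nrv k -> V) : kcochain f -> vb_cochain VV (r f).
Proof.
move=> kf; have sf := kcochain_smooth kf.
have sr : nerve_smooth (composable (k := k)) (r f).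
  apply: nerve_smooth_gmul => //.
    by move=> q cq; exact: core_mul0_comp (in_ker_core (kcochain_in kf cq)) _.
  by apply: nerve_smooth_vzero; exact: nerve_smooth_first_arrow.
case: k f kf sf sr => [|k] f kf sf sr.
  split=> // x; rewrite r0E //.
  by have [] := kcochain_in kf (I : @composable 0 x); rewrite base0.
split=> // [p cp|p q cp cq pq]; first exact: r_proj.
by rewrite !r_src // !src_first_arrow // pq.
Qed.

Lemma r_inj_at x v w g : in_ker VV x v -> in_ker VV x w -> tgt g = x -> v · 0_g = w · 0_g -> v = w.
Proof.
by move=> [cv _] [cw _] tg; apply: gmulI; [exact: core_mul0_comp cv tg|exact: core_mul0_comp cw tg].
Qed.

Lemma ker_action_in g v : in_ker VV (src g) v ->
  in_ker VV (tgt g) (0_g · v · inv (0_g)) /\ (0_g · v · inv (0_g)) · 0_g = 0_g · v.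
Proof.
move=> [cv tv]; have pv := core_proj cv; have sv := core_src cv.
have c0 : S (0_g) = T v by rewrite src0 tv.
have c1 : S (0_g · v) = S (0_g) by rewrite gsrc_mul // sv src0.
split; last by rewrite gmulVK.
split; first split.
- rewrite vb_mul_proj ?tgt_inv // vb_mul_proj // proj_inv !vproj_zero pv gmulg1.
  exact: gmulgV.
- by rewrite gsrc_mul ?tgt_inv // src_inv tgt0.
- by rewrite gtgt_mul ?tgt_inv // gtgt_mul // tgt0.
Qed.

Lemma kdiff_in k (f : nrv k -> V) p : kcochain f -> composable p ->
  in_ker VV (base p) (kdiff f p).
Proof.
move=> kf cp; rewrite /rep_diff /=; apply: in_kerD.
  have := kcochain_in kf (composable_face (leq0n _) cp).
  by rewrite -src_first_arrow // => /ker_action_in [].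
rewrite big_nat; apply: in_ker_sum => i /andP[i0 ik]; apply: in_kerZ.
rewrite -(base_face i0 cp); apply: kcochain_in => //.
exact: composable_face.
Qed.

Lemma r_kdiff k (f : nrv k -> V) p : kcochain f -> composable p ->
  r (kdiff f) p = vadd (0_(first_arrow p) · f (face 0 p))
    (\big[@vadd _ _ _ _ V/0_(first_arrow p)]_(1 <= i < k.+2) vscale ((-1) ^+ i) (f (face i p) · 0_(first_arrow p))).
Proof.
move=> kf cp; rewrite /r_map /rep_diff /=.
have k0 := kcochain_in kf (composable_face (leq0n _) cp).
rewrite -src_first_arrow // in k0; have [ka Ea] := ker_action_in k0.
have kF i : (1 <= i < k.+2)%N -> in_ker VV (base p) (vscale ((-1) ^+ i) (f (face i p))).
  move=> /andP[i0 ik]; apply: in_kerZ; rewrite -(base_face i0 cp); apply: kcochain_in => //.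
  exact: composable_face.
rewrite big_nat (mul0D (x := base p)) ?Ea //; last 2 first.
- exact: in_ker_core ka.
- exact/in_ker_core/in_ker_sum.
congr vadd; rewrite (mul0_sum _ (erefl (base p)) kF) [RHS]big_nat; apply: eq_bigr => i ik.
have /andP[i0 ik'] := ik.
rewrite (mul0Z (x := base p)) // -(base_face i0 cp); apply: in_ker_core; apply: kcochain_in => //.
exact: composable_face.
Qed.

(** After right translation by zero the action v |-> 0_g v 0_g^-1 becomes
    v |-> 0_g v, and the division in the first coface becomes a difference
    ([ker_mul_shift]), whose two terms are the first two of the differential. *)
Lemma r_diff k (f : nrv k.+1 -> V) p : kcochain f -> composable p ->
  vb_diff VV (r f) p = r (kdiff f) p.
Proof.
move=> kf cp; have Cr := r_cochain kf.
rewrite r_kdiff // vb_diffE [in LHS]big_ltn // [in RHS]big_ltn //.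
set g := first_arrow p; have gh := src_first_arrow cp; rewrite -/g in gh.
have cf j : (j <= k.+2)%N -> composable (face j p) by move=> jk; exact: composable_face.
have kB := kcochain_in kf (cf 0%N isT); rewrite -gh in kB.
have kA := kcochain_in kf (cf 1%N isT); rewrite base_face // in kA.
have pA : vproj (f (face 1 p) · 0_g) = g by exact: core_mul0_proj (in_ker_core kA) _.
have pB : vproj (0_g · f (face 0 p)) = g.
  have [cB tB] := kB; rewrite vb_mul_proj ?src0 ?tB // vproj_zero (core_proj cB).
  exact: gmulg1.
have -> : coface VV (r f) 1 p = vadd (f (face 1 p) · 0_g) (vscale (-1) (0_g · f (face 0 p))).
  rewrite -(ker_mul_shift (x := base p)) // /coface eqxx /r_map first_arrow_face1 core_shift_div //.
  - exact: in_ker_core kA.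
  - have := in_ker_core kB; rewrite gh; exact.
have -> : \big[@vadd _ _ _ _ V/0_g]_(2 <= i < k.+3) vscale ((-1) ^+ i) (coface VV (r f) i p) =
    \big[@vadd _ _ _ _ V/0_g]_(2 <= i < k.+3) vscale ((-1) ^+ i) (f (face i p) · 0_g).
  rewrite big_nat [RHS]big_nat; apply: eq_bigr => i /andP[i2 ik].
  by rewrite /coface gtn_eqF // /r_map first_arrow_face.
set x := \big[_/_]_(2 <= i < k.+3) _.
have px : vproj x = g.
  rewrite /x big_nat; apply: vproj_sum => i /andP[i2 ik].
  rewrite vproj_scale; apply: (core_mul0_proj (x := base p)) => //.
  have i0 : (0 < i)%N by lia.
  by rewrite -(base_face i0 cp); apply/in_ker_core/kcochain_in => //; apply: cf.
by move: (f (face 1 p) · 0_g) (0_g · f (face 0 p)) (x) pA pB px => y z w *; fibre g.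
Qed.

(** In degree 0 the term of the face 1 enters the VB-differential with a plus
    sign, hence the sign. *)
Lemma r_diff0 (f : nrv 0 -> V) p : kcochain f -> composable p ->
  vb_diff VV (r f) p = vscale (-1) (r (kdiff f) p).
Proof.
move=> kf cp; rewrite r_kdiff // big_ltn // big_geq // vb_diff0E.
set g := first_arrow p; have gh := src_first_arrow cp; rewrite -/g in gh.
have cf j : (j <= 1)%N -> composable (face j p) by move=> jk; exact: composable_face.
have kB := kcochain_in kf (cf 0%N isT); rewrite -gh in kB.
have kA := kcochain_in kf (cf 1%N isT); rewrite base_face // in kA.
have pA : vproj (f (face 1 p) · 0_g) = g by exact: core_mul0_proj (in_ker_core kA) _.
have [cB tB] := kB.
have c0 : S (0_g) = T (f (face 0 p)) by rewrite src0 tB.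
have pB : vproj (0_g · f (face 0 p)) = g.
  by rewrite vb_mul_proj // vproj_zero (core_proj cB); exact: gmulg1.
have -> : left_part VV (r f) g = f (face 1 p) · 0_g by rewrite /left_part r0E.
have -> : right_part VV (r f) g = vscale (-1) (0_g · f (face 0 p)).
  rewrite /right_part r0E //.
  have -> : f (src g) = f (face 0 p) by [].
  by rewrite (ker_inv kB) -{1}(vscale_zero V (-1) g) vb_mul_scale.
by move: (f (face 1 p) · 0_g) (0_g · f (face 0 p)) pA pB => y z *; fibre g.
Qed.

(** The preimage is the quotient by the zero vectors. *)
Lemma r_preimage k (w : nrv k.+1 -> V) : vb_cochain VV w ->
  (forall p, composable p -> S (w p) = vzero E (src (first_arrow p))) ->
  (forall p, composable p -> T (w p) = vzero E (base p)) ->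
  exists2 z : nrv k.+1 -> V, kcochain z & forall p, composable p -> r z p = w p.
Proof.
move=> Cw sw tw; exists (fun p => w p · inv (0_(first_arrow p))).
  split=> [p cp|].
    have c0 : S (w p) = T (inv (0_(first_arrow p))) by rewrite tgt_inv src0 sw.
    split; first split.
    - by rewrite vb_mul_proj // proj_inv vproj_zero (vbc_proj Cw) // gmulgV.
    - by rewrite gsrc_mul // src_inv tgt0.
    - by rewrite /core_anchor gtgt_mul // tw.
  apply: nerve_smooth_gmul; last 2 first.
  - exact: vbc_smooth Cw.
  - apply: nerve_smooth_ginv; apply: nerve_smooth_vzero; exact: nerve_smooth_first_arrow.
  by move=> p cp; rewrite tgt_inv src0 sw.
by move=> p cp; rewrite /r_map gmulVK // src0 sw.
Qed.

Lemma rD k (f f' : nrv k -> V) p : kcochain f -> kcochain f' -> composable p ->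
  r (fun q => vadd (f q) (f' q)) p = vadd (r f p) (r f' p).
Proof.
move=> kf kf' cp; apply: (mul0D (x := base p)) => //; apply: in_ker_core; exact: kcochain_in.
Qed.

Lemma rZ k t (f : nrv k -> V) p : kcochain f -> composable p ->
  r (fun q => vscale t (f q)) p = vscale t (r f p).
Proof.
move=> kf cp; apply: (mul0Z (x := base p)) => //; apply: in_ker_core; exact: kcochain_in.
Qed.

Lemma kcochainD k (f f' : nrv k -> V) : kcochain f -> kcochain f' ->
  kcochain (fun q => vadd (f q) (f' q)).
Proof.
move=> kf kf'; split=> [p cp|]; first exact: in_kerD (kcochain_in kf cp) (kcochain_in kf' cp).
apply: nerve_smooth_vadd; [|exact: kcochain_smooth kf|exact: kcochain_smooth kf'].
move=> q cq.
by rewrite (core_proj (in_ker_core (kcochain_in kf cq))) (core_proj (in_ker_core (kcochain_in kf' cq))).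
Qed.

Lemma kcochainZ k t (f : nrv k -> V) : kcochain f -> kcochain (fun q => vscale t (f q)).
Proof.
move=> kf; split=> [p cp|]; first exact: in_kerZ (kcochain_in kf cp).
by apply: nerve_smooth_vscale; exact: kcochain_smooth kf.
Qed.

Lemma kcochain0 k : kcochain (fun p : nrv k => 0_(gone GG (base p))).
Proof.
split=> [p cp|]; first exact: in_ker0.
by apply: nerve_smooth_vzero; apply: nerve_smooth_gone; exact: nerve_smooth_base.
Qed.

Lemma kcochain_agree k (f f' : nrv k -> V) : (forall p, composable p -> f p = f' p) ->
  kcochain f -> kcochain f'.
Proof.
move=> ff' kf; split=> [p cp|]; first by rewrite -ff' //; exact: kcochain_in kf cp.
exact: nerve_smooth_eq (kcochain_smooth kf).
Qed.

(** The sign in front depends on the degree only, so that linearity of the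
    differential passes from the VB-complex to the kernel complex, where the
    action would otherwise have to be expanded. *)
Lemma kdiff_r k : exists t : R, forall (f : nrv k -> V) p, kcochain f -> composable p ->
  r (kdiff f) p = vscale t (vb_diff VV (r f) p).
Proof.
case: k => [|k]; [exists (-1)|exists 1] => f p kf cp.
  by rewrite r_diff0 // vscaleA mulrNN mul1r vscale1.
by rewrite vscale1 r_diff.
Qed.

Lemma kdiff_eq_r k (f f' : nrv k -> V) p : kcochain f -> kcochain f' -> composable p ->
  vb_diff VV (r f) p = vb_diff VV (r f') p -> kdiff f p = kdiff f' p.
Proof.
move=> kf kf' cp E1; have [t Et] := kdiff_r k.
apply: (r_inj_at (kdiff_in kf cp) (kdiff_in kf' cp) (erefl (tgt (first_arrow p)))).
by rewrite -!/(r _ p) -[LHS]/(r (kdiff f) p) -[RHS]/(r (kdiff f') p) !Et // E1.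
Qed.

End KernelComplex.

(** * Smooth lifts and the map pi *)

Section Lifts.
Context {R : realType} {n d a b : nat} {M : manifold R n} {G : manifold R d}
        {GG : lie_groupoid M G} {E : vbundle M a} {V : vbundle G b}.
Variable VV : vb_groupoid GG E V.
Local Notation src := (gsrc GG).
Local Notation tgt := (gtgt GG).
Local Notation S := (gsrc VV).
Local Notation T := (gtgt VV).
Local Notation inv := (ginv VV).
Local Notation "v · w" := (gmul VV v w) (at level 40, left associativity).
Local Notation "0_ g" := (vzero V g) (at level 8, format "0_ g").
Local Notation nrv k := (@nerve _ _ _ M G k).
Local Notation face := (face GG).
Local Notation composable := (composable GG).
Local Notation base := (base GG).
Local Notation first_arrow := (first_arrow GG).
Local Notation degen := (degen GG).

Implicit Types (v w : V) (e : E) (g h : G) (x : M) (k : nat).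

Lemma rank_row_mx (K : fieldType) m n1 n2 (A : 'M[K]_(m, n1)) (B : 'M[K]_(m, n2)) :
  \rank (row_mx A B) = (\rank A + \rank (kermx A *m B))%N.
Proof.
have h1 := mxrank_mul_ker (kermx A) B.
have h2 : \rank (kermx (row_mx A B)) = \rank (kermx A :&: kermx B)%MS.
  apply/eqmx_rank/andP; split; last first.
    rewrite sub_kermx mul_mx_row.
    have /sub_kermxP -> := capmxSl (kermx A) (kermx B).
    by have /sub_kermxP -> := capmxSr (kermx A) (kermx B); rewrite row_mx0.
  have := mulmx_ker (row_mx A B); rewrite mul_mx_row -[X in _ = X](row_mx0).
  by move=> /eq_row_mx [E1 E2]; rewrite sub_capmx !sub_kermx E1 E2 !eqxx.
rewrite !mxrank_ker in h1 h2; have := rank_leq_row A; have := rank_leq_row (row_mx A B).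
by lia.
Qed.

Section Ranks.
Context (g : G) (Phi : @chart R V (d + b)) (phi : @chart R G d) (U : set G) (al : V -> 'rV[R]_b)
  (Psi : @chart R E (n + a)) (psi : @chart R M n) (U' : set M) (al' : E -> 'rV[R]_a).
Hypotheses (aPhi : atlas Phi) (tr : trivialization Phi phi U al) (Ug : U g)
  (aPsi : atlas Psi) (tr' : trivialization Psi psi U' al') (U'g : U' (src g)).

Lemma src_mxE v : vproj v = g -> al' (S v) = al v *m mx_of S Phi phi al' g.
Proof. by move=> pv; rewrite -{1}pv; apply: (mx_ofP (vb_src VV) aPhi tr aPsi tr'); rewrite pv. Qed.

Lemma src_mx_rank : \rank (mx_of S Phi phi al' g) = a.
Proof.
suff : row_full (mx_of S Phi phi al' g) by move/eqP.
rewrite -sub1mx; apply/row_subP => i.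
have [e pe ae] := triv_inv tr' (row i 1%:M) U'g.
have [v pv Sv] := src_onto VV pe.
by rewrite -ae -Sv src_mxE // submxMl.
Qed.

Lemma src_mx_ker (x : 'rV[R]_b) : x *m mx_of S Phi phi al' g = 0 -> S (triv_vec Phi phi g x) = vzero E (src g).
Proof.
have [pv av] := triv_vecP x aPhi tr Ug; move=> x0.
apply: (triv_inj tr'); rewrite ?vproj_zero ?proj_src ?pv //.
by rewrite src_mxE // av x0 (triv_zero tr').
Qed.

End Ranks.

(** The source map is a submersion, hence onto on fibres, so that the equation
    for the source has constant rank. *)
Lemma lift_source k (e : nrv k -> E) :
  nerve_smooth (composable (k := k)) e -> (forall q, composable q -> vproj (e q) = base q) ->
  exists2 c : nrv k.+1 -> V, vb_cochain VV c & forall p, composable p -> S (c p) = e (face 0 p).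
Proof.
move=> se pe.
have sS : smooth S by case: (@gsrc_submersion _ _ _ _ _ (vb_lie VV)).
have se0 := nerve_smooth_face (leq0n k.+1) se.
(* The second equation repeats the first and adds nothing to the rank. *)
have [||c sc cP] := @nerve_lift_pair _ _ _ _ _ k.+1 _ _ _ _ _ _ _ _ _ V E E src src S S
  (composable (k := k.+1)) (first_arrow (k := k.+1)) (fun p => e (face 0 p)) (fun p => e (face 0 p)) a
  (vb_src VV) sS (vb_src VV) sS (nerve_smooth_first_arrow _ _) se0 se0.
- move=> p cp; have cp0 := composable_face (leq0n _) cp.
  have [|v pv Sv] := @src_onto _ _ _ _ _ _ _ _ _ _ VV (first_arrow p) (e (face 0 p)).
    by rewrite pe // src_first_arrow.
  by exists v.
- move=> p Phi phi U al Psi1 psi1 U1 al1 Psi2 psi2 U2 al2 cp aPhi tr Up aPsi1 tr1 U1p aPsi2 tr2 U2p.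
  rewrite rank_row_mx (src_mx_rank aPhi tr Up aPsi1 tr1 U1p).
  suff -> : kermx (mx_of S Phi phi al1 (first_arrow p)) *m mx_of S Phi phi al2 (first_arrow p) = 0.
    by rewrite mxrank0 addn0.
  apply/row_matrixP => i; rewrite row_mul row0.
  set x := row i _; have [pv av] := triv_vecP x aPhi tr Up.
  have x0 : x *m mx_of S Phi phi al1 (first_arrow p) = 0.
    by rewrite /x -row_mul mulmx_ker row0.
  rewrite -av -(src_mxE aPhi tr Up aPsi2 tr2 U2p) //.
  by rewrite (src_mx_ker aPhi tr Up aPsi1 tr1 U1p x0) (triv_zero tr2).
exists c; last by move=> p cp; case: (cP p cp).
split=> //; first by move=> p cp; case: (cP p cp).
by move=> p q cp cq pq; have [_ -> _] := cP p cp; have [_ -> _] := cP q cq; rewrite pq.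
Qed.

(** The source and the target together have rank [a] plus the rank of the anchor
    at units, so that regularity makes the rank constant. *)
Lemma lift_anchor k (e : nrv k -> E) : regular VV ->
  nerve_smooth (composable (k := k)) e -> (forall q, composable q -> image_anchor VV (base q) (e q)) ->
  exists2 h : nrv k -> V, nerve_smooth (composable (k := k)) h &
    forall q, composable q -> core VV (base q) (h q) /\ T (h q) = e q.
Proof.
move=> [rho reg] se ie.
have sS : smooth S by case: (@gsrc_submersion _ _ _ _ _ (vb_lie VV)).
have sT : smooth T by case: (@gtgt_submersion _ _ _ _ _ (vb_lie VV)).
have sb := nerve_smooth_base GG (composable (k := k)).
have [||h sh hP] := @nerve_lift_pair _ _ _ _ _ k _ _ _ _ _ _ _ _ _ V E E src tgt S T
  (composable (k := k)) (fun q => gone GG (base q)) (fun q => vzero E (base q)) e (a + rho)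
  (vb_src VV) sS (vb_tgt VV) sT (nerve_smooth_gone GG sb) (nerve_smooth_vzero E sb) se.
- by move=> q cq; have [v [pv sv] Tv] := ie q cq; exists v.
- move=> q Phi phi U al Psi1 psi1 U1 al1 Psi2 psi2 U2 al2 cq aPhi tr Uq aPsi1 tr1 U1q aPsi2 tr2 U2q.
  set x := base q in Uq U1q U2q *; set g := gone GG x in Uq U1q U2q *.
  rewrite rank_row_mx (src_mx_rank aPhi tr Uq aPsi1 tr1 U1q); congr (_ + _)%N.
  set A := mx_of S _ _ _ _; set B := mx_of T _ _ _ _.
  have TB v : vproj v = g -> al2 (T v) = al v *m B.
    by move=> pv; rewrite /B -pv; apply: (mx_ofP (vb_tgt VV) aPhi tr aPsi2 tr2); rewrite pv.
  have [f [finj frange fD fZ]] := reg x.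
  have fim (w : 'rV[R]_rho) : image_anchor VV x (f w) by rewrite -frange; exists w.
  have pf (w : 'rV[R]_rho) : vproj (f w) = x by exact: image_anchor_proj (fim w).
  have U2x : U2 x by rewrite -(gtgt_one GG x).
  pose h (w : 'rV[R]_rho) := al2 (f w).
  have hD (u w : 'rV[R]_rho) : h (u + w) = h u + h w by rewrite /h fD (triv_add tr2) ?pf.
  have hZ t (w : 'rV[R]_rho) : h (t *: w) = t *: h w by rewrite /h fZ (triv_scale tr2) ?pf.
  have h0 : h 0 = 0 by rewrite -(scale0r 0) hZ scale0r.
  pose F : 'M[R]_(rho, a) := \matrix_i h (delta_mx 0 i).
  have hF (w : 'rV[R]_rho) : h w = w *m F.
    rewrite {1}(row_sum_delta w) (big_morph h hD h0) mulmx_sum_row.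
    by apply: eq_bigr => i _; rewrite hZ rowK.
  have hinj (u w : 'rV[R]_rho) : h u = h w -> u = w.
    by move=> huw; apply: finj; apply: (triv_inj tr2); rewrite ?pf.
  (* Both row spaces consist of the coordinates of the image of the anchor. *)
  have -> : \rank (kermx A *m B) = \rank F.
    apply/eqmx_rank/andP; split; apply/row_subP => i.
      rewrite row_mul; set y := row i _.
      have y0 : y *m A = 0 by rewrite /y -row_mul mulmx_ker row0.
      have [pv av] := triv_vecP y aPhi tr Uq.
      have Sv := src_mx_ker aPhi tr Uq aPsi1 tr1 U1q y0.
      rewrite -av -TB //.
      have : image_anchor VV x (T (triv_vec Phi phi g y)).
        by exists (triv_vec Phi phi g y) => //; split=> //; rewrite Sv gsrc_one.
      by rewrite -frange => -[w _ <-]; rewrite -/(h w) hF submxMl.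
    rewrite rowK /h; have [v [pv sv] <-] := fim (delta_mx 0 i).
    rewrite /core_anchor TB // submxMr // sub_kermx.
    have := src_mxE aPhi tr Uq aPsi1 tr1 U1q pv; rewrite -/A => <-.
    by rewrite sv (triv_zero tr1) // -(gsrc_one GG x).
  apply/eqP; rewrite -/(row_free F); apply/inj_row_free => v v0.
  by apply: hinj; rewrite hF v0 h0.
by exists h => // q cq; have [ph Sh Th] := hP q cq.
Qed.

Local Notation qcochain := (@cochain _ _ _ _ _ (coker_complex VV)).
Local Notation qdiff := (@rep_diff _ _ _ _ _ GG (coker_rep VV)).
Local Notation pi := (pi_map VV).

(** The lifts of a class form an affine subspace of the fibre, so that the local
    lifts glue. *)
Lemma lift_coker k (f : nrv k -> set E) : qcochain f ->
  exists2 e : nrv k -> E, nerve_smooth (composable (k := k)) e &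
    forall q, composable q -> vproj (e q) = base q /\ coker_class VV (e q) = f q.
Proof.
move=> [_ sf].
apply: (nerve_glue_sections (A := fun q => [set e | vproj e = base q /\ coker_class VV e = f q])
  (fun q => vzero E (base q))).
- move=> q e e' t cq [pe Ee] [pe' Ee']; split; first by vproj_solve.
  rewrite -Ee; have pp : vproj e = vproj e' by rewrite pe.
  have /(coker_classP VV pp) iu : coker_class VV e = coker_class VV e' by rewrite Ee Ee'.
  apply: coker_class_eq; exists (vscale (- t) (vadd e (vscale (-1) e'))).
    exact: image_anchorZ.
  by fibre (base q).
- by move=> q e e' cq [-> _] [-> _].
- move=> p cp; have [N [h [oN Np sh hP]]] := sf p cp.
  exists N, h; split=> // q cq Nq; have [ph Eh] := hP q cq Nq.
  by rewrite /= ph Eh.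
Qed.

Lemma pi_mapE k (c : nrv k.+1 -> V) q : vb_cochain VV c -> composable q ->
  pi c q = coker_class VV (vbc_source VV c q).
Proof.
move=> Cc cq; apply/seteqP; split=> [e [p [cp pq]]|e ce].
  by rewrite (vbc_sourceE Cc) // pq.
exists (degen q); split=> //; [exact: composable_degen|exact: face0_degen].
Qed.

Lemma pi_cochain k (c : nrv k.+1 -> V) : vb_cochain VV c -> qcochain (pi c).
Proof.
move=> Cc; split=> [q cq|q cq].
  by rewrite pi_mapE //; exists (vbc_source VV c q) => //=; exact: vbc_source_proj Cc _ cq.
exists setT, (vbc_source VV c); split=> //; first exact: openT.
  by rewrite setIT; exact: vbc_source_smooth Cc.
move=> q' cq' _; rewrite pi_mapE //; split=> //; exact: vbc_source_proj Cc _ cq'.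
Qed.

Lemma pi_preimage k (f : nrv k -> set E) : qcochain f ->
  exists2 c : nrv k.+1 -> V, vb_cochain VV c & forall q, composable q -> pi c q = f q.
Proof.
move=> /lift_coker [e se eP].
have [|c Cc Sc] := lift_source se; first by move=> q /eP [].
exists c => // q cq; rewrite pi_mapE // /vbc_source Sc; last exact: composable_degen.
by rewrite face0_degen; case: (eP q cq).
Qed.

(** The action of the first arrow on the class of the source of [c p] is the class
    of the target of [c p]. *)
Lemma qdiff_pi k (c : nrv k.+1 -> V) p : vb_cochain VV c -> composable p ->
  qdiff (pi c) p = coker_class VV (diff_source VV c p).
Proof.
move=> Cc cp.
have cf j : (j <= k.+1)%N -> composable (face j p) by move=> jk; exact: composable_face.
have pF i : (1 <= i < k.+2)%N -> vproj (vscale ((-1) ^+ i) (vbc_source VV c (face i p))) = base p.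
  move=> /andP[i0 ik]; rewrite vproj_scale (vbc_source_proj Cc) ?base_face //.
  exact: cf.
rewrite /rep_diff (pi_mapE Cc (cf 0%N isT)) -(vbc_sourceE Cc cp) -{1}(vbc_proj Cc cp).
rewrite (coker_action VV (c p)) [\big[_/_]_(_ <= _ < _) _]big_nat.
rewrite (eq_bigr (fun i => coker_class VV (vscale ((-1) ^+ i) (vbc_source VV c (face i p))))).
  rewrite (coker_sum VV (index_iota 1 k.+2) pF) (coker_add VV) //.
  - by rewrite /diff_source [in RHS]big_nat.
  - by rewrite vproj_sum // proj_tgt (vbc_proj Cc).
by move=> i /andP[i0 ik]; rewrite (pi_mapE Cc (cf _ ik)) (coker_scale VV).
Qed.

Lemma pi_vb_diff k (c : nrv k.+1 -> V) p : vb_cochain VV c -> composable p ->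
  pi (vb_diff VV c) p = coker_class VV (vscale (-1) (diff_source VV c p)).
Proof.
move=> Cc cp; rewrite pi_mapE //; last exact: vb_cochain_diff.
rewrite /vbc_source (src_vb_diff Cc) ?face0_degen //.
exact: composable_degen.
Qed.

Lemma pi_vb_diff0 (c : nrv 0 -> V) p : vb_cochain VV c -> composable p ->
  pi (vb_diff VV c) p = coker_class VV (vzero E (base p)).
Proof.
move=> Cc cp; have [cc _] := Cc; rewrite pi_mapE //; last exact: vb_cochain_diff.
rewrite /vbc_source (src_vb_diff0 Cc) first_arrow_degen gsrc_one.
rewrite -{2}(core_tgt_proj (cc (base p))); apply/coker_class0P.
by rewrite (core_tgt_proj (cc _)); exists (c (base p)).
Qed.

End Lifts.

(** * Cohomology of complexes of functions on the nerve *)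

Section GenericCohomology.
Context {R : realType} {n d : nat} {M : manifold R n} {G : manifold R d}
        {GG : lie_groupoid M G}.
Local Notation complex := (@complex R n d M G).
Local Notation nrv k := (@nerve _ _ _ M G k).
Local Notation composable := (composable GG).
Local Notation agree := (agree GG).

Local Notation "f \++ g" := (fun p => cadd (f p) (g p)) (at level 50).
Local Notation "t \** f" := (fun p => cscale t (f p)) (at level 40).

(** The operations of a complex satisfy the vector space laws on values of
    cochains only, hence this form of the axioms. *)
Record complex_laws (C : complex) : Prop := ComplexLaws {
  claw_addC : forall k (f g : nrv k -> cval C) p, cochain f -> cochain g -> composable p ->
    cadd (f p) (g p) = cadd (g p) (f p) ;
  claw_addA : forall k (f g h : nrv k -> cval C) p, cochain f -> cochain g -> cochain h ->
    composable p -> cadd (f p) (cadd (g p) (h p)) = cadd (cadd (f p) (g p)) (h p) ;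
  claw_add0 : forall k (f : nrv k -> cval C) p, cochain f -> composable p ->
    cadd (f p) (czero C p) = f p ;
  claw_opp : forall k (f : nrv k -> cval C) p, cochain f -> composable p ->
    cadd (f p) (cscale (-1) (f p)) = czero C p ;
  claw_scaleD : forall k t (f g : nrv k -> cval C) p, cochain f -> cochain g -> composable p ->
    cscale t (cadd (f p) (g p)) = cadd (cscale t (f p)) (cscale t (g p)) ;
  claw_agree : forall k (f g : nrv k -> cval C), agree f g -> cochain f -> cochain g ;
  claw_0 : forall k, cochain (@czero _ _ _ _ _ C k) ;
  claw_D : forall k (f g : nrv k -> cval C), cochain f -> cochain g -> cochain (f \++ g) ;
  claw_Z : forall k t (f : nrv k -> cval C), cochain f -> cochain (t \** f) ;
  claw_diff : forall k (f : nrv k -> cval C), cochain f -> cochain (cdiff f) ;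
  claw_diff_agree : forall k (f g : nrv k -> cval C), agree f g -> agree (cdiff f) (cdiff g) ;
  claw_diffD : forall k (f g : nrv k -> cval C) p, cochain f -> cochain g -> composable p ->
    cdiff (f \++ g) p = cadd (cdiff f p) (cdiff g p) ;
  claw_diffZ : forall k t (f : nrv k -> cval C) p, cochain f -> composable p ->
    cdiff (t \** f) p = cscale t (cdiff f p) }.

Section Laws.
Context {C : complex} (L : complex_laws C).
Local Notation fn k := (nrv k -> cval C).
Local Notation zero k := (@czero _ _ _ _ _ C k).
Local Notation cocycle := (@cocycle _ _ _ _ _ GG C _).
Local Notation cclass := (@cclass _ _ _ _ _ GG C _).

(** Coboundaries up to their values on strings that are not composable.  Unlike
    [coboundary], this notion is stable under sums. *)
Definition cobound k (f : fn k) := exists2 b : fn k, coboundary b & agree f b.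

Lemma cobound_cochain k (f : fn k) : cobound f -> cochain f.
Proof.
move=> [b cb fb]; apply: (claw_agree L (f := b)) => [p cp|]; first by rewrite fb.
case: k b cb {fb f} => [_ ->|k b [c cc <-]]; [exact: claw_0|exact: claw_diff].
Qed.

Lemma cobound_agree k (f g : fn k) : agree f g -> cobound f -> cobound g.
Proof. by move=> fg [b cb fb]; exists b => // p cp; rewrite -fg // fb. Qed.

Lemma add00 k : agree (zero k \++ zero k) (zero k).
Proof. by move=> p cp; exact: (claw_add0 L (claw_0 L k) cp). Qed.

Lemma idem0 k (f : fn k) : cochain f -> (forall p, composable p -> f p = cadd (f p) (f p)) -> agree f (zero k).
Proof.
move=> cf ff p cp; have cN := claw_Z L (-1) cf.
have := claw_addA L cf cf cN cp.
by rewrite -ff // (claw_opp L cf cp) (claw_add0 L cf cp).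
Qed.

Lemma scale0 k t : agree (t \** zero k) (zero k).
Proof.
apply: idem0 => [|p cp]; first exact: claw_Z (claw_0 L k).
by rewrite -(claw_scaleD L t (claw_0 L k) (claw_0 L k) cp) add00.
Qed.

Lemma diff0 k : agree (cdiff (zero k)) (zero k.+1).
Proof.
apply: idem0 => [|p cp]; first exact: claw_diff (claw_0 L k).
rewrite -(claw_diffD L (claw_0 L k) (claw_0 L k) cp).
by apply: claw_diff_agree cp => // q cq; rewrite add00.
Qed.

Lemma cobound0 k : cobound (zero k).
Proof.
case: k => [|k]; first by exists (zero 0).
exists (cdiff (zero k)); first by exists (zero k) => //; exact: claw_0.
by move=> p cp; rewrite diff0.
Qed.

Lemma coboundD k (f g : fn k) : cobound f -> cobound g -> cobound (f \++ g).
Proof.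
case: k f g => [f g [_ -> ff] [_ -> gg]|k f g [_ [b cb <-] fb] [_ [b' cb' <-] gb']].
  by exists (zero 0) => // p cp; rewrite ff // gg // add00.
exists (cdiff (b \++ b')); first by exists (b \++ b') => //; exact: claw_D.
by move=> p cp; rewrite fb // gb' // (claw_diffD L cb cb' cp).
Qed.

Lemma coboundZ k t (f : fn k) : cobound f -> cobound (t \** f).
Proof.
case: k f => [f [_ -> ff]|k f [_ [b cb <-] fb]].
  by exists (zero 0) => // p cp; rewrite ff // scale0.
exists (cdiff (t \** b)); first by exists (t \** b) => //; exact: claw_Z.
by move=> p cp; rewrite fb // (claw_diffZ L t cb cp).
Qed.

Lemma coboundS k (f : fn k.+1) : cobound f <-> exists2 b, cochain b & agree f (cdiff b).
Proof.
by split=> [[_ [b cb <-] fb]|[b cb fb]]; [exists b|exists (cdiff b) => //; exists b].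
Qed.

Lemma cobound_deg0 (f : fn 0) : cobound f <-> agree f (zero 0).
Proof. by split=> [[_ -> //]|f0]; exists (zero 0). Qed.

Lemma cobound_diff k (b : fn k) : cochain b -> cobound (cdiff b).
Proof. by move=> cb; exists (cdiff b) => //; exists b. Qed.

Lemma cohomologousP k (c c' : fn k) :
  cohomologous GG c c' <-> exists2 b, cobound b & agree c' (c \++ b).
Proof.
split=> [[b cb E]|[b [b' cb bb] E]]; first by exists b => //; exists b.
by exists b' => // p cp; rewrite E // bb.
Qed.

Lemma cocycle_cochain k (c : fn k) : cocycle c -> cochain c. Proof. by case. Qed.

Lemma cohomologous_sym k (c c' : fn k) : cochain c -> cohomologous GG c c' -> cohomologous GG c' c.
Proof.
move=> cc /cohomologousP[b cb E]; apply/cohomologousP; exists ((-1) \** b); first exact: coboundZ.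
have cb' := cobound_cochain cb; have cN := claw_Z L (-1) cb'.
move=> p cp; rewrite E // -(claw_addA L cc cb' cN cp) (claw_opp L cb' cp).
by rewrite (claw_add0 L cc cp).
Qed.

Lemma cohomologous_trans k (c c' c'' : fn k) : cochain c ->
  cohomologous GG c c' -> cohomologous GG c' c'' -> cohomologous GG c c''.
Proof.
move=> cc /cohomologousP[b cb E] /cohomologousP[b' cb' E']; apply/cohomologousP.
exists (b \++ b'); first exact: coboundD.
move=> p cp; rewrite E' // E //.
exact: (esym (claw_addA L cc (cobound_cochain cb) (cobound_cochain cb') cp)).
Qed.

Lemma cohomologous_sub k (c c' : fn k) : cochain c -> cohomologous GG c c' ->
  cobound (c' \++ ((-1) \** c)).
Proof.
move=> cc /cohomologousP[b cb E]; have Cb := cobound_cochain cb; have cN := claw_Z L (-1) cc.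
apply: cobound_agree cb => p cp; rewrite E // (claw_addC L cc Cb cp).
have <- := claw_addA L Cb cc cN cp; rewrite (claw_opp L cc cp).
exact: (esym (claw_add0 L Cb cp)).
Qed.

Lemma agree_cohomologous k (c c' : fn k) : cochain c -> agree c c' -> cohomologous GG c c'.
Proof.
move=> cc E; apply/cohomologousP; exists (zero k); first exact: cobound0.
by move=> p cp; rewrite -E // (claw_add0 L cc cp).
Qed.

Lemma cclass_self k (c : fn k) : cocycle c -> cclass c c.
Proof. by move=> zc; split=> //; apply: agree_cohomologous => //; case: zc. Qed.

Lemma cclass_eq k (c c' : fn k) : cocycle c -> cocycle c' -> cohomologous GG c c' ->
  cclass c = cclass c'.
Proof.
move=> [cc _] [cc' _] h; apply/seteqP; split=> e [ze he]; split=> //.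
  by apply: cohomologous_trans he => //; exact: cohomologous_sym.
exact: cohomologous_trans he.
Qed.

Lemma cclass_agree k (c c' : fn k) : cocycle c -> cocycle c' -> agree c c' -> cclass c = cclass c'.
Proof. by move=> zc zc' E; apply: cclass_eq => //; apply: agree_cohomologous => //; case: zc. Qed.

Lemma cocycle_agree k (c c' : fn k) : agree c c' -> cocycle c -> cocycle c'.
Proof.
move=> E [cc dc]; split; first exact: claw_agree E cc.
by move=> p cp; rewrite -(claw_diff_agree L E cp) dc.
Qed.

Lemma cocycle0 k : cocycle (zero k).
Proof. by split; [exact: claw_0|exact: diff0]. Qed.

Lemma cocycleD k (f g : fn k) : cocycle f -> cocycle g -> cocycle (f \++ g).
Proof.
move=> [cf df] [cg dg]; split; first exact: claw_D.
by move=> p cp; rewrite (claw_diffD L cf cg cp) df // dg // add00.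
Qed.

Lemma cocycleZ k t (f : fn k) : cocycle f -> cocycle (t \** f).
Proof.
move=> [cf df]; split; first exact: claw_Z.
by move=> p cp; rewrite (claw_diffZ L t cf cp) df // scale0.
Qed.

Lemma cohomologousD k (f f' g g' : fn k) : cochain f -> cochain g ->
  cohomologous GG f f' -> cohomologous GG g g' -> cohomologous GG (f \++ g) (f' \++ g').
Proof.
move=> cf cg /cohomologousP[b cb E] /cohomologousP[b' cb' E']; apply/cohomologousP.
exists (b \++ b'); first exact: coboundD.
have Cb := cobound_cochain cb; have Cb' := cobound_cochain cb'.
move=> p cp; rewrite E // E' //.
rewrite (claw_addA L (claw_D L cf Cb) cg Cb' cp) -(claw_addA L cf Cb cg cp).
rewrite (claw_addC L Cb cg cp) (claw_addA L cf cg Cb cp).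
exact: (esym (claw_addA L (claw_D L cf cg) Cb Cb' cp)).
Qed.

Lemma cohomologousZ k t (f f' : fn k) : cochain f ->
  cohomologous GG f f' -> cohomologous GG (t \** f) (t \** f').
Proof.
move=> cf /cohomologousP[b cb E]; apply/cohomologousP; exists (t \** b); first exact: coboundZ.
by move=> p cp; rewrite E // (claw_scaleD L t cf (cobound_cochain cb) cp).
Qed.

Lemma hadd_cclass k (f g : fn k) : cocycle f -> cocycle g ->
  hadd GG (cclass f) (cclass g) = cclass (f \++ g).
Proof.
move=> zf zg; apply/seteqP; split=> [c [f' [g' [[zf' ff'] [zg' gg'] ]]]|c cc].
  have -> // : cclass (f' \++ g') = cclass (f \++ g).
  apply: esym; apply: cclass_eq; [exact: cocycleD|exact: cocycleD|].
  by apply: cohomologousD => //; exact: cocycle_cochain.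
by exists f, g; split=> //; exact: cclass_self.
Qed.

Lemma hscale_cclass k t (f : fn k) : cocycle f ->
  hscale GG t (cclass f) = cclass (t \** f).
Proof.
move=> zf; apply/seteqP; split=> [c [f' [zf' ff']]|c cc]; last by exists f => //; exact: cclass_self.
have -> // : cclass (t \** f') = cclass (t \** f).
apply: esym; apply: cclass_eq; [exact: cocycleZ|exact: cocycleZ|].
by apply: cohomologousZ => //; exact: cocycle_cochain.
Qed.

Lemma hzero_cobound k (c : fn k) : cocycle c ->
  cclass c = hzero GG (C := C) (k := k) <-> cobound c.
Proof.
move=> zc; have cc := cocycle_cochain zc; split=> [E|cb]; last first.
  apply: esym; apply: cclass_eq => //; first exact: cocycle0.
  apply/cohomologousP; exists c => // p cp.
  by rewrite (claw_addC L (claw_0 L k) cc cp) (claw_add0 L cc cp).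
have : hzero GG (C := C) (k := k) c by rewrite -E; exact: cclass_self.
move=> [_ /cohomologousP[b cb Eb]]; have Cb := cobound_cochain cb; apply: cobound_agree cb => p cp.
by rewrite Eb // (claw_addC L (claw_0 L k) Cb cp) (claw_add0 L Cb cp).
Qed.

End Laws.

(** Compatibility with the differentials is replaced by preservation of cocycles
    and coboundaries, because the maps [r] and [pi] commute with the differentials
    only up to a sign, and [pi] lowers the degree. *)
Record cochain_map (C D : complex) k l (f : (nrv k -> cval C) -> (nrv l -> cval D)) : Prop :=
    CochainMap {
  cmap_agree : forall u v, cochain u -> cochain v -> agree u v -> agree (f u) (f v) ;
  cmap_cochain : forall u, cochain u -> cochain (f u) ;
  cmap_D : forall u v, cochain u -> cochain v -> agree (f (u \++ v)) (f u \++ f v) ;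
  cmap_Z : forall t u, cochain u -> agree (f (t \** u)) (t \** f u) ;
  cmap_cocycle : forall u, cocycle GG u -> cocycle GG (f u) ;
  cmap_cobound : forall u, cobound u -> cobound (f u) }.

Section Induced.
Context {C D : complex} (LC : complex_laws C) (LD : complex_laws D) {k l : nat}
  {f : (nrv k -> cval C) -> (nrv l -> cval D)} (Mf : cochain_map f).

Lemma induced_cclass u : cocycle GG u -> induced GG f (cclass GG u) = cclass GG (f u).
Proof.
move=> zu; apply/seteqP; split=> [c [v [zv /cohomologousP[b cb E]] cv]|c cc]; last first.
  by exists u => //; exact: cclass_self.
have -> // : cclass GG (f u) = cclass GG (f v).
apply: (cclass_eq LD); [exact: cmap_cocycle|exact: cmap_cocycle|].
have Cb := cobound_cochain LC cb; have Cu := cocycle_cochain zu.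
apply/cohomologousP; exists (f b); first exact: cmap_cobound.
move=> p cp; rewrite -(cmap_D Mf Cu Cb cp); apply: (cmap_agree Mf) cp => //.
- exact: cocycle_cochain zv.
- exact: claw_D.
Qed.

Lemma induced_linear : cohomology_linear GG (induced GG f).
Proof.
split=> [_ [u zu <-]|_ _ [u zu <-] [v zv <-]|t _ [u zu <-]].
- by exists (f u); [exact: cmap_cocycle|rewrite induced_cclass].
- have zfu := cmap_cocycle Mf zu; have zfv := cmap_cocycle Mf zv; have zuv := cocycleD LC zu zv.
  rewrite (hadd_cclass LC) // !induced_cclass // (hadd_cclass LD) //.
  apply: (cclass_agree LD) (cmap_cocycle Mf zuv) (cocycleD LD zfu zfv) _.
  exact: (cmap_D Mf (cocycle_cochain zu) (cocycle_cochain zv)).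
- have zfu := cmap_cocycle Mf zu; have ztu := cocycleZ LC t zu.
  rewrite (hscale_cclass LC) // !induced_cclass // (hscale_cclass LD) //.
  apply: (cclass_agree LD) (cmap_cocycle Mf ztu) (cocycleZ LD t zfu) _.
  exact: (cmap_Z Mf t (cocycle_cochain zu)).
Qed.

End Induced.
End GenericCohomology.
Arguments complex_laws {R n d M G} GG C.
Arguments cobound {R n d M G} GG {C k} f.
Arguments cochain_map {R n d M G} GG {C D k l} f.

(** * Vector space laws of the three complexes *)

Section ThreeComplexes.
Context {R : realType} {n d a b : nat} {M : manifold R n} {G : manifold R d}
        {GG : lie_groupoid M G} {E : vbundle M a} {V : vbundle G b}.
Variable VV : vb_groupoid GG E V.
Local Notation src := (gsrc GG).
Local Notation tgt := (gtgt GG).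
Local Notation S := (gsrc VV).
Local Notation T := (gtgt VV).
Local Notation inv := (ginv VV).
Local Notation "v · w" := (gmul VV v w) (at level 40, left associativity).
Local Notation "0_ g" := (vzero V g) (at level 8, format "0_ g").
Local Notation nrv k := (@nerve _ _ _ M G k).
Local Notation face := (face GG).
Local Notation composable := (composable GG).
Local Notation base := (base GG).
Local Notation first_arrow := (first_arrow GG).
Local Notation degen := (degen GG).

Implicit Types (v w : V) (e : E) (g h : G) (x : M) (k : nat).

Local Notation r := (@r_map _ _ _ _ _ GG _ _ _ _ VV _).
Local Notation pi := (pi_map VV).
Local Notation kcochain := (@cochain _ _ _ _ _ (ker_complex VV) _).
Local Notation kdiff := (@rep_diff _ _ _ _ _ GG (ker_rep VV)).
Local Notation qcochain := (@cochain _ _ _ _ _ (coker_complex VV) _).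
Local Notation qdiff := (@rep_diff _ _ _ _ _ GG (coker_rep VV)).
Local Notation qadd := (@radd _ _ _ _ _ (coker_rep VV)).
Local Notation qscale := (@rscale _ _ _ _ _ (coker_rep VV)).
Local Notation qzero x := (coker_class VV (vzero E x)).

Lemma vb_laws : complex_laws GG (vb_complex VV).
Proof.
have proj k (f : nrv k -> V) p : vb_cochain VV f -> composable p -> vproj (f p) = first_arrow p.
  exact: vb_cochain_proj.
split=> //=.
- by move=> k f g p cf cg cp; rewrite vaddC // !proj.
- by move=> k f g h p cf cg ch cp; rewrite vaddA // !proj.
- by move=> k f p cf cp; rewrite vadd0 // proj.
- by move=> k f p cf cp; rewrite (@vaddN _ _ _ _ _ _ (first_arrow p)) // proj.
- by move=> k t f g p cf cg cp; rewrite vscaleDr // !proj.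
- exact: vb_cochain_agree.
- exact: vb_cochain0.
- exact: vb_cochainD.
- exact: vb_cochainZ.
- exact: vb_cochain_diff.
- exact: vb_diff_agree.
- by move=> k f g p; exact: vb_diffD.
- by move=> k t f p; exact: vb_diffZ.
Qed.

(** Smoothness is inherited from the VB-differential of [r f], from which the
    differential is recovered by division by zeros. *)
Lemma kdiff_cochain k (f : nrv k -> V) : kcochain f -> kcochain (kdiff f).
Proof.
move=> kf; split=> [p cp|]; first exact: kdiff_in.
have [t Et] := kdiff_r VV k; have Cr := vb_cochain_diff (r_cochain kf).
have ck p (cp : composable p) := in_ker_core (kdiff_in kf cp).
apply: (@nerve_smooth_eq _ _ _ _ _ _ _ _ _ (fun p =>
  vscale t (vb_diff VV (r f) p) · inv (0_(first_arrow p)))) => [p cp|].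
  by rewrite -Et // /r_map gmulK //; exact: core_mul0_comp (ck p cp) _.
apply: nerve_smooth_gmul.
- by move=> p cp; rewrite -Et // /r_map (src_mul0 (ck p cp)) // tgt_inv src0.
- by apply: nerve_smooth_vscale; exact: vb_cochain_smooth Cr.
- apply: nerve_smooth_ginv; apply: nerve_smooth_vzero; exact: nerve_smooth_first_arrow.
Qed.

Lemma kdiff_agree k (f f' : nrv k -> V) : (forall p, composable p -> f p = f' p) ->
  forall p, composable p -> kdiff f p = kdiff f' p.
Proof.
move=> ff' p cp; rewrite /rep_diff ff'; last exact: composable_face.
rewrite big_nat [in RHS]big_nat; congr (radd _ _); apply: eq_bigr => i /andP[i0 ik].
by rewrite ff' //; exact: composable_face.
Qed.

Lemma kdiffD k (f f' : nrv k -> V) p : kcochain f -> kcochain f' -> composable p ->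
  kdiff (fun q => vadd (f q) (f' q)) p = vadd (kdiff f p) (kdiff f' p).
Proof.
move=> kf kf' cp; have kff := kcochainD kf kf'; have [t Et] := kdiff_r VV k.
have [kd kd'] := (kdiff_in kf cp, kdiff_in kf' cp).
have tp : tgt (first_arrow p) = base p by [].
apply: (r_inj_at (kdiff_in kff cp) (in_kerD kd kd') tp).
rewrite (mul0D (in_ker_core kd) (in_ker_core kd') tp) -!/(r_map VV _ _) !Et //.
have -> : vb_diff VV (r (fun q => vadd (f q) (f' q))) p =
    vb_diff VV (fun q => vadd (r f q) (r f' q)) p.
  by apply: vb_diff_agree cp => q cq; exact: rD.
rewrite vb_diffD //; [|exact: r_cochain|exact: r_cochain].
have pd c (kh : kcochain c) := vb_cochain_proj (vb_cochain_diff (r_cochain kh)) cp.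
by rewrite vscaleDr // !pd.
Qed.

Lemma kdiffZ k s (f : nrv k -> V) p : kcochain f -> composable p ->
  kdiff (fun q => vscale s (f q)) p = vscale s (kdiff f p).
Proof.
move=> kf cp; have ksf := kcochainZ s kf; have [t Et] := kdiff_r VV k.
have kd := kdiff_in kf cp; have tp : tgt (first_arrow p) = base p by [].
apply: (r_inj_at (kdiff_in ksf cp) (in_kerZ s kd) tp).
rewrite (mul0Z s (in_ker_core kd) tp) -!/(r_map VV _ _) !Et //.
have -> : vb_diff VV (r (fun q => vscale s (f q))) p = vb_diff VV (fun q => vscale s (r f q)) p.
  by apply: vb_diff_agree cp => q cq; exact: rZ.
rewrite vb_diffZ //; last exact: r_cochain.
by rewrite !vscaleA mulrC.
Qed.

Lemma ker_laws : complex_laws GG (ker_complex VV).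
Proof.
have proj k (f : nrv k -> V) p : kcochain f -> composable p -> vproj (f p) = gone GG (base p).
  by move=> kf cp; exact: core_proj (in_ker_core (kcochain_in kf cp)).
split.
- by move=> k f g p cf cg cp; apply: vaddC; rewrite !proj.
- by move=> k f g h p cf cg ch cp; apply: vaddA; rewrite !proj.
- by move=> k f p cf cp; apply: vadd0; rewrite proj.
- by move=> k f p cf cp; apply: vaddN; rewrite proj.
- by move=> k t f g p cf cg cp; apply: vscaleDr; rewrite !proj.
- exact: kcochain_agree.
- exact: kcochain0.
- exact: kcochainD.
- exact: kcochainZ.
- exact: kdiff_cochain.
- exact: kdiff_agree.
- by move=> k f g p; exact: kdiffD.
- by move=> k t f p; exact: kdiffZ.
Qed.

Lemma vbc_sourceD k (c c' : nrv k.+1 -> V) q : vb_cochain VV c -> vb_cochain VV c' -> composable q ->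
  vbc_source VV (fun p => vadd (c p) (c' p)) q = vadd (vbc_source VV c q) (vbc_source VV c' q).
Proof.
move=> Cc Cc' cq; have cd := composable_degen cq.
by rewrite /vbc_source srcD // (vb_cochain_proj Cc cd) (vb_cochain_proj Cc' cd).
Qed.

Lemma vbc_sourceZ k t (c : nrv k.+1 -> V) q :
  vbc_source VV (fun p => vscale t (c p)) q = vscale t (vbc_source VV c q).
Proof. exact: srcZ. Qed.

Lemma piD k (c c' : nrv k.+1 -> V) q : vb_cochain VV c -> vb_cochain VV c' -> composable q ->
  pi (fun p => vadd (c p) (c' p)) q = qadd (pi c q) (pi c' q).
Proof.
move=> Cc Cc' cq; rewrite !pi_mapE //; last exact: vb_cochainD.
by rewrite coker_add ?vbc_sourceD // !vbc_source_proj.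
Qed.

Lemma piZ k t (c : nrv k.+1 -> V) q : vb_cochain VV c -> composable q ->
  pi (fun p => vscale t (c p)) q = qscale t (pi c q).
Proof.
by move=> Cc cq; rewrite !pi_mapE ?coker_scale ?vbc_sourceZ //; exact: vb_cochainZ.
Qed.

Lemma pi_agree k (c c' : nrv k.+1 -> V) : vb_cochain VV c -> vb_cochain VV c' ->
  (forall p, composable p -> c p = c' p) -> forall q, composable q -> pi c q = pi c' q.
Proof.
by move=> Cc Cc' cc' q cq; rewrite !pi_mapE // /vbc_source cc' //; exact: composable_degen.
Qed.

Lemma qcochain_agree k (f f' : nrv k -> set E) : (forall p, composable p -> f p = f' p) ->
  qcochain f -> qcochain f'.
Proof.
move=> ff' [qf sf]; split=> [p cp|p cp]; first by rewrite -ff' //; exact: qf.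
have [N [h [oN Np sh hP]]] := sf p cp; exists N, h; split=> // q cq Nq.
by have [ph Eh] := hP q cq Nq; rewrite -ff'.
Qed.

Lemma qdiff_agree k (f f' : nrv k -> set E) : (forall p, composable p -> f p = f' p) ->
  forall p, composable p -> qdiff f p = qdiff f' p.
Proof.
move=> ff' p cp; rewrite /rep_diff ff'; last exact: composable_face.
rewrite big_nat [in RHS]big_nat; congr (radd _ _); apply: eq_bigr => i /andP[i0 ik].
by rewrite ff' //; exact: composable_face.
Qed.

(** In positive degree [pi] anticommutes with the differentials. *)
Lemma qdiff_pi_vb_diff k (c : nrv k.+1 -> V) p : vb_cochain VV c -> composable p ->
  qdiff (pi c) p = qscale (-1) (pi (vb_diff VV c) p).
Proof.
move=> Cc cp; rewrite qdiff_pi // pi_vb_diff // coker_scale vscaleA.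
by rewrite mulrNN mulr1 vscale1.
Qed.

Lemma qdiff_cochain k (f : nrv k -> set E) : qcochain f -> qcochain (qdiff f).
Proof.
move=> /pi_preimage[c Cc cf]; have Cd := vb_cochainZ (-1) (vb_cochain_diff Cc).
apply: qcochain_agree (pi_cochain Cd) => p cp.
rewrite piZ //; last exact: vb_cochain_diff.
by rewrite -qdiff_pi_vb_diff //; exact: qdiff_agree.
Qed.

Lemma qcochainD k (f f' : nrv k -> set E) : qcochain f -> qcochain f' ->
  qcochain (fun q => qadd (f q) (f' q)).
Proof.
move=> /pi_preimage[c Cc cf] /pi_preimage[c' Cc' cf'].
apply: qcochain_agree (pi_cochain (vb_cochainD Cc Cc')) => q cq.
by rewrite piD // cf // cf'.
Qed.

Lemma qcochainZ k t (f : nrv k -> set E) : qcochain f -> qcochain (fun q => qscale t (f q)).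
Proof.
move=> /pi_preimage[c Cc cf]; apply: qcochain_agree (pi_cochain (vb_cochainZ t Cc)) => q cq.
by rewrite piZ // cf.
Qed.

Lemma pi0 k (q : nrv k) : composable q -> pi (fun p => 0_(first_arrow p)) q = qzero (base q).
Proof.
move=> cq; rewrite pi_mapE //; last exact: vb_cochain0.
by rewrite /vbc_source src0 first_arrow_degen gsrc_one.
Qed.

Lemma qcochain0 k : qcochain (fun q : nrv k => qzero (base q)).
Proof. by apply: qcochain_agree (pi_cochain (vb_cochain0 VV k.+1)) => q cq; exact: pi0. Qed.

Lemma qdiffD k (f g : nrv k -> set E) p : qcochain f -> qcochain g -> composable p ->
  qdiff (fun q => qadd (f q) (g q)) p = qadd (qdiff f p) (qdiff g p).
Proof.
move=> /pi_preimage[c Cc cf] /pi_preimage[c' Cc' cg] cp.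
have Cd := vb_cochain_diff Cc; have Cd' := vb_cochain_diff Cc'.
rewrite -(qdiff_agree cf cp) -(qdiff_agree cg cp).
rewrite -(@qdiff_agree _ (pi (fun p => vadd (c p) (c' p)))) //; last first.
  by move=> q cq; rewrite piD // cf // cg.
rewrite !qdiff_pi_vb_diff //; last exact: vb_cochainD.
rewrite -!piZ //; last exact/vb_cochain_diff/vb_cochainD.
rewrite -[RHS]piD //; [|exact: vb_cochainZ|exact: vb_cochainZ].
apply: pi_agree cp.
- exact/vb_cochainZ/vb_cochain_diff/vb_cochainD.
- by apply: vb_cochainD; exact: vb_cochainZ.
- move=> q cq; rewrite vb_diffD // vscaleDr //.
  by rewrite (vb_cochain_proj Cd cq) (vb_cochain_proj Cd' cq).
Qed.

Lemma qdiffZ k t (f : nrv k -> set E) p : qcochain f -> composable p ->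
  qdiff (fun q => qscale t (f q)) p = qscale t (qdiff f p).
Proof.
move=> /pi_preimage[c Cc cf] cp; have Cd := vb_cochain_diff Cc.
rewrite -(qdiff_agree cf cp).
rewrite -(@qdiff_agree _ (pi (fun p => vscale t (c p)))) //; last first.
  by move=> q cq; rewrite piZ // cf.
rewrite !qdiff_pi_vb_diff //; last exact: vb_cochainZ.
rewrite -!piZ //; [|exact: vb_cochainZ|exact/vb_cochain_diff/vb_cochainZ].
apply: pi_agree cp.
- exact/vb_cochainZ/vb_cochain_diff/vb_cochainZ.
- by apply: vb_cochainZ; exact: vb_cochainZ.
- by move=> q cq; rewrite vb_diffZ // !vscaleA mulrC.
Qed.

Lemma coker_laws : complex_laws GG (coker_complex VV).
Proof.
have lift k (f : nrv k -> set E) p : qcochain f -> composable p ->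
    exists2 e, vproj e = base p & f p = coker_class VV e.
  by move=> [qf _] cp; have [e pe <-] := qf p cp; exists e.
have addE e e' : vproj e = vproj e' -> @cadd _ _ _ _ _ (coker_complex VV)
    (coker_class VV e) (coker_class VV e') = coker_class VV (vadd e e').
  exact: coker_add.
have scaleE s e : @cscale _ _ _ _ _ (coker_complex VV) s (coker_class VV e) =
    coker_class VV (vscale s e).
  exact: coker_scale.
have zeroE k (p : nrv k) : czero (coker_complex VV) p = qzero (base p) by [].
split.
- move=> k f g p cf cg cp; have [e pe Ee] := lift _ _ _ cf cp; have [e' pe' Ee'] := lift _ _ _ cg cp.
  by rewrite Ee Ee' !addE ?pe ?pe' // vaddC // pe.
- move=> k f g h p cf cg ch cp; have [e pe Ee] := lift _ _ _ cf cp.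
  have [e' pe' Ee'] := lift _ _ _ cg cp; have [u pu Eu] := lift _ _ _ ch cp.
  rewrite Ee Ee' Eu !addE ?vproj_add ?pe ?pe' ?pu //.
  by rewrite vaddA ?pe ?pe' ?pu.
- move=> k f p cf cp; have [e pe Ee] := lift _ _ _ cf cp.
  by rewrite Ee ?zeroE addE ?vproj_zero // vadd0.
- move=> k f p cf cp; have [e pe Ee] := lift _ _ _ cf cp.
  by rewrite Ee ?zeroE scaleE addE ?vproj_scale // (vaddN pe).
- move=> k t f g p cf cg cp; have [e pe Ee] := lift _ _ _ cf cp; have [e' pe' Ee'] := lift _ _ _ cg cp.
  rewrite Ee Ee' ?zeroE addE ?pe ?pe' // !scaleE addE ?vproj_scale ?pe ?pe' //.
  by rewrite vscaleDr // pe.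
- exact: qcochain_agree.
- exact: qcochain0.
- exact: qcochainD.
- exact: qcochainZ.
- exact: qdiff_cochain.
- exact: qdiff_agree.
- by move=> k f g p; exact: qdiffD.
- by move=> k t f p; exact: qdiffZ.
Qed.

(** * Cochains with source in the image of the anchor *)

Lemma diff_source_zero k (w : nrv k.+1 -> V) q : vb_cochain VV w ->
  (forall p, composable p -> S (w p) = vzero E (src (first_arrow p))) ->
  composable q -> diff_source VV w q = T (w q).
Proof.
move=> Cw Sw cq; rewrite /diff_source big_nat.
have -> : \big[@vadd _ _ _ _ E/vzero E (base q)]_(1 <= i < k.+2 | (1 <= i < k.+2)%N)
    vscale ((-1) ^+ i) (vbc_source VV w (face i q)) = vzero E (base q).
  elim/big_ind: _ => // [x y -> ->|i /andP[i0 ik]]; first by rewrite vadd0 // vproj_zero.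
  have cf : composable (face i q) by exact: composable_face.
  rewrite /vbc_source Sw; last exact: composable_degen.
  by rewrite first_arrow_degen gsrc_one base_face // vscale_zero.
by rewrite vadd0 // proj_tgt (vb_cochain_proj Cw cq).
Qed.

(** The difference [w] of [c] and the coboundary has zero source, and so has its
    own coboundary, whose source is minus the target of [w]; so [r_preimage]
    applies. *)
Lemma split_coboundary k (c : nrv k.+1 -> V) (h : nrv k -> V) :
  vb_cochain VV c -> vb_cochain VV h ->
  (forall p, composable p -> S (vb_diff VV h p) = S (c p)) ->
  (forall p, composable p -> S (vb_diff VV c p) = vzero E (src (first_arrow p))) ->
  exists2 z : nrv k.+1 -> V, kcochain z &
    forall p, composable p -> c p = vadd (r z p) (vb_diff VV h p).
Proof.
move=> Cc Ch Sh Sd; have Cd := vb_cochain_diff Ch; have Cd' := vb_cochainZ (-1) Cd.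
pose w (p : nrv k.+1) := vadd (c p) (vscale (-1) (vb_diff VV h p)).
have Cw : vb_cochain VV w by exact: vb_cochainD.
have Sw p : composable p -> S (w p) = vzero E (src (first_arrow p)).
  move=> cp; have pc := vb_cochain_proj Cc cp; have pd := vb_cochain_proj Cd cp.
  by rewrite /w srcD ?vproj_scale ?pc ?pd // srcZ Sh // (@vaddN _ _ _ _ _ _ (src (first_arrow p))) //
    proj_src pc.
have Tw p : composable p -> T (w p) = vzero E (base p).
  move=> cp; have cd := composable_degen cp.
  have : S (vb_diff VV w (degen p)) = vzero E (base p).
    have pd : vproj (vb_diff VV c (degen p)) = gone GG (base p).
      by rewrite (vb_cochain_proj (vb_cochain_diff Cc) cd) first_arrow_degen.
    rewrite /w vb_diffD // vb_diffZ // vb_diff_diff // vscale_zero first_arrow_degen.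
    by rewrite vadd0 // Sd // first_arrow_degen gsrc_one.
  rewrite (src_vb_diff Cw) // face0_degen (diff_source_zero Cw Sw cp) => T0.
  have : vscale (-1) (vscale (-1) (T (w p))) = vzero E (base p) by rewrite T0 vscale_zero.
  by rewrite vscaleA mulrNN mulr1 vscale1.
have [z kz Ez] := r_preimage Cw Sw Tw.
exists z => // p cp; rewrite Ez // /w.
have := vb_cochain_proj Cc cp; have := vb_cochain_proj Cd cp.
by move: (c p) (vb_diff VV h p) => x y py px; fibre (first_arrow p).
Qed.

(** Here the correcting cochain can be taken with zero source, so that
    subtracting it changes no class under [pi]. *)
Lemma split_anchor_succ k (c : nrv k.+2 -> V) : regular VV -> vb_cochain VV c ->
  (forall q, composable q -> image_anchor VV (base q) (vbc_source VV c q)) ->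
  (forall p, composable p -> S (vb_diff VV c p) = vzero E (src (first_arrow p))) ->
  exists (h : nrv k.+1 -> V) (z : nrv k.+2 -> V), [/\ vb_cochain VV h, kcochain z,
    forall p, composable p -> S (h p) = vzero E (src (first_arrow p)) &
    forall p : nrv k.+2, composable p -> c p = vadd (r z p) (vb_diff VV h p)].
Proof.
move=> reg Cc ic Sd.
have [h sh hP] := lift_anchor reg (vbc_source_smooth Cc) ic.
(* The source of the coboundary of h' is minus the target of h', whence the
   sign. *)
pose h' (q : nrv k.+1) := vscale (-1) (h q) · 0_(first_arrow q).
have ch q (cq : composable q) : core VV (base q) (vscale (-1) (h q)).
  by have [ch _] := hP q cq; exact: coreZ.
have Sh q : composable q -> S (h' q) = vzero E (src (first_arrow q)).
  by move=> cq; exact: src_mul0 (ch q cq) _.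
have Ch : vb_cochain VV h'.
  split=> [q cq|p q cp cq pq|]; first exact: core_mul0_proj (ch q cq) _.
    by rewrite !Sh // !src_first_arrow // pq.
  apply: nerve_smooth_gmul.
  - by move=> q cq; exact: core_mul0_comp (ch q cq) _.
  - exact: nerve_smooth_vscale.
  - apply: nerve_smooth_vzero; exact: nerve_smooth_first_arrow.
have [z kz Ez] : exists2 z : nrv k.+2 -> V, kcochain z &
    forall p, composable p -> c p = vadd (r z p) (vb_diff VV h' p).
  apply: split_coboundary => // p cp.
  have cf : composable (face 0 p) by exact: composable_face.
  rewrite (src_vb_diff Ch) // (diff_source_zero Ch Sh cf) /h'.
  rewrite (tgt_mul0 (ch _ cf)) // tgtZ vscaleA mulrNN mulr1 vscale1.
  by have [_ ->] := hP _ cf; rewrite (vbc_sourceE Cc).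
by exists h', z.
Qed.

(** In degree 1 the correcting cochain is the lift to the core itself: in degree 0
    the source of the coboundary of [h] is the anchor of [h]. *)
Lemma split_anchor k (c : nrv k.+1 -> V) : regular VV -> vb_cochain VV c ->
  (forall q, composable q -> image_anchor VV (base q) (vbc_source VV c q)) ->
  (forall p, composable p -> S (vb_diff VV c p) = vzero E (src (first_arrow p))) ->
  exists (h : nrv k -> V) (z : nrv k.+1 -> V), [/\ vb_cochain VV h, kcochain z &
    forall p : nrv k.+1, composable p -> c p = vadd (r z p) (vb_diff VV h p)].
Proof.
case: k c => [|k] c reg Cc ic Sd; last first.
  by have [h [z [Ch kz _ Ez]]] := split_anchor_succ reg Cc ic Sd; exists h, z.
have [h sh hP] := lift_anchor reg (vbc_source_smooth Cc) ic.
have Ch : vb_cochain VV h.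
  by split=> // x; have [] := hP x I; rewrite base0.
have [|z kz Ez] := split_coboundary Cc Ch _ Sd; last by exists h, z.
move=> p cp; rewrite (src_vb_diff0 Ch) (vbc_sourceE Cc) //.
have cf : composable (face 0 p) by exact: composable_face.
by have [_ <-] := hP _ cf.
Qed.

End ThreeComplexes.

(** * The long exact sequence *)

Section LongExactSequence.
Context {R : realType} {n d a b : nat} {M : manifold R n} {G : manifold R d}
        {GG : lie_groupoid M G} {E : vbundle M a} {V : vbundle G b}.
Variable VV : vb_groupoid GG E V.
Local Notation src := (gsrc GG).
Local Notation tgt := (gtgt GG).
Local Notation S := (gsrc VV).
Local Notation T := (gtgt VV).
Local Notation inv := (ginv VV).
Local Notation "v · w" := (gmul VV v w) (at level 40, left associativity).
Local Notation "0_ g" := (vzero V g) (at level 8, format "0_ g").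
Local Notation nrv k := (@nerve _ _ _ M G k).
Local Notation face := (face GG).
Local Notation composable := (composable GG).
Local Notation base := (base GG).
Local Notation first_arrow := (first_arrow GG).
Local Notation degen := (degen GG).

Implicit Types (v w : V) (e : E) (g h : G) (x : M) (k : nat).

Local Notation r := (@r_map _ _ _ _ _ GG _ _ _ _ VV _).
Local Notation pi := (pi_map VV).
Local Notation kcochain := (@cochain _ _ _ _ _ (ker_complex VV) _).
Local Notation kdiff := (@rep_diff _ _ _ _ _ GG (ker_rep VV)).
Local Notation qcochain := (@cochain _ _ _ _ _ (coker_complex VV) _).
Local Notation qdiff := (@rep_diff _ _ _ _ _ GG (coker_rep VV)).
Local Notation qadd := (@radd _ _ _ _ _ (coker_rep VV)).
Local Notation qscale := (@rscale _ _ _ _ _ (coker_rep VV)).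
Local Notation qzero x := (coker_class VV (vzero E x)).
Local Notation kcocycle := (@cocycle _ _ _ _ _ GG (ker_complex VV) _).
Local Notation vcocycle := (@cocycle _ _ _ _ _ GG (vb_complex VV) _).
Local Notation qcocycle := (@cocycle _ _ _ _ _ GG (coker_complex VV) _).
Local Notation kclass := (@cclass _ _ _ _ _ GG (ker_complex VV) _).
Local Notation vclass := (@cclass _ _ _ _ _ GG (vb_complex VV) _).
Local Notation qclass := (@cclass _ _ _ _ _ GG (coker_complex VV) _).
Local Notation Lk := (ker_laws VV).
Local Notation Lv := (vb_laws VV).
Local Notation Lq := (coker_laws VV).

Lemma r_inj k (u v : nrv k -> V) p : kcochain u -> kcochain v -> composable p ->
  r u p = r v p -> u p = v p.
Proof. by move=> ku kv cp; exact: r_inj_at (kcochain_in ku cp) (kcochain_in kv cp) (erefl _). Qed.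

Lemma r_zero k (p : nrv k) : r (fun q => 0_(gone GG (base q))) p = 0_(first_arrow p).
Proof. by rewrite /r_map mul0 ?gsrc_one // gmul1g. Qed.

Lemma r_cocycle_inv k (u : nrv k -> V) : kcochain u ->
  (forall p, composable p -> vb_diff VV (r u) p = 0_(first_arrow p)) -> kcocycle u.
Proof.
move=> ku du; split=> // p cp; have k0 := kcochain0 VV k.
have <- := diff0 Lk cp; apply: (kdiff_eq_r ku k0 cp); rewrite du //.
rewrite -[LHS](diff0 Lv cp).
by apply: vb_diff_agree cp => q _; rewrite r_zero.
Qed.

Lemma r_cocycle k (u : nrv k -> V) p : kcocycle u -> composable p ->
  vb_diff VV (r u) p = 0_(first_arrow p).
Proof.
case: k u p => [|k] u p [ku du] cp.
  rewrite r_diff0 // -[RHS](vscale_zero V (-1)) -r_zero /r_map.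
  by congr (vscale _ (gmul VV _ _)); exact: du.
by rewrite r_diff // -r_zero /r_map; congr (gmul VV _ _); exact: du.
Qed.

Lemma r_cochain_map k : cochain_map GG (C := ker_complex VV) (D := vb_complex VV) (r_map VV (k := k)).
Proof.
split=> [u v ku kv uv p cp|u ku|u v ku kv p cp|t u ku p cp|u zu|u].
- by rewrite /r_map uv.
- exact: r_cochain.
- exact: rD.
- exact: rZ.
- split; [exact: r_cochain (cocycle_cochain zu)|by move=> p; exact: r_cocycle].
case: k u => [u /cobound_deg0 u0|k u /coboundS[z kz uz]].
  by apply/cobound_deg0 => p cp; rewrite -[RHS]r_zero /r_map u0.
have [t Et] := kdiff_r VV k; apply/coboundS.
exists (fun q => vscale t (r z q)); first exact/vb_cochainZ/r_cochain.
move=> p cp; rewrite -[RHS]/(vb_diff VV _ p) vb_diffZ //; last exact: r_cochain.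
by rewrite -Et // /r_map uz.
Qed.

Lemma pi_r k (u : nrv k.+1 -> V) q : kcochain u -> composable q -> pi (r u) q = qzero (base q).
Proof.
move=> ku cq; rewrite pi_mapE //; last exact: r_cochain.
by rewrite /vbc_source r_src //; [rewrite first_arrow_degen gsrc_one|exact: composable_degen].
Qed.

Lemma qscale0 t x : qscale t (qzero x) = qzero x.
Proof. by rewrite coker_scale vscale_zero. Qed.

Lemma pi_cochain_map k :
  cochain_map GG (C := vb_complex VV) (D := coker_complex VV) (pi_map VV (k := k)).
Proof.
split=> [u v Cu Cv uv p cp|u Cu|u v Cu Cv p cp|t u Cu p cp|u [Cu du]|u].
- exact: pi_agree.
- exact: pi_cochain.
- exact: piD.
- exact: piZ.
- split=> [|p cp]; first exact: pi_cochain.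
  rewrite -[LHS]/(qdiff _ _) qdiff_pi_vb_diff // -[RHS](qscale0 (-1)) -(pi0 VV cp).
  by congr qscale; apply: pi_agree cp => //; [exact: vb_cochain_diff|exact: vb_cochain0].
case: k u => [|k] u /coboundS[h Ch uh].
  apply/cobound_deg0 => q cq; rewrite -[RHS](pi_vb_diff0 Ch) //.
  apply: pi_agree cq => //; last exact: vb_cochain_diff.
  by apply: vb_cochain_agree (vb_cochain_diff Ch) => p cp; rewrite uh.
apply/coboundS; exists (fun q => qscale (-1) (pi h q)); first by apply: qcochainZ; exact: pi_cochain.
move=> q cq; rewrite -[RHS]/(qdiff _ _) qdiffZ //; last exact: pi_cochain.
rewrite qdiff_pi // coker_scale -pi_vb_diff //.
apply: pi_agree cq => //; last exact: vb_cochain_diff.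
by apply: vb_cochain_agree (vb_cochain_diff Ch) => p cp; rewrite uh.
Qed.

Lemma pi_zero_anchor k (c : nrv k.+1 -> V) q : vb_cochain VV c -> composable q ->
  pi c q = qzero (base q) -> image_anchor VV (base q) (vbc_source VV c q).
Proof.
move=> Cc cq; rewrite pi_mapE //.
have <- := vbc_source_proj Cc cq.
by move=> E0; apply/coker_class0P.
Qed.

(** If [pi c] is the differential of f = pi h0, adding the coboundary of [h0] to
    [c] makes [pi c] vanish, as [pi] anticommutes with the differentials. *)
Lemma split_cobound k (c : nrv k.+1 -> V) : regular VV -> vb_cochain VV c ->
  cobound GG (C := coker_complex VV) (pi c) ->
  (forall p, composable p -> S (vb_diff VV c p) = vzero E (src (first_arrow p))) ->
  exists (h : nrv k -> V) (z : nrv k.+1 -> V), [/\ vb_cochain VV h, kcochain z &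
    forall p : nrv k.+1, composable p -> c p = vadd (r z p) (vb_diff VV h p)].
Proof.
move=> reg Cc bc Sd.
have [h0 Ch0 E0] : exists2 h0 : nrv k -> V, vb_cochain VV h0 &
    forall q, composable q -> pi (fun p => vadd (c p) (vb_diff VV h0 p)) q = qzero (base q).
  case: k c Cc bc Sd => [|k] c Cc bc Sd.
    exists (fun q => 0_(first_arrow q)); first exact: vb_cochain0.
    have C0 := vb_cochain_diff (vb_cochain0 VV 0).
    move/cobound_deg0 : bc => c0 q cq; rewrite piD // c0 // (pi_vb_diff0 (vb_cochain0 VV 0)) //.
    exact: (claw_add0 Lq (claw_0 Lq 0) cq).
  move/coboundS : bc => [f /pi_preimage[h Ch hf] cf].
  exists h => // q cq; have Cd := vb_cochain_diff Ch.
  have qd := qdiff_cochain (pi_cochain Ch).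
  rewrite piD // cf // -[cdiff f q]/(qdiff f q) -(qdiff_agree VV hf cq).
  by rewrite pi_vb_diff // -coker_scale -qdiff_pi //; exact: (claw_opp Lq qd cq).
pose c1 (p : nrv k.+1) := vadd (c p) (vb_diff VV h0 p).
have Cd := vb_cochain_diff Ch0; have C1 : vb_cochain VV c1 by exact: vb_cochainD.
have [||h [z [Ch kz Ez]]] := split_anchor reg C1.
- by move=> q cq; apply: pi_zero_anchor => //; exact: E0.
- move=> p cp; rewrite vb_diffD // vb_diff_diff // vadd0 ?Sd //.
  exact: vb_cochain_proj (vb_cochain_diff Cc) cp.
have Ch1 : vb_cochain VV (fun q => vadd (h q) (vscale (-1) (h0 q))).
  by apply: vb_cochainD => //; exact: vb_cochainZ.
exists (fun q => vadd (h q) (vscale (-1) (h0 q))), z; split=> // p cp.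
rewrite vb_diffD //; last exact: vb_cochainZ.
rewrite vb_diffZ //.
have := Ez p cp; rewrite /c1.
have := vb_cochain_proj Cc cp; have := vb_cochain_proj Cd cp.
have := vb_cochain_proj (vb_cochain_diff Ch) cp; have := r_proj kz cp.
move: (c p) (vb_diff VV h0 p) (vb_diff VV h p) (r z p) => x y u w pw pu py px Exy.
have -> : x = vadd (vadd x y) (vscale (-1) y) by fibre (first_arrow p).
by rewrite Exy; fibre (first_arrow p).
Qed.

(** The relation defined by all lifts of all representatives: no choice is
    involved, and [connecting_class] says that it is a single class. *)
Definition connecting k (A : classes (coker_complex VV) k) : classes (ker_complex VV) k.+2 :=
  [set u | kcocycle u /\ exists c : nrv k.+1 -> V,
    [/\ vb_cochain VV c, A (pi c) & forall p, composable p -> vb_diff VV c p = r u p]].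

(** Any preimage of [f] under [pi] has a coboundary with source in the image of
    the anchor; subtracting from the preimage the cochain of [split_anchor_succ]
    keeps its image under [pi]. *)
Lemma lift_cocycle k (f : nrv k -> set E) : regular VV -> qcocycle f ->
  exists (c : nrv k.+1 -> V) (u : nrv k.+2 -> V),
    [/\ vb_cochain VV c, kcocycle u, forall q, composable q -> pi c q = f q &
        forall p : nrv k.+2, composable p -> vb_diff VV c p = r u p].
Proof.
move=> reg [/pi_preimage[c Cc cf] df]; have Cd := vb_cochain_diff Cc.
have [||h [z [Ch kz Sh Ez]]] := split_anchor_succ reg Cd.
- move=> q cq; apply: pi_zero_anchor => //.
  rewrite pi_vb_diff // -coker_scale -qdiff_pi // -[RHS](qscale0 (-1)); congr qscale.
  by rewrite (qdiff_agree VV cf cq); exact: df.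
- by move=> p cp; rewrite vb_diff_diff // src0.
have CN := vb_cochainZ (-1) Ch; have CD := vb_cochainD Cc CN.
have Er p : composable p -> vb_diff VV (fun q => vadd (c q) (vscale (-1) (h q))) p = r z p.
  move=> cp; rewrite vb_diffD // vb_diffZ // Ez //.
  have := vb_cochain_proj (vb_cochain_diff Ch) cp; have := r_proj kz cp.
  by move: (r z p) (vb_diff VV h p) => x y px py; fibre (first_arrow p).
exists (fun q => vadd (c q) (vscale (-1) (h q))), z; split=> //.
  apply: r_cocycle_inv => // p cp; rewrite -(vb_diff_diff CD cp).
  by apply: vb_diff_agree cp => q cq; rewrite Er.
move=> q cq; rewrite piD // -cf // piZ //.
have -> : pi h q = qzero (base q).
  rewrite pi_mapE // /vbc_source Sh ?first_arrow_degen ?gsrc_one //; exact: composable_degen.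
by rewrite qscale0; exact: (claw_add0 Lq (pi_cochain Cc) cq).
Qed.

(** Two lifts differ by a cochain to which [split_cobound] applies, so that the
    cocycles that they give differ by the differential of a kernel cochain.
    Conversely, adding [r z] to [c] adds the differential of [z] to [u]. *)
Lemma connecting_class k (f : nrv k -> set E) (c : nrv k.+1 -> V) (u : nrv k.+2 -> V) :
  regular VV -> qcocycle f -> vb_cochain VV c -> kcocycle u ->
  (forall q, composable q -> pi c q = f q) ->
  (forall p, composable p -> vb_diff VV c p = r u p) ->
  connecting (qclass f) = kclass u.
Proof.
move=> reg zf Cc zu cf cu; have ku := cocycle_cochain zu.
apply/seteqP; split=> u' [zu' Hu']; split=> //; have ku' := cocycle_cochain zu'.
  have [c' [Cc' [zc' ch] Ec']] := Hu'.
  have CN := vb_cochainZ (-1) Cc; have CD := vb_cochainD Cc' CN.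
  pose e (p : nrv k.+1) := vadd (c' p) (vscale (-1) (c p)).
  have Ee p : composable p -> vb_diff VV e p = vadd (r u' p) (vscale (-1) (r u p)).
    by move=> cp; rewrite vb_diffD // vb_diffZ // Ec' // cu.
  have [||h' [z [Ch' kz Ez]]] := split_cobound reg (CD : vb_cochain VV e).
  - apply: cobound_agree (cohomologous_sub Lq (cocycle_cochain zf) ch) => q cq.
    by rewrite piD // piZ // cf.
  - move=> p cp; rewrite Ee // srcD ?vproj_scale ?r_proj // srcZ !r_src //.
    by rewrite vscale_zero vadd0 // vproj_zero.
  apply/cohomologousP; exists (kdiff z); first exact: cobound_diff.
  move=> p cp; apply: (r_inj ku' (kcochainD ku (kdiff_cochain kz)) cp).
  rewrite rD //; last exact: kdiff_cochain.
  rewrite -r_diff //.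
  have <- : vb_diff VV e p = vb_diff VV (r z) p.
    rewrite (vb_diff_agree VV Ez cp) vb_diffD //; [|exact: r_cochain|exact: vb_cochain_diff].
    rewrite vb_diff_diff // vadd0 //.
    exact: vb_cochain_proj (vb_cochain_diff (r_cochain kz)) cp.
  rewrite Ee //; have := r_proj ku cp; have := r_proj ku' cp.
  by move: (r u p) (r u' p) => x y py px; fibre (first_arrow p).
move/cohomologousP : Hu' => [h /coboundS[z kz hz] Eh].
have Cr := r_cochain kz; have CD := vb_cochainD Cc Cr.
have Ep q : composable q -> pi (fun p => vadd (c p) (r z p)) q = f q.
  by move=> cq; rewrite piD // cf // pi_r //; exact: (claw_add0 Lq (cocycle_cochain zf) cq).
exists (fun p => vadd (c p) (r z p)); split=> // [|p cp].
  split; first by apply: (cocycle_agree Lq) zf => q cq; rewrite Ep.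
  apply: (agree_cohomologous Lq) => [|q cq]; [exact: (cocycle_cochain zf)|by rewrite Ep].
rewrite vb_diffD // cu // r_diff // -rD //; last exact: kdiff_cochain.
by rewrite /r_map Eh // hz.
Qed.

Lemma connecting_linear k : regular VV -> cohomology_linear GG (connecting (k := k)).
Proof.
move=> reg; split=> [_ [f zf <-]|_ _ [f zf <-] [g zg <-]|t _ [f zf <-]].
- have [c [u [Cc zu cf cu]]] := lift_cocycle reg zf.
  by exists u => //; rewrite (connecting_class reg zf Cc zu cf cu).
- have [c [u [Cc zu cf cu]]] := lift_cocycle reg zf.
  have [c' [u' [Cc' zu' cg cu']]] := lift_cocycle reg zg.
  have [ku ku'] := (cocycle_cochain zu, cocycle_cochain zu').
  rewrite (hadd_cclass Lq) // (connecting_class reg zf Cc zu cf cu).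
  rewrite (connecting_class reg zg Cc' zu' cg cu') (hadd_cclass Lk) //.
  apply: connecting_class reg (cocycleD Lq zf zg) (vb_cochainD Cc Cc') (cocycleD Lk zu zu') _ _.
    by move=> q cq; rewrite piD // cf // cg.
  by move=> p cp; rewrite vb_diffD // cu // cu' // rD.
- have [c [u [Cc zu cf cu]]] := lift_cocycle reg zf.
  have ku := cocycle_cochain zu.
  rewrite (hscale_cclass Lq) // (connecting_class reg zf Cc zu cf cu) (hscale_cclass Lk) //.
  apply: connecting_class reg (cocycleZ Lq t zf) (vb_cochainZ t Cc) (cocycleZ Lk t zu) _ _.
    by move=> q cq; rewrite piZ // cf.
  by move=> p cp; rewrite vb_diffZ // cu // rZ.
Qed.

Lemma Hr_class k (u : nrv k -> V) : kcocycle u -> Hr (kclass u) = vclass (r u).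
Proof. exact: (induced_cclass Lk Lv (r_cochain_map k)). Qed.

Lemma Hpi_class k (c : nrv k.+1 -> V) : vcocycle c -> Hpi (vclass c) = qclass (pi c).
Proof. exact: (induced_cclass Lv Lq (pi_cochain_map k)). Qed.

Lemma vcocycle_src k (c : nrv k -> V) p : vcocycle c -> composable p ->
  S (vb_diff VV c p) = vzero E (src (first_arrow p)).
Proof. by move=> [_ dc] cp; have -> : vb_diff VV c p = 0_(first_arrow p) by [exact: dc]; rewrite src0. Qed.

Lemma vcocycle_r k (c : nrv k.+1 -> V) (h : nrv k -> V) (z : nrv k.+1 -> V) :
  vcocycle c -> vb_cochain VV h -> kcochain z ->
  (forall p, composable p -> c p = vadd (r z p) (vb_diff VV h p)) ->
  kcocycle z /\ Hr (kclass z) = vclass c.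
Proof.
move=> zc Ch kz Ez; have Cz := r_cochain kz; have Cd := vb_cochain_diff Ch.
have zz : kcocycle z.
  apply: r_cocycle_inv => // p cp; have [_ dc] := zc.
  rewrite -[RHS](dc p cp) -[RHS]/(vb_diff VV c p) (vb_diff_agree VV Ez cp) vb_diffD //.
  rewrite vb_diff_diff // vadd0 //; exact: vb_cochain_proj (vb_cochain_diff Cz) cp.
split=> //; rewrite Hr_class //; apply: (cclass_eq Lv) => //.
  exact: (cmap_cocycle (r_cochain_map _)).
by apply/cohomologousP; exists (vb_diff VV h) => //; apply/coboundS; exists h.
Qed.

Lemma exact_VB k : regular VV -> exact_at GG (Hr (VV := VV) (k := k.+1)) (Hpi (VV := VV) (k := k)).
Proof.
move=> reg _ [c zc <-]; have Cc := cocycle_cochain zc.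
have zp : qcocycle (pi c) by exact: (cmap_cocycle (pi_cochain_map k)).
rewrite Hpi_class //; split=> [/(hzero_cobound Lq zp) bc|[_ [z zz <-]]].
  have [|h [z [Ch kz Ez]]] := split_cobound reg Cc bc; first by move=> p; exact: vcocycle_src.
  have [zz Hz] := vcocycle_r zc Ch kz Ez.
  by exists (kclass z) => //; exists z.
rewrite -Hpi_class // => <-; have kz := cocycle_cochain zz.
have zr : vcocycle (r z) by exact: (cmap_cocycle (r_cochain_map _)).
have zp' : qcocycle (pi (r z)) by exact: (cmap_cocycle (pi_cochain_map k)).
rewrite Hr_class // Hpi_class //; apply/(hzero_cobound Lq zp').
by apply: cobound_agree (cobound0 Lq k) => q cq; rewrite pi_r.
Qed.

Lemma exact_coker k : regular VV -> exact_at GG (Hpi (VV := VV) (k := k)) (connecting (k := k)).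
Proof.
move=> reg _ [f zf <-]; have [c [u [Cc zu cf cu]]] := lift_cocycle reg zf.
rewrite (connecting_class reg zf Cc zu cf cu); split.
  move=> /(hzero_cobound Lk zu)/coboundS[z kz uz].
  have Cz := vb_cochainZ (-1) (r_cochain kz); have CD := vb_cochainD Cc Cz.
  pose c' (p : nrv k.+1) := vadd (c p) (vscale (-1) (r z p)).
  have zc' : vcocycle c'.
    split=> // p cp; rewrite -[LHS]/(vb_diff VV c' p) vb_diffD // vb_diffZ //; last exact: r_cochain.
    rewrite cu // r_diff // {1}/r_map uz //.
    exact: vaddN (vb_cochain_proj (r_cochain (kdiff_cochain kz)) cp).
  exists (vclass c'); first by exists c'.
  rewrite Hpi_class //; apply: (cclass_agree Lq) => //.
    exact: (cmap_cocycle (pi_cochain_map k)).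
  move=> q cq; rewrite piD // cf // piZ //; last exact: r_cochain.
  by rewrite pi_r // qscale0; exact: (claw_add0 Lq (cocycle_cochain zf) cq).
move=> [_ [c' zc' <-]]; rewrite Hpi_class // => Ef; have Cc' := cocycle_cochain zc'.
have zp : qcocycle (pi c') by exact: (cmap_cocycle (pi_cochain_map k)).
rewrite -(connecting_class reg zf Cc zu cf cu) -Ef.
apply: (connecting_class reg zp Cc' (cocycle0 Lk _)) => // p cp.
have [_ dc] := zc'; rewrite -[LHS]/(cdiff (c := vb_complex VV) c' p) dc //.
by apply: esym; exact: r_zero.
Qed.

Lemma exact_ker k : regular VV -> exact_at GG (connecting (k := k)) (Hr (VV := VV) (k := k.+2)).
Proof.
move=> reg _ [u zu <-]; have ku := cocycle_cochain zu.
have zr : vcocycle (r u) by exact: (cmap_cocycle (r_cochain_map _)).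
split=> [|[_ [f zf <-]]].
  rewrite Hr_class // => /(hzero_cobound Lv zr)/coboundS[c Cc uc].
  have zp : qcocycle (pi c).
    split=> [|q cq]; first exact: pi_cochain.
    rewrite -[LHS]/(qdiff (pi c) q) qdiff_pi_vb_diff // -[RHS](qscale0 (-1)) -(pi_r ku cq).
    by congr qscale; apply: pi_agree cq => //; [exact: vb_cochain_diff|exact: r_cochain|
      move=> p cp; rewrite uc].
  exists (qclass (pi c)); first by exists (pi c).
  by apply: connecting_class reg zp Cc zu _ _ => // p cp; rewrite uc.
have [c [v [Cc zv cf cv]]] := lift_cocycle reg zf.
rewrite (connecting_class reg zf Cc zv cf cv) => <-.
have zrv : vcocycle (r v) by exact: (cmap_cocycle (r_cochain_map _)).
rewrite Hr_class //; apply/(hzero_cobound Lv zrv)/coboundS.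
by exists c => // p cp; rewrite -[RHS]/(vb_diff VV c p) cv.
Qed.

(** In degree 0 the source of the differential is the anchor. *)
Lemma deg0_ker (h : nrv 0 -> V) : vb_cochain VV h ->
  (forall p, composable p -> S (vb_diff VV h p) = vzero E (src (first_arrow p))) -> kcochain h.
Proof.
move=> Ch Sh; have [ch sh] := Ch; split=> [x cx|//]; rewrite base0; split; first exact: ch.
have := Sh (degen x) (composable_degen cx).
by rewrite (src_vb_diff0 Ch) first_arrow_degen base0 gsrc_one.
Qed.

(** In degree 0 the map [r] is the identity, there are no coboundaries but 0, and
    VB-cocycles lie in the kernel of the anchor by [deg0_ker]. *)
Lemma Hr0_bij : set_bij (@cohomology _ _ _ _ _ GG (ker_complex VV) 0)
  (@cohomology _ _ _ _ _ GG (vb_complex VV) 0) (Hr (VV := VV) (k := 0)).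
Proof.
split.
- by have [] := induced_linear Lk Lv (r_cochain_map 0).
- move=> _ _ /set_mem[u zu <-] /set_mem[v zv <-]; rewrite !Hr_class // => Euv.
  have zr : vcocycle (r v) by exact: (cmap_cocycle (r_cochain_map _)).
  have : vclass (r u) (r v) by rewrite Euv; exact: (cclass_self Lv).
  move=> [_ /cohomologousP[h /cobound_deg0 h0 Eh]].
  have [ku kv] := (cocycle_cochain zu, cocycle_cochain zv).
  apply: (cclass_agree Lk) => // p cp; apply: (r_inj ku kv cp).
  rewrite Eh // h0 //; apply: esym; exact: (claw_add0 Lv (r_cochain ku) cp).
- move=> _ [c zc <-]; have Cc := cocycle_cochain zc.
  have kc : kcochain c by apply: deg0_ker => // p; exact: vcocycle_src.
  have rc p : r c p = c p by exact: r0E.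
  have zk : kcocycle c.
    apply: r_cocycle_inv => // p cp; have [_ dc] := zc; rewrite -[RHS](dc p cp).
    by apply: vb_diff_agree cp => q _; exact: rc.
  exists (kclass c); first by exists c.
  rewrite Hr_class //; apply: (cclass_agree Lv) => //.
  exact: (cmap_cocycle (r_cochain_map _)).
Qed.

(** If [r v] and [r u] differ by the coboundary of a section of the core, that
    section lies in the kernel of the anchor, by [deg0_ker]. *)
Lemma Hr1_inj : set_inj (@cohomology _ _ _ _ _ GG (ker_complex VV) 1) (Hr (VV := VV) (k := 1)).
Proof.
move=> _ _ /set_mem[u zu <-] /set_mem[v zv <-]; rewrite !Hr_class // => Euv.
have zr : vcocycle (r v) by exact: (cmap_cocycle (r_cochain_map _)).
have : vclass (r u) (r v) by rewrite Euv; exact: (cclass_self Lv).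
move=> [_ /cohomologousP[h0 /coboundS[h Ch hE] Eh]].
have [ku kv] := (cocycle_cochain zu, cocycle_cochain zv).
have Ev p : composable p -> r v p = vadd (r u p) (vb_diff VV h p).
  by move=> cp; rewrite Eh // hE.
have kh : kcochain h.
  apply: deg0_ker => // p cp.
  have := congr1 S (Ev p cp); rewrite srcD; last first.
    by rewrite r_proj // (vb_cochain_proj (vb_cochain_diff Ch)).
  rewrite !r_src // v0add // proj_src.
  by rewrite (vb_cochain_proj (vb_cochain_diff Ch)).
apply: (cclass_eq Lk) => //; apply/cohomologousP.
have kN := kcochainZ (-1) kh.
exists (kdiff (fun q => vscale (-1) (h q))); first exact: cobound_diff.
move=> p cp; apply: (r_inj kv (kcochainD ku (kdiff_cochain kN)) cp).
rewrite rD //; last exact: kdiff_cochain.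
rewrite Ev //; congr vadd.
have -> : vb_diff VV h p = vb_diff VV (r h) p.
  by apply: vb_diff_agree cp => q _; rewrite r0E.
by rewrite r_diff0 // -rZ //; [rewrite /r_map kdiffZ|exact: kdiff_cochain].
Qed.

Lemma connecting_exact : regular VV -> long_exact_sequence VV (@connecting).
Proof.
move=> reg; split.
- split=> k.
  + exact: (induced_linear Lk Lv (r_cochain_map k)).
  + exact: (induced_linear Lv Lq (pi_cochain_map k)).
  + exact: connecting_linear.
- exact: Hr0_bij.
- exact: Hr1_inj.
- by move=> k; split; [exact: exact_VB|exact: exact_coker|exact: exact_ker].
Qed.

End LongExactSequence.

Theorem theorem1p5 (R : realType) (n d a b : nat)
    (M : manifold R n) (G : manifold R d) (GG : lie_groupoid M G)
    (E : vbundle M a) (V : vbundle G b) (VV : vb_groupoid GG E V) :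
  regular VV ->
  exists K : forall k : nat,
      classes (coker_complex VV) k -> classes (ker_complex VV) k.+2,
    long_exact_sequence VV K.
Proof. by move=> reg; exists (@connecting _ _ _ _ _ _ _ _ _ _ VV); exact: connecting_exact. Qed.
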